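(* Let $(Y_k)_{k\in\mathbb{N}}$ be i.i.d. symmetric Rademacher random variables, fix an integer $\ell\ge2$, and let $F_n=J_\ell(f_n)$ with $f_n\in\mathfrak{H}_0^{\odot\ell}$ for each $n\in\mathbb{N}$. Assume that $\ell!\,\|f_n\|^2_{\mathfrak{H}^{\otimes\ell}}=1$ for all $n$, that $$\big\|f_n\star_m^mf_n\big\|_{\mathfrak{H}^{\otimes(2\ell-2m)}}\longrightarrow0\quad\text{as }n\to\infty,\qquad\forall m=1,\dots,\ell-1,$$ and that the following two conditions hold: $$\sum_{n\ge2}\frac{1}{n\gamma_n^3}\sum_{k,j=1}^n\frac{\big|\langle f_k,f_j\rangle_{\mathfrak{H}^{\otimes\ell}}\big|}{kj}<+\infty,$$ $$\sum_{n\ge2}\frac{1}{n\gamma_n^2}\sum_{k=1}^n\frac1k\,\big\|f_k\star_m^mf_k\big\|_{\mathfrak{H}^{\otimes(2\ell-2m)}}<+\infty,\qquad\forall m=1,\dots,\ell-1.$$ Then the almost sure central limit theorem (ASCLT) holds for $(F_n)_{n\in\mathbb{N}}$.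
   Context: $\mathbb{N}=\{1,2,\dots\}$ and $\gamma_n=\sum_{k=1}^nk^{-1}$. $(Y_k)_{k\in\mathbb{N}}$ i.i.d. symmetric Rademacher means independent with $P(Y_k=1)=P(Y_k=-1)=1/2$. $\mathfrak{H}=\ell^2(\mathbb{N})$, $\mathfrak{H}^{\otimes n}=\ell^2(\mathbb{N}^n)$, $\Delta_n=\{(i_1,\dots,i_n)\in\mathbb{N}^n: i_k\ne i_j \text{ for } k\neq j\}$, and $\mathfrak{H}_0^{\odot n}$ is the set of symmetric $f\in\mathfrak{H}^{\otimes n}$ vanishing off $\Delta_n$. For $f\in\mathfrak{H}_0^{\odot n}$, $J_n(f)=\sum_{(i_1,\dots,i_n)\in\Delta_n}f(i_1,\dots,i_n)Y_{i_1}\cdots Y_{i_n}$ (in $L^2$). Star-contraction: for $f\in\mathfrak{H}^{\otimes n}$, $g\in\mathfrak{H}^{\otimes m}$ and $0\le r\le n\wedge m$, $f\star_r^rg\in\mathfrak{H}^{\otimes(n+m-2r)}$ is $$f\star_r^rg(i_1,\dots,i_{n-r},j_1,\dots,j_{m-r})=\sum_{a_1,\dots,a_r\in\mathbb{N}}f(i_1,\dots,i_{n-r},a_1,\dots,a_r)\,g(j_1,\dots,j_{m-r},a_1,\dots,a_r).$$ ASCLT: given a sequence $(G_n)$ of real random variables converging in law to $Z\sim\mathscr{N}(0,1)$, the ASCLT holds for $(G_n)$ if, almost surely, for every bounded continuous $f:\mathbb{R}\to\mathbb{R}$, $\frac{1}{\log n}\sum_{k=1}^n\frac1kf(G_k)\to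 E[f(Z)]$ as $n\to\infty$ (equivalently with $\log n$ replaced by $\gamma_n$). *)

(* Defs.v *)
From HB Require Import structures.
From mathcomp Require Import all_boot all_order all_algebra all_fingroup finmap.
From mathcomp Require Import all_classical all_reals all_analysis.
From mathcomp Require showcase.summability.

Set Implicit Arguments.
Unset Strict Implicit.
Unset Printing Implicit Defensive.

Import Order.TTheory GRing.Theory Num.Theory.
Import numFieldNormedType.Exports.

Local Open Scope classical_set_scope.
Local Open Scope ring_scope.

Definition gamma {R : realType} (n : nat) : R := \sum_(1 <= k < n.+1) k%:R^-1.

(* The coordinates of l^2(N^n), and the variables Y_k, are indexed by nat
   (starting at 0) instead of {1, 2, ...}: this is a mere relabelling. *)
Section square_summable_kernels.
Context {R : realType}.

(* Sum of an absolutely summable family of reals (the value is not meaningful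
   for other families). *)
Definition sumR (T : choiceType) (u : T -> R) : R :=
  fine (\esum_(x in [set: T]) (EFin \o u)^\+ x
        - \esum_(x in [set: T]) (EFin \o u)^\- x)%E.

Definition l2 (T : choiceType) (u : T -> R) : Prop :=
  (\esum_(x in [set: T]) (u x ^+ 2)%:E < +oo)%E.

Definition l2_dot (T : choiceType) (u v : T -> R) : R :=
  sumR (fun x => u x * v x).

Definition l2_norm (T : choiceType) (u : T -> R) : R := Num.sqrt (l2_dot u u).

Definition symmetric_kernel (n : nat) (f : n.-tuple nat -> R) : Prop :=
  forall (s : 'S_n) (t : n.-tuple nat), f [tuple tnth t (s k) | k < n] = f t.

Definition sym_offdiag_kernel (n : nat) (f : n.-tuple nat -> R) : Prop :=
  [/\ l2 f, symmetric_kernel f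
    & forall t : n.-tuple nat, ~~ uniq t -> f t = 0].

(* Used below only on sequences of size n, for which it is just a cast. *)
Definition to_tuple (n : nat) (s : seq nat) : n.-tuple nat :=
  [tuple nth 0%N s k | k < n].

(* Meaningful for r <= minn n m: the first n - r entries of t are the i's, the
   m - r following ones are the j's. *)
Definition star (n m r : nat) (f : n.-tuple nat -> R) (g : m.-tuple nat -> R)
    : (n + m - 2 * r).-tuple nat -> R :=
  fun t => sumR (fun a : r.-tuple nat =>
    f (to_tuple n (take (n - r) t ++ a)) * g (to_tuple m (drop (n - r) t ++ a))).

End square_summable_kernels.

Arguments star {R n m} r f g.

Section probability_notions.
Context {d : measure_display} {T : measurableType d} {R : realType}
  (P : probability T R).

Definition independent_RV (Y : nat -> {RV P >-> R}) : Prop :=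
  forall (J : {fset nat}) (B : nat -> set R), (forall k, measurable (B k)) ->
    P (\bigcap_(k in [set` J]) Y k @^-1` B k)
    = (\prod_(k <- J) P (Y k @^-1` B k))%E.

Definition iid_rademacher (Y : nat -> {RV P >-> R}) : Prop :=
  independent_RV Y /\
  forall k, P (Y k @^-1` [set 1]) = (2^-1)%:E
         /\ P (Y k @^-1` [set -1]) = (2^-1)%:E.

Definition partial_J (Y : nat -> {RV P >-> R}) (n : nat)
    (f : n.-tuple nat -> R) (A : {fset n.-tuple nat}) : T -> R :=
  fun w => \sum_(t <- A | uniq t) f t * \prod_(k < n) Y (tnth t k) w.

(* F is (a version of) J_n(f): the sum over Delta_n converges to F in L^2,
   unconditionally (along the finite sets of indices ordered by inclusion). *)
Definition is_J (Y : nat -> {RV P >-> R}) (n : nat) (f : n.-tuple nat -> R)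
    (F : {RV P >-> R}) : Prop :=
  ('E_P[fun w => ((F w - partial_J Y f A w) ^+ 2)%R])%E
    @[A --> summability.totally] --> (0%E : \bar R).

Definition bounded_continuous (phi : R -> R) : Prop :=
  continuous phi /\ bounded_fun phi.

Definition cvg_law_std_normal (G : nat -> {RV P >-> R}) : Prop :=
  forall phi : R -> R, bounded_continuous phi ->
    \int[P]_w phi (G n w) @[n --> \oo] --> \int[normal_prob 0 1]_x phi x.

(* Convergence in law to N(0, 1) is part of the notion; G 0 is irrelevant. *)
Definition ASCLT (G : nat -> {RV P >-> R}) : Prop :=
  cvg_law_std_normal G /\
  {ae P, forall w, forall phi : R -> R, bounded_continuous phi ->
    (ln n%:R)^-1 * (\sum_(1 <= k < n.+1) k%:R^-1 * phi (G k w)) @[n --> \oo]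
    --> \int[normal_prob 0 1]_x phi x}.

End probability_notions.

(* Main.v *)
(* The Ibragimov-Lifshits criterion: to get the ASCLT it suffices to bound the second moments of
   the logarithmic averages of h(F_k) - E h(Z), with weights 1 / (n gamma_n^3), for h in a countable
   class which determines convergence in law; here h runs over the functions cos (q x) and
   sin (q x), q rational, and sinc (x / m), which gives tightness as in Levy's theorem.
   A product of two such trigonometric functions of F_k and F_j is a sum of trigonometric
   functions of F_k + F_j and F_k - F_j, hence everything follows from a quantitative central
   limit theorem for characteristic functions of elements of one Rademacher chaos.  On a finite
   cube, Stein's method with the discrete gradient D_k bounds the error by the variance of
   sum_k (D_k F)^2, computed from the contractions, and by sum_k E (D_k F)^4, which hypercontractivity
   (Bonami) reduces to the contraction of order l - 1.  Square summability of the kernels passes the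
   bound to the infinite sequence. *)

Require Import Defs.
From HB Require Import structures.
From mathcomp Require Import all_boot all_order all_algebra all_fingroup finmap.
From mathcomp Require Import all_classical all_reals all_analysis.
From mathcomp Require Import measurable_realfun.
From mathcomp Require Import ring lra zify.

Set Implicit Arguments.
Unset Strict Implicit.
Unset Printing Implicit Defensive.

Import Order.TTheory GRing.Theory Num.Theory.
Import numFieldNormedType.Exports.

Local Open Scope classical_set_scope.
Local Open Scope ring_scope.

(** * Walsh polynomials on the discrete cube *)

Section cube.
Context {R : realType} (N : nat).
Local Notation Q := {ffun 'I_N -> bool}.
Implicit Types (x : Q) (k : 'I_N) (A B C S U : {set 'I_N}) (c : {set 'I_N} -> R).

(** The tests are trigonometric because a Walsh polynomial is affine in each sign, F = a + s D with
    a and D free of s: the addition formulas split cos (t F) and sin (t F) exactly, so the discrete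
    setting, which has no chain rule, costs a single remainder, sin y - y cos y of order y^3. The
    covariance of the tests at F_k and F_j needs the laws of F_k + F_j and F_k - F_j, whose
    variances 2 + 2 rho and 2 - 2 rho, with rho = l! <f_k, f_j>, shift the Gaussian value by at most
    a multiple of |rho|: this is the origin of the first series in the hypotheses. The second one
    comes from the contraction norms of f_k and f_j, where summing over the absent index yields one
    factor gamma_n. The obstacle is that contractions of f_k + f_j contain mixed ones, on which
    nothing is assumed; exchanging free and contracted variables bounds them by contractions of each
    kernel alone. The rate must be linear in the norms to match the series: the energy is quadratic
    in them, its square root linear, and norms above 1 are absorbed by a trivial bound. *)

Definition sgnc k x : R := (-1) ^+ (x k).

Definition walsh S x : R := \prod_(k in S) sgnc k x.

Definition flip k x : Q := [ffun i => x i (+) (i == k)].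

Definition avg (H : Q -> R) : R := (2 ^+ N)^-1 * \sum_x H x.

Definition wpoly c x : R := \sum_S c S * walsh S x.

(* With [F = wpoly c], [wpoly (wdiff c k)] is the discrete gradient D_k F. *)
Definition wdiff c k S : R := if k \in S then 0 else c (k |: S).

Definition wrest c k S : R := if k \in S then 0 else c S.

Lemma sgnc_sq k x : sgnc k x * sgnc k x = 1.
Proof. by rewrite /sgnc -expr2 sqrr_sign. Qed.

Lemma flipK k : involutive (flip k).
Proof. by move=> x; apply/ffunP => i; rewrite !ffunE -addbA addbb addbF. Qed.

Lemma sgnc_flip k x : sgnc k (flip k x) = - sgnc k x.
Proof. by rewrite /sgnc ffunE eqxx addbT; case: (x k); rewrite /= ?expr0 ?expr1 ?opprK. Qed.

Lemma sgnc_flip_neq i k x : i != k -> sgnc i (flip k x) = sgnc i x.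
Proof. by rewrite /sgnc ffunE => /negbTE ->; rewrite addbF. Qed.

Lemma walsh_flip_notin k S x : k \notin S -> walsh S (flip k x) = walsh S x.
Proof.
move=> kS; apply: eq_bigr => i iS; apply: sgnc_flip_neq.
by apply: contraNneq kS => <-.
Qed.

Lemma walshU1 k S x : k \notin S -> walsh (k |: S) x = sgnc k x * walsh S x.
Proof. by move=> kS; rewrite /walsh big_setU1. Qed.

Lemma walshD1 k S x : k \in S -> walsh S x = sgnc k x * walsh (S :\ k) x.
Proof. by move=> kS; rewrite /walsh (big_setD1 k). Qed.

Lemma avg_flip k (H : Q -> R) : avg (fun x => H (flip k x)) = avg H.
Proof.
rewrite /avg; congr (_ * _).
by rewrite [RHS](reindex_inj (can_inj (flipK k))).
Qed.

Lemma avgD (H1 H2 : Q -> R) : avg (fun x => H1 x + H2 x) = avg H1 + avg H2.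
Proof. by rewrite /avg big_split mulrDr. Qed.

Lemma avgZ a (H : Q -> R) : avg (fun x => a * H x) = a * avg H.
Proof. by rewrite /avg -mulr_sumr mulrCA. Qed.

Lemma avgN (H : Q -> R) : avg (fun x => - H x) = - avg H.
Proof. by rewrite /avg sumrN mulrN. Qed.

Lemma avgB (H1 H2 : Q -> R) : avg (fun x => H1 x - H2 x) = avg H1 - avg H2.
Proof. by rewrite avgD avgN. Qed.

Lemma avg_sum (I : Type) (r : seq I) (P : pred I) (H : I -> Q -> R) :
  avg (fun x => \sum_(i <- r | P i) H i x) = \sum_(i <- r | P i) avg (H i).
Proof. by rewrite /avg exchange_big mulr_sumr. Qed.

Lemma eq_avg (H1 H2 : Q -> R) : H1 =1 H2 -> avg H1 = avg H2.
Proof. by move=> e; rewrite /avg; congr (_ * _); apply: eq_bigr => x _. Qed.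

Lemma avg_ge0 (H : Q -> R) : (forall x, 0 <= H x) -> 0 <= avg H.
Proof.
move=> h; rewrite mulr_ge0 ?invr_ge0 ?exprn_ge0 ?ler0n //.
by apply: sumr_ge0.
Qed.

Lemma ler_avg (H1 H2 : Q -> R) : (forall x, H1 x <= H2 x) -> avg H1 <= avg H2.
Proof.
by move=> h; rewrite -subr_ge0 -avgB; apply: avg_ge0 => x; rewrite subr_ge0.
Qed.

Lemma avg_cst (a : R) : avg (fun=> a) = a.
Proof.
rewrite /avg sumr_const card_ffun card_bool card_ord -[a *+ _]mulr_natl natrX mulrA.
by rewrite mulVf ?mul1r // expf_neq0 // pnatr_eq0.
Qed.

Lemma ler_norm_avg (H : Q -> R) : `|avg H| <= avg (fun x => `|H x|).
Proof.
rewrite ler_norml -avgN; apply/andP; split; apply: ler_avg => x.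
  by rewrite lerNl -normrN ler_norm.
exact: ler_norm.
Qed.

Lemma avg_sqr_le (H : Q -> R) : (avg H) ^+ 2 <= avg (fun x => H x ^+ 2).
Proof.
rewrite -subr_ge0.
have -> : avg (fun x => H x ^+ 2) - avg H ^+ 2 = avg (fun x => (H x - avg H) ^+ 2).
  rewrite (@eq_avg (fun x => (H x - avg H) ^+ 2) (fun x => H x ^+ 2 - (avg H * 2) * H x + avg H ^+ 2)); last first.
    by move=> x /=; ring.
  rewrite avgD avgB avgZ avg_cst -/(avg H) [avg (fun x => H x)]/(avg H).
  set a := avg H; set b := avg (fun x => H x ^+ 2). ring.
by apply: avg_ge0 => x; exact: sqr_ge0.
Qed.

Lemma avg_CS (H1 H2 : Q -> R) :
  (avg (fun x => H1 x * H2 x)) ^+ 2 <=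
  avg (fun x => H1 x ^+ 2) * avg (fun x => H2 x ^+ 2).
Proof.
set a := avg (fun x => H1 x ^+ 2); set b := avg (fun x => H1 x * H2 x).
set e := avg (fun x => H2 x ^+ 2).
have a0 : 0 <= a by apply: avg_ge0 => x; exact: sqr_ge0.
have quad (u v : R) : 0 <= u ^+ 2 * a + 2 * u * v * b + v ^+ 2 * e.
  have -> : u ^+ 2 * a + 2 * u * v * b + v ^+ 2 * e =
            avg (fun x => (u * H1 x + v * H2 x) ^+ 2).
    rewrite -!avgZ -!avgD; apply: eq_avg => x; ring.
  by apply: avg_ge0 => x; exact: sqr_ge0.
have [a_eq0|a_neq0] := eqVneq a 0.
  have := quad 1 0; have h := quad.
  have [->|bn0] := eqVneq b 0; first by rewrite a_eq0 expr0n mul0r.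
  (* With a = 0 the quadratic form is affine in its first argument; this value makes it equal to
     -1. *)
  have := h (- (e + 1) / (2 * b)) 1; rewrite a_eq0.
  have -> : (- (e + 1) / (2 * b)) ^+ 2 * 0 + 2 * (- (e + 1) / (2 * b)) * 1 * b + 1 ^+ 2 * e = - 1.
    by field; exact: bn0.
  by rewrite oppr_ge0 ler10.
have := quad (- b) a.
have -> : (- b) ^+ 2 * a + 2 * - b * a * b + a ^+ 2 * e = a * (a * e - b ^+ 2) by ring.
by rewrite pmulr_rge0 ?subr_ge0 // lt_def a_neq0 a0.
Qed.

(** Flipping a sign of S preserves the average and negates the character, so the average of a
    nonconstant character is its own opposite. *)
Lemma avg_walsh S : avg (walsh S) = (S == finset.set0)%:R.
Proof.
have [->|[k kS]] := set_0Vmem S.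
  by rewrite eqxx (@eq_avg _ (fun=> 1)) ?avg_cst // => x; rewrite /walsh big_set0.
have -> : (S == finset.set0) = false by apply: contraTF kS => /eqP ->; rewrite inE.
suff : avg (walsh S) = - avg (walsh S) by move=> h; rewrite /=; lra.
rewrite -{1}(avg_flip k) -avgN; apply: eq_avg => x.
by rewrite (walshD1 _ kS) sgnc_flip walsh_flip_notin ?setD11 // (walshD1 x kS) mulNr.
Qed.

Definition symdiff S U : {set 'I_N} := (S :\: U) :|: (U :\: S).

Lemma in_symdiff i S U : (i \in symdiff S U) = (i \in S) (+) (i \in U).
Proof. by rewrite !inE; case: (i \in S); case: (i \in U). Qed.

(** Walsh functions are the characters of the group of subsets under symmetric difference: squares
    of signs disappear. *)
Lemma walsh_mul S U x : walsh S x * walsh U x = walsh (symdiff S U) x.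
Proof.
rewrite /walsh [X in X * _]big_mkcond [X in _ * X]big_mkcond [RHS]big_mkcond -big_split /=; apply: eq_bigr => i _.
by rewrite in_symdiff; case: (i \in S); case: (i \in U); rewrite /= ?sgnc_sq ?mul1r ?mulr1.
Qed.

Lemma symdiff_eq0 S U : (symdiff S U == finset.set0) = (S == U).
Proof.
apply/eqP/eqP => [/setP e|->]; apply/setP => i; last by rewrite in_symdiff addbb inE.
by have := e i; rewrite in_symdiff !inE; case: (i \in S); case: (i \in U).
Qed.

Lemma avg_wpolyM c1 c2 :
  avg (fun x => wpoly c1 x * wpoly c2 x) = \sum_S c1 S * c2 S.
Proof.
rewrite (@eq_avg _ (fun x => \sum_S \sum_U (c1 S * c2 U) * walsh (symdiff S U) x)).
  rewrite avg_sum; apply: eq_bigr => S _; rewrite avg_sum (bigD1 S) //=.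
  rewrite avgZ avg_walsh symdiff_eq0 eqxx mulr1 big1 ?addr0 // => U US.
  by rewrite avgZ avg_walsh symdiff_eq0 eq_sym (negbTE US) mulr0.
move=> x; rewrite /wpoly mulr_suml; apply: eq_bigr => S _; rewrite mulr_sumr.
by apply: eq_bigr => U _; rewrite -walsh_mul; ring.
Qed.

Lemma avg_wpoly_sqr c : avg (fun x => wpoly c x ^+ 2) = \sum_S c S ^+ 2.
Proof. by rewrite avg_wpolyM. Qed.

(** [wrest c k] carries the average of F over the k-th sign and [wdiff c k] half of its jump, and
    neither depends on that sign. This exact affine form drives both the induction of [bonami] and
    the integration by parts of [stein_bound]. *)
Lemma wpoly_split c k x :
  wpoly c x = wpoly (wrest c k) x + sgnc k x * wpoly (wdiff c k) x.
Proof.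
rewrite /wpoly (bigID (fun S : {set 'I_N} => k \notin S)) /=; congr (_ + _).
  rewrite [RHS](bigID (fun S : {set 'I_N} => k \notin S)) /= [X in _ + X]big1 ?addr0.
    by apply: eq_bigr => S kS; rewrite /wrest (negbTE kS).
  by move=> S; rewrite negbK /wrest => ->; rewrite mul0r.
rewrite [X in _ = _ * X](bigID (fun S : {set 'I_N} => k \notin S)) /= [X in _ = _ * (_ + X)]big1 ?addr0; last first.
  by move=> S; rewrite negbK /wdiff => ->; rewrite mul0r.
rewrite mulr_sumr (reindex_onto (fun S : {set 'I_N} => k |: S) (fun S : {set 'I_N} => S :\ k)) /=; last first.
  by move=> S; rewrite negbK => kS; rewrite finset.setD1K.
apply: eq_big => [S|S].
  rewrite setU11 /=; apply/eqP/idP => [<-|kS]; first by rewrite setD11.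
  by rewrite setU1K.
rewrite setU11 /= => /eqP e.
have kS : k \notin S by rewrite -e setD11.
by rewrite /wdiff (negbTE kS) walshU1 //; ring.
Qed.

Lemma wpoly_rest_flip c k x : wpoly (wrest c k) (flip k x) = wpoly (wrest c k) x.
Proof.
apply: eq_bigr => S _; rewrite /wrest; case: ifPn => kS; first by rewrite !mul0r.
by rewrite walsh_flip_notin.
Qed.

Lemma wpoly_diff_flip c k x : wpoly (wdiff c k) (flip k x) = wpoly (wdiff c k) x.
Proof.
apply: eq_bigr => S _; rewrite /wdiff; case: ifPn => kS; first by rewrite !mul0r.
by rewrite walsh_flip_notin.
Qed.

End cube.

(** * Hypercontractivity on the discrete cube *)

Section bonami.
Context {R : realType} (N : nat).
Local Notation Q := {ffun 'I_N -> bool}.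
Implicit Types (x : Q) (k : 'I_N) (A B C S U : {set 'I_N}) (c : {set 'I_N} -> R).

Lemma sum_sqr_le (I : finType) (P : pred I) (F : I -> R) :
  (\sum_(i | P i) F i) ^+ 2 <= #|P|%:R * \sum_(i | P i) F i ^+ 2.
Proof.
have -> : (\sum_(i | P i) F i) ^+ 2 = \sum_(i | P i) \sum_(j | P j) F i * F j.
  by rewrite expr2 mulr_suml; apply: eq_bigr => i _; rewrite mulr_sumr.
have -> : #|P|%:R * \sum_(i | P i) F i ^+ 2 =
    \sum_(i | P i) \sum_(j | P j) (F i ^+ 2 + F j ^+ 2) / 2.
  have e : \sum_(i | P i) \sum_(j | P j) F i ^+ 2 = #|P|%:R * \sum_(i | P i) F i ^+ 2.
    rewrite mulr_sumr; apply: eq_bigr => i _.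
    by rewrite sumr_const mulr_natl.
  under [RHS]eq_bigr => i _ do rewrite -mulr_suml big_split /=.
  rewrite -mulr_suml big_split /= [X in (_ + X)]exchange_big /= e.
  by field.
apply: ler_sum => i _; apply: ler_sum => j _.
have := sqr_ge0 (F i - F j); nra.
Qed.

Lemma avg_odd k (H : Q -> R) : (forall x, H (flip k x) = - H x) -> avg H = 0.
Proof.
move=> h; suff : avg H = - avg H by move=> e; lra.
by rewrite -{1}(avg_flip k) -avgN; apply: eq_avg => x.
Qed.

(** Induction on the number n of active signs, the degree being free. With F = a + s b the odd terms
    average out: E F^4 = E a^4 + 6 E a^2 b^2 + E b^4, where b has one degree less than F. If b has
    degree d, Cauchy-Schwarz bounds the middle term by 6 sqrt(9) 9^d E a^2 E b^2; the number 9 is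
    the one for which 6 sqrt(9) = 2 . 9, so that this is exactly the cross term of 9^(d+1) (E a^2 +
    E b^2)^2. *)
Lemma bonami n d c : (forall S, c S != 0 -> (#|S| <= d)%N) ->
    (forall S, c S != 0 -> forall i, i \in S -> (i < n)%N) ->
  avg (fun x => wpoly c x ^+ 4) <= 9 ^+ d * avg (fun x => wpoly c x ^+ 2) ^+ 2.
Proof.
elim: n d c => [|n IHn] d c cd cn.
  have wc x : wpoly c x = c finset.set0.
    rewrite /wpoly (bigD1 finset.set0) //= big1 ?addr0.
      by rewrite /walsh big_set0 mulr1.
    move=> S S0; have [->|/cn h] := eqVneq (c S) 0; first by rewrite mul0r.
    have [e|[i iS]] := set_0Vmem S; first by rewrite e eqxx in S0.
    by have := h i iS.
  rewrite (@eq_avg _ _ _ (fun=> c finset.set0 ^+ 4)); last by move=> x; rewrite wc.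
  rewrite (@eq_avg _ _ (fun x => wpoly c x ^+ 2) (fun=> c finset.set0 ^+ 2)); last by move=> x; rewrite wc.
  rewrite !avg_cst -exprM ler_peMl ?exprn_even_ge0 //.
  by rewrite exprn_ege1 // ler1n.
(* [n] may exceed [N]; from [N] on there is no sign left to split and the induction hypothesis
   applies as it is. *)
case: (ltnP n N) => nN; last first.
  apply: (IHn _ _ cd) => S cS i _; exact: leq_trans (ltn_ord i) nN.
case: d cd => [|d] cd.
  apply: (IHn _ _ cd) => S cS i iS.
  by have := cd S cS; rewrite leqn0 cards_eq0 => /eqP e; rewrite e inE in iS.
have [k kn] : exists k : 'I_N, val k = n by exists (Ordinal nN).
pose a x := wpoly (wrest c k) x; pose b x := wpoly (wdiff c k) x.
have ltk S i : c S != 0 -> i \in S -> i != k -> (i < n)%N.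
  move=> cS iS ik; have := cn S cS i iS; rewrite ltnS leq_eqVlt => /orP[/eqP e|//].
  by move/eqP: ik; case; apply/val_inj; rewrite kn.
have Ha : avg (fun x => a x ^+ 4) <= 9 ^+ d.+1 * avg (fun x => a x ^+ 2) ^+ 2.
  apply: IHn => S; rewrite /wrest; case: ifPn => kS; rewrite ?eqxx // => cS.
    exact: cd.
  by move=> i iS; apply: (ltk _ _ cS iS); apply: contraNneq kS => <-.
have Hb : avg (fun x => b x ^+ 4) <= 9 ^+ d * avg (fun x => b x ^+ 2) ^+ 2.
  apply: IHn => S; rewrite /wdiff; case: ifPn => kS; rewrite ?eqxx // => cS.
    by have := cd _ cS; rewrite cardsU1 kS.
  move=> i iS; apply: (ltk _ _ cS); first by rewrite !inE iS orbT.
  by apply: contraNneq kS => <-.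
have af x : a (flip k x) = a x by exact: wpoly_rest_flip.
have bf x : b (flip k x) = b x by exact: wpoly_diff_flip.
have e2 : avg (fun x => wpoly c x ^+ 2) = avg (fun x => a x ^+ 2) + avg (fun x => b x ^+ 2).
  rewrite -avgD -[RHS]addr0 -(@avg_odd k (fun x => sgnc k x * (2 * a x * b x))).
    rewrite -avgD; apply: eq_avg => x; rewrite (wpoly_split c k) -/(a x) -/(b x).
    by have := @sgnc_sq R _ k x; set s := sgnc k x => ss; ring: ss.
  by move=> x; rewrite sgnc_flip af bf mulNr.
have e4 : avg (fun x => wpoly c x ^+ 4) = avg (fun x => a x ^+ 4) +
    6 * avg (fun x => a x ^+ 2 * b x ^+ 2) + avg (fun x => b x ^+ 4).
  rewrite -avgZ -!avgD -[RHS]addr0.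
  rewrite -(@avg_odd k (fun x => sgnc k x * (4 * a x ^+ 3 * b x + 4 * a x * b x ^+ 3))).
    rewrite -avgD; apply: eq_avg => x; rewrite (wpoly_split c k) -/(a x) -/(b x).
    by have := @sgnc_sq R _ k x; set s := sgnc k x => ss; ring: ss.
  by move=> x; rewrite sgnc_flip af bf mulNr.
rewrite e2 e4.
have := avg_CS (fun x => a x ^+ 2) (fun x => b x ^+ 2).
rewrite (@eq_avg _ _ (fun x => (a x ^+ 2) ^+ 2) (fun x => a x ^+ 4)); last by move=> x; rewrite -exprM.
rewrite (@eq_avg _ _ (fun x => (b x ^+ 2) ^+ 2) (fun x => b x ^+ 4)); last by move=> x; rewrite -exprM.
have a20 : 0 <= avg (fun x => a x ^+ 2) by apply: avg_ge0 => x; exact: sqr_ge0.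
have b20 : 0 <= avg (fun x => b x ^+ 2) by apply: avg_ge0 => x; exact: sqr_ge0.
have a40 : 0 <= avg (fun x => a x ^+ 4) by apply: avg_ge0 => x; exact: exprn_even_ge0.
have b40 : 0 <= avg (fun x => b x ^+ 4) by apply: avg_ge0 => x; exact: exprn_even_ge0.
have m0 : 0 <= avg (fun x => a x ^+ 2 * b x ^+ 2).
  by apply: avg_ge0 => x; rewrite mulr_ge0 ?sqr_ge0.
move: Ha Hb a20 b20 a40 b40 m0; rewrite exprS.
have : (0 : R) <= 9 ^+ d by rewrite exprn_ge0.
move: (9 ^+ d) (avg (fun x => a x ^+ 4)) (avg (fun x => a x ^+ 2)) (avg (fun x => b x ^+ 4))
  (avg (fun x => b x ^+ 2)) (avg (fun x => a x ^+ 2 * b x ^+ 2)) => t a4 a2 b4 b2 m.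
move=> t0 Ha Hb a20 b20 a40 b40 m0 CS.
have mle : m <= 3 * t * a2 * b2.
  rewrite -(@ler_pXn2r _ 2) ?nnegrE //; last by rewrite !mulr_ge0.
  apply: le_trans CS _.
  have -> : (3 * t * a2 * b2) ^+ 2 = (9 * t * a2 ^+ 2) * (t * b2 ^+ 2) by ring.
  exact: ler_pM.
nra.
Qed.

End bonami.

(** * Discrete gradient and contractions *)

Section carre_du_champ.
Context {R : realType} (N : nat).
Local Notation Q := {ffun 'I_N -> bool}.
Implicit Types (x : Q) (k : 'I_N) (A B C S U : {set 'I_N}) (c : {set 'I_N} -> R).

Definition homogeneous l c := forall S, c S != 0 -> #|S| = l.

(** The free variables are A and B, the contracted ones C. The size of C is no parameter: for [c]
    homogeneous of degree l only the sets with #|C| = l - #|A| contribute. *)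
Definition contr c A B : R :=
  \sum_(C : {set 'I_N} | [disjoint A & C] && [disjoint B & C]) c (A :|: C) * c (B :|: C).

(** Contractions of all orders 1, ..., l - 1 together. [A] and [B] may meet: the diagonal A = B is
    what [sum_avg_diff4] uses. *)
Definition contr_energy l c : R :=
  \sum_(A : {set 'I_N} | (0 < #|A| < l)%N) \sum_(B : {set 'I_N}) contr c A B ^+ 2.

Definition gradsq c x : R := \sum_k wpoly (wdiff c k) x ^+ 2.

Lemma sgn_wpoly_diff c k x :
  sgnc k x * wpoly (wdiff c k) x = \sum_(S : {set 'I_N} | k \in S) c S * walsh S x.
Proof.
rewrite /wpoly (bigID (fun S : {set 'I_N} => k \notin S)) /= [X in (_ + X)]big1 ?addr0; last first.
  by move=> S; rewrite negbK /wdiff => ->; rewrite mul0r.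
rewrite mulr_sumr [RHS](reindex_onto (fun S : {set 'I_N} => k |: S) (fun S : {set 'I_N} => S :\ k)) /=; last first.
  by move=> S kS; rewrite finset.setD1K.
apply/esym; apply: eq_big => [S|S].
  rewrite setU11 /=; apply/eqP/idP => [<-|kS]; first by rewrite setD11.
  by rewrite setU1K.
rewrite setU11 /= => /eqP e.
have kS : k \notin S by rewrite -e setD11.
by rewrite /wdiff (negbTE kS) walshU1 //; ring.
Qed.

(** The number operator acts on a chaos of order l as multiplication by l. Stein's method needs the
    inverse of this operator, which is here a division by l. *)
Lemma euler_wpoly l c x : homogeneous l c ->
  \sum_k sgnc k x * wpoly (wdiff c k) x = l%:R * wpoly c x.
Proof.
move=> hc; under eq_bigr => k _ do rewrite sgn_wpoly_diff.
rewrite (exchange_big_dep predT) //= /wpoly mulr_sumr; apply: eq_bigr => S _.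
rewrite sumr_const; have [->|/hc <-] := eqVneq (c S) 0.
  by rewrite !mul0r mulr0 mul0rn.
by rewrite mulr_natl.
Qed.

(** Walsh coefficients of the sum of squared gradients: the pair S, [symdiff S U] contributes to the
    character U once for each common element k, and the common elements are those of S outside U. *)
Definition gradcoef c U : R :=
  \sum_(S : {set 'I_N}) #|S :\: U|%:R * (c S * c (symdiff S U)).

Lemma symdiffK S U : symdiff S (symdiff S U) = U.
Proof. by apply/setP => i; rewrite !in_symdiff addKb. Qed.

Lemma gradsqE c x : gradsq c x = wpoly (gradcoef c) x.
Proof.
rewrite /gradsq /wpoly.
transitivity (\sum_k \sum_(S : {set 'I_N} | k \in S) \sum_(U : {set 'I_N} | k \in U)
    (c S * c U * walsh (symdiff S U) x)).
  apply: eq_bigr => k _.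
  have -> : wpoly (wdiff c k) x ^+ 2 = (sgnc k x * wpoly (wdiff c k) x) ^+ 2.
    by rewrite exprMn [sgnc k x ^+ 2]expr2 sgnc_sq mul1r.
  rewrite sgn_wpoly_diff expr2 mulr_suml; apply: eq_bigr => S _.
  rewrite mulr_sumr; apply: eq_bigr => U _; rewrite -walsh_mul; ring.
transitivity (\sum_(S : {set 'I_N}) \sum_(U : {set 'I_N})
   #|S :&: U|%:R * (c S * c U * walsh (symdiff S U) x)).
  rewrite (exchange_big_dep predT) //=; apply: eq_bigr => S _.
  rewrite (exchange_big_dep predT) //=; apply: eq_bigr => U _.
  rewrite sumr_const mulr_natl; congr (_ *+ _); apply: eq_card => i.
  by rewrite !inE.
under eq_bigr => S _.
  rewrite (reindex_inj (can_inj (symdiffK S))) /=.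
  over.
rewrite exchange_big /=; apply: eq_bigr => U _; rewrite /gradcoef mulr_suml.
apply: eq_bigr => S _; rewrite symdiffK.
have -> : S :&: symdiff S U = S :\: U.
  by apply/setP => i; rewrite !inE; case: (i \in S); case: (i \in U).
by ring.
Qed.

Lemma gradcoef0 l c : homogeneous l c ->
  gradcoef c finset.set0 = l%:R * \sum_S c S ^+ 2.
Proof.
move=> hc; rewrite mulr_sumr; apply: eq_bigr => S _.
have -> : symdiff S finset.set0 = S by apply/setP => i; rewrite in_symdiff inE addbF.
rewrite finset.setD0; have [->|/hc ->] := eqVneq (c S) 0; last by [].
by rewrite expr0n !mul0r !mulr0.
Qed.

Lemma contr_neq0 l c A B : homogeneous l c -> contr c A B != 0 ->
  #|A| = #|B| /\ (#|A| <= l)%N.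
Proof.
move=> hc; rewrite /contr => h.
have [C /andP[/andP[AC BC]]] : exists C : {set 'I_N}, [disjoint A & C] && [disjoint B & C] &&
    (c (A :|: C) * c (B :|: C) != 0).
  apply/existsP; apply: contraNT h => /existsPn h; rewrite big1 // => C hC.
  by have := h C; rewrite hC /= negbK => /eqP.
rewrite mulf_eq0 negb_or => /andP[/hc cA /hc cB].
have e (X : {set 'I_N}) : [disjoint X & C]%B -> #|X :|: C| = (#|X| + #|C|)%N.
  by move=> XC; rewrite cardsU disjoint_setI0 // cards0 subn0.
rewrite !e // in cA cB; split; first by apply/eqP; rewrite -(eqn_add2r #|C|) cA cB.
by rewrite -cA leq_addr.
Qed.

(** Split S into its part A inside U and its part C outside. The partner [symdiff S U] is then the
    union of U minus A and C, and the multiplicity is #|C| = l - #|A|; grouping by A makes a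
    contraction appear. *)
Lemma gradcoefE l c U : homogeneous l c ->
  gradcoef c U = \sum_(A : {set 'I_N} | A \subset U) (l - #|A|)%:R * contr c A (U :\: A).
Proof.
move=> hc; rewrite /gradcoef (partition_big (fun S => S :&: U) (fun A : {set 'I_N} => A \subset U)) /=; last first.
  by move=> S _; exact: finset.subsetIr.
apply: eq_bigr => A AU; rewrite /contr mulr_sumr.
have AUP i : i \in A -> i \in U by move/fintype.subsetP: AU; exact.
rewrite (reindex_onto (fun C : {set 'I_N} => A :|: C) (fun S : {set 'I_N} => S :\: U)) /=; last first.
  by move=> S /eqP <-; apply/setP => i; rewrite !inE; case: (i \in S); case: (i \in U).
have dP (X Y : {set 'I_N}) : reflect (forall i, i \in X -> i \notin Y) [disjoint X & Y]%B.
  apply: (iffP pred0P) => h i; last first.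
    by apply/negbTE; rewrite /= negb_and; case iX: (i \in X) => //=; exact: h.
  by move=> iX; have := h i; rewrite /= iX /= => ->.
have cond C : ((A :|: C) :&: U == A) && ((A :|: C) :\: U == C) =
    [disjoint A & C] && [disjoint U :\: A & C].
  apply/andP/andP => [[/eqP/setP h1 /eqP/setP h2]|[/dP h1 /dP h2]].
    have CU i : i \in C -> i \notin U.
      by have := h2 i; rewrite !inE => <- /andP[].
    split; apply/dP => i.
      by move=> /AUP iU; apply/negP => /CU; rewrite iU.
    by rewrite inE => /andP[_ iU]; apply/negP => /CU; rewrite iU.
  have CU i : i \in C -> i \notin U.
    move=> iC; apply/negP => iU; case iA: (i \in A).
      by have := h1 i iA; rewrite iC.
    by have := h2 i; rewrite inE iA iU iC => /(_ isT).
  split; apply/eqP/setP => i; rewrite !inE;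
    have := @AUP i; have := CU i; case: (i \in A); case: (i \in C); case: (i \in U) => //= a b; (try by have := a isT); try by have := b isT.
apply: eq_big => [C|C]; first exact: cond.
rewrite cond => /andP[/dP h1 /dP h2].
have -> : (A :|: C) :\: U = C.
  by apply/eqP; have := cond C; rewrite (introT (dP _ _) h1) (introT (dP _ _) h2) => /andP[].
have -> : symdiff (A :|: C) U = (U :\: A) :|: C.
  apply/setP => i; rewrite in_symdiff !inE.
  have := @AUP i; have := h1 i; have := h2 i; rewrite inE.
  case: (i \in A); case: (i \in C); case: (i \in U) => //= a b e; (try by have := a isT); (try by have := b isT); try by have := e isT.
have [->|/hc <-] := eqVneq (c (A :|: C)) 0; first by rewrite !mul0r !mulr0.
by rewrite cardsU disjoint_setI0 ?cards0 ?subn0 ?addKn //; exact/dP.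
Qed.

(** A pair A inside U is the same as the disjoint pair A, U minus A; dropping disjointness only adds
    nonnegative terms. *)
Lemma sum_disjoint_pairs_le (F : {set 'I_N} -> {set 'I_N} -> R) (P : pred {set 'I_N}) :
  (forall A B, 0 <= F A B) ->
  \sum_(U : {set 'I_N}) \sum_(A : {set 'I_N} | (A \subset U) && P A) F A (U :\: A) <=
  \sum_(A : {set 'I_N} | P A) \sum_(B : {set 'I_N}) F A B.
Proof.
move=> F0; rewrite (exchange_big_dep P) /=; last by move=> U A _ /andP[].
apply: ler_sum => A PA.
rewrite (reindex_onto (fun B : {set 'I_N} => A :|: B) (fun U : {set 'I_N} => U :\: A)) /=; last first.
  move=> U /andP[/fintype.subsetP AU _]; apply/setP => i; rewrite !inE.
  by have := AU i; case: (i \in A) => //= ->.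
rewrite (eq_bigr (fun B => F A B)); last by move=> B /andP[_ /eqP ->].
rewrite big_mkcond /=; apply: ler_sum => B _; by case: ifP.
Qed.

(** The extreme sizes drop out: a set A of size l has multiplicity 0, and a nonzero contraction
    forces #|U| = 2 #|A|, so that A empty would mean U empty. The contractions of orders 1, ..., l -
    1 remain. *)
Lemma gradcoef_sqr_le l c U : homogeneous l c -> U != finset.set0 ->
  gradcoef c U ^+ 2 <= 4 ^+ l * l%:R ^+ 2 *
    \sum_(A : {set 'I_N} | (A \subset U) && (0 < #|A| < l)%N) contr c A (U :\: A) ^+ 2.
Proof.
move=> hc U0; rewrite (gradcoefE _ hc).
have cardU (A : {set 'I_N}) : A \subset U -> contr c A (U :\: A) != 0 ->
    #|U| = (#|A| + #|A|)%N /\ (#|A| <= l)%N.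
  move=> AU /(contr_neq0 hc)[e1 e2]; split=> //.
  by rewrite {2}e1 addnC cardsD (finset.setIidPr AU) subnK // subset_leq_card.
have e : \sum_(A : {set 'I_N} | A \subset U) (l - #|A|)%:R * contr c A (U :\: A) =
   \sum_(A : {set 'I_N} | (A \subset U) && (0 < #|A| < l)%N) (l - #|A|)%:R * contr c A (U :\: A).
  rewrite (bigID (fun A : {set 'I_N} => (0 < #|A| < l)%N)) /= [X in _ + X]big1 ?addr0 //.
  move=> A /andP[AU]; rewrite negb_and -!leqNgt leqn0 => /orP[/eqP A0|lA].
    have [->|/(cardU _ AU)[]] := eqVneq (contr c A (U :\: A)) 0; first by rewrite mulr0.
    by rewrite A0 addn0 => /eqP; rewrite cards_eq0 (negbTE U0).
  by move: lA; rewrite -subn_eq0 => /eqP ->; rewrite mul0r.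
rewrite e.
(* Above size 2 l all the contractions vanish; otherwise U has at most 4^l subsets, which is the
   constant in Cauchy-Schwarz. *)
have [big|small] := ltnP (l + l) #|U|.
  rewrite big1 ?expr0n /=; last first.
    move=> A /andP[AU _]; have [->|/(cardU _ AU)[eU lA]] := eqVneq (contr c A (U :\: A)) 0.
      by rewrite mulr0.
    by move: big; rewrite eU ltnNge leq_add.
  rewrite !mulr_ge0 ?exprn_ge0 ?ler0n //; apply: sumr_ge0 => A _; exact: sqr_ge0.
apply: le_trans (sum_sqr_le _ _) _.
rewrite -mulrA ler_pM ?ler0n //.
- by apply: sumr_ge0 => A _; exact: sqr_ge0.
- have : (#|[pred A : {set 'I_N} | (A \subset U) && (0 < #|A| < l)%N]| <= 4 ^ l)%N.
    apply: (@leq_trans (2 ^ #|U|)).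
      rewrite -card_powerset; apply: subset_leq_card; apply/fintype.subsetP => A.
      by rewrite !inE => /andP[].
    by rewrite (_ : 4 = 2 ^ 2)%N // -expnM leq_exp2l // mul2n -addnn.
  by rewrite -(ler_nat R) natrX.
- rewrite mulr_sumr; apply: ler_sum => A /andP[AU _].
  rewrite exprMn ler_wpM2r ?sqr_ge0 // ler_sqr ?nnegrE ?ler0n // ler_nat.
  exact: leq_subr.
Qed.

Lemma avg_gradsq_variance l c : homogeneous l c ->
  avg (fun x => (gradsq c x - l%:R * \sum_S c S ^+ 2) ^+ 2) <=
  4 ^+ l * l%:R ^+ 2 * contr_energy l c.
Proof.
move=> hc; pose v U := if U == finset.set0 then 0 else gradcoef c U.
have -> : avg (fun x => (gradsq c x - l%:R * \sum_S c S ^+ 2) ^+ 2) = avg (fun x => wpoly v x ^+ 2).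
  apply: eq_avg => x; rewrite gradsqE /wpoly -(gradcoef0 hc); congr (_ ^+ 2).
  rewrite (bigD1 finset.set0) //= [RHS](bigD1 finset.set0) //= /v eqxx mul0r add0r.
  rewrite /walsh big_set0 mulr1 addrAC subrr add0r.
  by apply: eq_bigr => U /negbTE ->.
rewrite avg_wpoly_sqr.
have vle U : v U ^+ 2 <= 4 ^+ l * l%:R ^+ 2 *
    \sum_(A : {set 'I_N} | (A \subset U) && (0 < #|A| < l)%N) contr c A (U :\: A) ^+ 2.
  rewrite /v; case: ifPn => U0; last exact: gradcoef_sqr_le.
  by rewrite expr0n /= !mulr_ge0 ?exprn_ge0 ?ler0n //; apply: sumr_ge0 => A _; exact: sqr_ge0.
apply: (le_trans (ler_sum _ (fun U _ => vle U))).
rewrite -mulr_sumr ler_wpM2l ?mulr_ge0 ?exprn_ge0 ?ler0n //.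
apply: (sum_disjoint_pairs_le (F := fun A B => contr c A B ^+ 2)) => A B.
exact: sqr_ge0.
Qed.

(** E (D_k F)^2 is the diagonal entry of [contr] at the singleton of k, and [2 <= l] places
    singletons in the range of [contr_energy]. *)
Lemma sum_avg_diff4 l c : (2 <= l)%N -> homogeneous l c ->
  \sum_k avg (fun x => wpoly (wdiff c k) x ^+ 4) <= 9 ^+ l * contr_energy l c.
Proof.
move=> l2 hc.
apply: (@le_trans _ _ (\sum_k 9 ^+ l * contr c [set k]%SET [set k]%SET ^+ 2)).
  apply: ler_sum => k _.
  apply: (@le_trans _ _ (9 ^+ l * avg (fun x => wpoly (wdiff c k) x ^+ 2) ^+ 2)).
    apply: (@bonami _ _ N) => [S|S _ i _]; last exact: ltn_ord.
    rewrite /wdiff; case: ifPn; rewrite ?eqxx // => kS /hc <-.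
    by rewrite subset_leq_card // finset.subsetUr.
  rewrite ler_wpM2l ?exprn_ge0 ?ler0n // avg_wpoly_sqr le_eqVlt; apply/orP; left; apply/eqP.
  congr (_ ^+ 2); rewrite /contr [RHS]big_mkcond /=; apply: eq_bigr => S _.
  rewrite andbb /wdiff disjoints1; by case: ifP => //= _; rewrite expr0n.
rewrite -mulr_sumr ler_wpM2l ?exprn_ge0 ?ler0n //.
rewrite /contr_energy (bigID (fun A : {set 'I_N} => [exists k, A == [set k]%SET])) /=.
apply: ler_wpDr.
  by apply: sumr_ge0 => A _; apply: sumr_ge0 => B _; exact: sqr_ge0.
rewrite (eq_bigl (fun A => A \in [set [set k]%SET | k in 'I_N]%SET)); last first.
  move=> A; apply/andP/imsetP => [[_ /existsP[k /eqP e]]|[k _ ->]]; first by exists k.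
  by rewrite cards1 l2; split=> //; apply/existsP; exists k.
rewrite big_imset /=; last by move=> i j _ _ /set1_inj.
apply: ler_sum => k _; rewrite (bigD1 [set k]%SET) //= lerDl.
by apply: sumr_ge0 => B _; exact: sqr_ge0.
Qed.

End carre_du_champ.

(** * Stein's method on the cube *)

Section real_bounds.
Context {R : realType}.
Implicit Types (f : R -> R) (t y M : R).

Lemma derive_bounded_le f (df : R -> R) M t : 0 <= t ->
    (forall u : R, is_derive u 1 f (df u)) ->
    (forall u, 0 <= u <= t -> `|df u| <= M) ->
  `|f t - f 0| <= M * t.
Proof.
move=> t0 fd dM.
have [|c + ->] := MVT_segment t0 (fun u _ => fd u).
  apply: continuous_subspaceT => u; apply: differentiable_continuous.
  by apply/derivable1_diffP; have [] := fd u.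
rewrite in_itv /= => c0t; rewrite subr0 normrM (ger0_norm t0) ler_wpM2r //.
exact: dM.
Qed.

Lemma normr_sin_le y : `|sin y| <= `|y|.
Proof.
wlog y0 : y / 0 <= y.
  move=> h; have [/h //|y0] := leP 0 y.
  by have := h (- y); rewrite sinN !normrN oppr_ge0 => -> //; exact: ltW.
have := @derive_bounded_le sin cos 1 y y0 (fun u => is_derive_sin u).
by rewrite sin0 subr0 mul1r (ger0_norm y0); apply => u _; exact: cos_max.
Qed.

(** The derivative of the left side is u sin u, of order u^2. The cubic order turns the remainder of
    the integration by parts into a fourth moment of the gradient. *)
Lemma sin_sub_mul_cos_le y : `|sin y - y * cos y| <= `|y| ^+ 3.
Proof.
wlog y0 : y / 0 <= y.
  move=> h; have [/h //|y0] := leP 0 y.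
  have := h (- y); rewrite sinN cosN mulNr -opprD !normrN oppr_ge0 => -> //; exact: ltW.
have := @derive_bounded_le (fun u => sin u - u * cos u) (fun u => u * sin u) (y ^+ 2) y y0.
rewrite sin0 mul0r !subr0 (ger0_norm y0) => h; rewrite exprSr; apply: h.
  move=> u; apply: is_derive_eq; rewrite /GRing.scale /=; ring.
move=> u /andP[u0 uy]; rewrite normrM expr2; apply: ler_pM => //.
  by rewrite ger0_norm.
by apply: le_trans (normr_sin_le _) _; rewrite ger0_norm.
Qed.

End real_bounds.

Section stein.
Context {R : realType} (N : nat).
Local Notation Q := {ffun 'I_N -> bool}.
Implicit Types (x : Q) (k : 'I_N) (A B C S U : {set 'I_N}) (c : {set 'I_N} -> R).

Lemma sin_sgn k x (a b : R) : sin (a + sgnc k x * b) = sin a * cos b + sgnc k x * (cos a * sin b).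
Proof.
rewrite sinD /sgnc; case: (x k); rewrite /= ?expr1 ?expr0 ?mulN1r ?mul1r //.
by rewrite cosN sinN; ring.
Qed.

Lemma cos_sgn k x (a b : R) : cos (a + sgnc k x * b) = cos a * cos b - sgnc k x * (sin a * sin b).
Proof.
rewrite cosD /sgnc; case: (x k); rewrite /= ?expr1 ?expr0 ?mulN1r ?mul1r //.
by rewrite cosN sinN; ring.
Qed.

(** With F = a_k + x_k D_k, Euler's identity and the vanishing of odd terms give l
    E[F sin(t F + th)] = sum_k E[D_k cos(t a_k + th) sin(t D_k)]. Replacing sin y by y cos y
    recovers t E[gradsq cos(t F + th)], at the price of fourth moments; then [gradsq] is replaced by
    its mean l s2, at the price of its standard deviation. *)
Lemma stein_bound l c (t th : R) : (2 <= l)%N -> homogeneous l c -> 0 <= t ->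
  `|avg (fun x => wpoly c x * sin (t * wpoly c x + th)) -
    t * (\sum_S c S ^+ 2) * avg (fun x => cos (t * wpoly c x + th))| <=
  t ^+ 3 * (9 ^+ l * contr_energy l c) + t * (2 ^+ l * Num.sqrt (contr_energy l c)).
Proof.
move=> l2 hc t0.
have l0 : 0 < l%:R :> R by rewrite ltr0n; exact: leq_trans l2.
set s2 := \sum_S c S ^+ 2; set X := contr_energy l c.
have X0 : 0 <= X by apply: sumr_ge0 => A _; apply: sumr_ge0 => B _; exact: sqr_ge0.
pose G x := wpoly c x; pose D k x := wpoly (wdiff c k) x; pose a k x := wpoly (wrest c k) x.
have GE k x : t * G x + th = (t * a k x + th) + sgnc k x * (t * D k x).
  by rewrite /G (wpoly_split c k); rewrite -/(a k x) -/(D k x); ring.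
have af k x : a k (flip k x) = a k x by exact: wpoly_rest_flip.
have Df k x : D k (flip k x) = D k x by exact: wpoly_diff_flip.
have e1 : l%:R * avg (fun x => G x * sin (t * G x + th)) =
    \sum_k avg (fun x => D k x * (cos (t * a k x + th) * sin (t * D k x))).
  rewrite -avgZ (@eq_avg _ _ _ (fun x => \sum_k sgnc k x * D k x * sin (t * G x + th))); last first.
    by move=> x; rewrite mulrA -(euler_wpoly x hc) mulr_suml.
  rewrite avg_sum; apply: eq_bigr => k _.
  rewrite -[RHS]addr0 -(@avg_odd R _ k (fun x => sgnc k x * (D k x * (sin (t * a k x + th) * cos (t * D k x))))).
    rewrite -avgD; apply: eq_avg => x; rewrite (GE k) sin_sgn.
    have := @sgnc_sq R _ k x; set s := sgnc k x => ss; ring: ss.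
  by move=> x; rewrite sgnc_flip af Df mulNr.
have e2 : avg (fun x => gradsq c x * cos (t * G x + th)) =
    \sum_k avg (fun x => D k x ^+ 2 * (cos (t * a k x + th) * cos (t * D k x))).
  rewrite (@eq_avg _ _ _ (fun x => \sum_k D k x ^+ 2 * cos (t * G x + th))); last first.
    by move=> x; rewrite mulr_suml.
  rewrite avg_sum; apply: eq_bigr => k _.
  rewrite -[RHS]addr0 -(@avg_odd R _ k (fun x => sgnc k x * - (D k x ^+ 2 * (sin (t * a k x + th) * sin (t * D k x))))).
    rewrite -avgD; apply: eq_avg => x; rewrite (GE k) cos_sgn.
    by set s := sgnc k x; ring.
  by move=> x; rewrite sgnc_flip af Df mulNr.
have b1 : `|l%:R * avg (fun x => G x * sin (t * G x + th)) -
            t * avg (fun x => gradsq c x * cos (t * G x + th))| <= t ^+ 3 * (9 ^+ l * X).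
  rewrite e1 e2 mulr_sumr -sumrB.
  apply: le_trans (ler_norm_sum _ _ _) _.
  apply: (@le_trans _ _ (\sum_k t ^+ 3 * avg (fun x => D k x ^+ 4))); last first.
    by rewrite -mulr_sumr ler_wpM2l ?exprn_ge0 //; exact: sum_avg_diff4.
  apply: ler_sum => k _; rewrite -avgZ -avgZ -avgB.
  apply: le_trans (ler_norm_avg _) _; apply: ler_avg => x.
  have -> : D k x * (cos (t * a k x + th) * sin (t * D k x)) -
    t * (D k x ^+ 2 * (cos (t * a k x + th) * cos (t * D k x))) =
    cos (t * a k x + th) * (D k x * (sin (t * D k x) - (t * D k x) * cos (t * D k x))) by ring.
  rewrite normrM; apply: le_trans (ler_piMl _ (cos_max _)) _ => //.
  rewrite normrM; apply: le_trans (ler_wpM2l _ (sin_sub_mul_cos_le _)) _ => //.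
  rewrite normrM (ger0_norm t0) exprMn mulrCA ler_wpM2l ?exprn_ge0 // -exprS.
  by rewrite -normrX ger0_norm // exprn_even_ge0.
have b2 : `|avg (fun x => gradsq c x * cos (t * G x + th)) -
            l%:R * s2 * avg (fun x => cos (t * G x + th))| <= l%:R * (2 ^+ l * Num.sqrt X).
  (* The cosine is bounded by 1, so the square of the error is at most the variance of [gradsq]. *)
  rewrite -avgZ -avgB -(@ler_pXn2r _ 2) ?nnegrE ?mulr_ge0 ?exprn_ge0 ?sqrtr_ge0 ?ler0n //.
  rewrite real_normK ?num_real //; apply: le_trans (avg_sqr_le _) _.
  apply: (@le_trans _ _ (avg (fun x => (gradsq c x - l%:R * s2) ^+ 2))).
    apply: ler_avg => x; by rewrite -mulrBl exprMn ler_piMr ?sqr_ge0 //.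
  apply: le_trans (avg_gradsq_variance hc) _.
  rewrite !exprMn sqr_sqrtr // -exprM mulnC exprM [2 ^+ 2](_ : _ = 4); last by ring.
  by rewrite -/X; nra.
rewrite -(@ler_pM2l _ l%:R) // -[X in X * `|_|](gtr0_norm l0) -normrM.
set u := avg _ in b1 b2 *; set v := avg _ in b1 b2; set w := avg _ in b2 *.
have -> : l%:R * (u - t * s2 * w) = (l%:R * u - t * v) + t * (v - l%:R * s2 * w) by ring.
apply: le_trans (ler_normD _ _) _; rewrite [leRHS]mulrDr; apply: lerD.
  apply: le_trans b1 _; rewrite ler_peMl ?mulr_ge0 ?exprn_ge0 ?ler0n //.
  by rewrite (ler_nat R 1); exact: leq_trans l2.
rewrite normrM (ger0_norm t0) [leRHS]mulrCA; exact: ler_wpM2l.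
Qed.

(* By [stein_bound], [expR (u ^+ 2 / 2 * s2)] times the characteristic function at u has a small
   derivative in u. *)
Lemma cube_charfun_bound l c (t th : R) : (2 <= l)%N -> homogeneous l c -> 0 <= t ->
  `|avg (fun x => cos (t * wpoly c x + th)) -
    expR (- (t ^+ 2 / 2 * \sum_S c S ^+ 2)) * cos th| <=
  t ^+ 4 * (9 ^+ l * contr_energy l c) + t ^+ 2 * (2 ^+ l * Num.sqrt (contr_energy l c)).
Proof.
move=> l2 hc t0.
set s2 := \sum_S c S ^+ 2; set X := contr_energy l c.
have X0 : 0 <= X by apply: sumr_ge0 => A _; apply: sumr_ge0 => B _; exact: sqr_ge0.
have s20 : 0 <= s2 by apply: sumr_ge0 => S _; exact: sqr_ge0.
pose phi u := avg (fun x => cos (u * wpoly c x + th)).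
pose dphi u := avg (fun x => wpoly c x * sin (u * wpoly c x + th)).
have phid (u : R) : is_derive u 1 phi (- dphi u).
  (* The average is rewritten over ordinals, the index type of [is_derive_sum]. *)
  have -> : phi = (fun u => (2 ^+ N)^-1 *: \sum_(i < #|{: Q}|) cos (u * wpoly c (enum_val i) + th)).
    apply/funext => v; rewrite /phi /avg; congr (_ * _).
    exact: (reindex _ (onW_bij _ (@enum_val_bij _))).
  have -> : - dphi u = (2 ^+ N)^-1 *: \sum_(i < #|{: Q}|) - (wpoly c (enum_val i) * sin (u * wpoly c (enum_val i) + th)).
    rewrite /dphi -avgN /avg; congr (_ * _).
    exact: (reindex _ (onW_bij _ (@enum_val_bij _))).
  apply: is_deriveZ.
  have -> : (fun u => \sum_(i < #|{: Q}|) cos (u * wpoly c (enum_val i) + th)) =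
    \sum_(i < #|{: Q}|) (fun u => cos (u * wpoly c (enum_val i) + th)).
    by apply/funext => v; rewrite fct_sumE.
  apply: is_derive_sum => i.
  apply: is_derive_eq.
  rewrite /GRing.scale /=; ring.
set B := t ^+ 3 * (9 ^+ l * X) + t * (2 ^+ l * Num.sqrt X).
have B0 : 0 <= B by rewrite addr_ge0 // !mulr_ge0 ?exprn_ge0 ?sqrtr_ge0.
pose g u := expR (u ^+ 2 / 2 * s2) * phi u.
have := @derive_bounded_le R g (fun u => expR (u ^+ 2 / 2 * s2) * (u * s2 * phi u - dphi u))
   (expR (t ^+ 2 / 2 * s2) * B) t t0.
have g0 : g 0 = cos th.
  rewrite /g expr0n /= !mul0r expR0 mul1r /phi.
  by rewrite (@eq_avg _ _ _ (fun=> cos th)) ?avg_cst // => x; rewrite mul0r add0r.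
rewrite g0 => h.
have {h} : `|g t - cos th| <= expR (t ^+ 2 / 2 * s2) * B * t.
  apply: h.
    move=> u; rewrite /g; have := phid u => hphi.
    apply: is_derive_eq; rewrite /GRing.scale /=.
    by field.
  move=> u /andP[u0 ut]; rewrite normrM (ger0_norm (expR_ge0 _)).
  apply: ler_pM; [exact: expR_ge0|exact: normr_ge0| |].
    rewrite ler_expR ler_wpM2r // ler_wpM2r ?invr_ge0 // ler_sqr ?nnegrE //.
  rewrite distrC; apply: le_trans (stein_bound th l2 hc u0) _.
  have u3 : u ^+ 3 <= t ^+ 3 by apply: lerXn2r => //; rewrite nnegrE.
  by apply: lerD; apply: ler_wpM2r; rewrite ?mulr_ge0 ?exprn_ge0 ?sqrtr_ge0.
rewrite /g => h.
have -> : avg (fun x => cos (t * wpoly c x + th)) - expR (- (t ^+ 2 / 2 * s2)) * cos th =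
  expR (- (t ^+ 2 / 2 * s2)) * (expR (t ^+ 2 / 2 * s2) * phi t - cos th).
  by rewrite mulrBr mulrA -expRD addNr expR0 mul1r.
rewrite normrM (ger0_norm (expR_ge0 _)).
apply: le_trans (ler_wpM2l (expR_ge0 _) h) _.
rewrite -[_ * B * t]mulrA [_ * (_ * (B * t))]mulrA -expRD addNr expR0 mul1r le_eqVlt; apply/orP; left; apply/eqP.
by rewrite /B; ring.
Qed.

End stein.

(** * Square-summable kernels restricted to boxes *)

Section tuples_and_sets.
Context {R : realType}.

Lemma val_to_tuple n (s : seq nat) : size s = n -> val (to_tuple n s) = s.
Proof.
move=> sn; apply: (@eq_from_nth _ 0%N); first by rewrite size_tuple.
move=> i; rewrite size_tuple => ni.
by rewrite -[i]/(val (Ordinal ni)) -tnth_nth tnth_mktuple.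
Qed.

Lemma sym_kernel_perm n (f : n.-tuple nat -> R) (s t : n.-tuple nat) :
  symmetric_kernel f -> perm_eq s t -> f s = f t.
Proof.
move=> fs /tuple_permP [p e]; rewrite -(fs p t); congr f; apply/val_inj.
by rewrite /= e.
Qed.

Lemma sum_uniq_tuple N n (Phi : {set 'I_N} -> R) :
  \sum_(t : n.-tuple 'I_N | uniq t) Phi [set i in t]%SET =
  n`!%:R * \sum_(S : {set 'I_N} | #|S| == n) Phi S.
Proof.
rewrite (partition_big (fun t : n.-tuple 'I_N => [set i in t]%SET) (fun S => #|S| == n)) /=; last first.
  by move=> t ut; rewrite cardsE (card_uniqP ut) size_tuple.
rewrite mulr_sumr; apply: eq_bigr => S /eqP Sn.
rewrite (eq_bigr (fun=> Phi S)); last by move=> t /andP[_ /eqP ->].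
rewrite sumr_const mulr_natl; congr (_ *+ _).
have := card_uniq_tuples n (mem S); rewrite Sn ffactnn => <-.
rewrite [RHS]cardsE; apply: eq_card => t. rewrite !unfold_in andbC.
apply/andP/andP => [[/eqP eS ut]|[/allP tS ut]]; split=> //.
  by apply/allP => i it; rewrite /= -eS inE.
rewrite eqEcard cardsE (card_uniqP ut) size_tuple Sn leqnn andbT.
by apply/fintype.subsetP => i; rewrite inE => /tS.
Qed.

Lemma sum_set_le_uniq_tuple N n (Phi : {set 'I_N} -> R) : (forall S, 0 <= Phi S) ->
  \sum_(S : {set 'I_N} | #|S| == n) Phi S <=
  \sum_(t : n.-tuple 'I_N | uniq t) Phi [set i in t]%SET.
Proof.
move=> Phi0; rewrite sum_uniq_tuple ler_peMl ?sumr_ge0 //.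
by rewrite (ler_nat R 1) fact_gt0.
Qed.

(* A symmetric kernel vanishing on diagonals, seen as a function of the set of its arguments
   and multiplied by the number n! of orderings of that set. *)
Definition kset n (f : n.-tuple nat -> R) N (S : {set 'I_N}) : R :=
  if #|S| == n then n`!%:R * f (to_tuple n (map val (enum S))) else 0.

Arguments kset {n} f {N} S.

Definition nat_tuple n N (t : n.-tuple 'I_N) : n.-tuple nat := [tuple of map val t].

Lemma kset_homogeneous n (f : n.-tuple nat -> R) N : homogeneous n (kset f (N := N)).
Proof. by move=> S; rewrite /kset; case: ifP => [/eqP|]; rewrite ?eqxx. Qed.

Lemma kset_seq n (f : n.-tuple nat -> R) N (u : seq 'I_N) :
    symmetric_kernel f -> (forall t : n.-tuple nat, ~~ uniq t -> f t = 0) ->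
    size u = n ->
  n`!%:R * f (to_tuple n (map val u)) = if uniq u then kset f [set i in u]%SET else 0.
Proof.
move=> fs fd un; case: ifPn => uu; last first.
  rewrite fd ?mulr0 // val_to_tuple ?size_map //.
  by rewrite (map_inj_uniq val_inj).
rewrite /kset cardsE (card_uniqP uu) un eqxx; congr (_ * _); apply: sym_kernel_perm => //.
rewrite !val_to_tuple ?size_map //; first last.
  by rewrite -cardE cardsE (card_uniqP uu).
apply: perm_map; apply: uniq_perm; rewrite ?enum_uniq // => i.
by rewrite mem_enum inE.
Qed.

Lemma to_nat_tuple n N (t : n.-tuple 'I_N) : to_tuple n (map val t) = nat_tuple t.
Proof. by apply/val_inj; rewrite val_to_tuple // size_map size_tuple. Qed.

Lemma kset_tuple n (f : n.-tuple nat -> R) N (t : n.-tuple 'I_N) :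
    symmetric_kernel f -> (forall t : n.-tuple nat, ~~ uniq t -> f t = 0) ->
  n`!%:R * f (nat_tuple t) = if uniq t then kset f [set i in t]%SET else 0.
Proof. by move=> fs fd; rewrite -to_nat_tuple kset_seq // size_tuple. Qed.

Lemma natfact_neq0 n : n`!%:R != 0 :> R.
Proof. by rewrite pnatr_eq0 -lt0n fact_gt0. Qed.

Lemma sum_kset n (f : n.-tuple nat -> R) N (w : {set 'I_N} -> R) :
    symmetric_kernel f -> (forall t : n.-tuple nat, ~~ uniq t -> f t = 0) ->
  \sum_(t : n.-tuple 'I_N | uniq t) f (nat_tuple t) * w [set i in t]%SET =
  \sum_(S : {set 'I_N}) kset f S * w S.
Proof.
move=> fs fd; apply: (mulfI (natfact_neq0 n)).
transitivity (\sum_(t : n.-tuple 'I_N | uniq t) (fun S => kset f S * w S) [set i in t]%SET).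
  rewrite mulr_sumr; apply: eq_bigr => t ut.
  by rewrite mulrA kset_tuple // ut.
rewrite (sum_uniq_tuple n (fun S => kset f S * w S)); congr (_ * _); rewrite big_mkcond /=; apply: eq_bigr => S _.
by case: ifPn => // Sn; rewrite /kset (negbTE Sn) mul0r.
Qed.

Lemma sum_tuple_wpoly n (f : n.-tuple nat -> R) N (y : 'I_N -> R) :
    symmetric_kernel f -> (forall t : n.-tuple nat, ~~ uniq t -> f t = 0) ->
  \sum_(t : n.-tuple 'I_N | uniq t) f (nat_tuple t) * \prod_(k < n) y (tnth t k) =
  \sum_(S : {set 'I_N}) kset f S * \prod_(i in S) y i.
Proof.
move=> fs fd; rewrite -(sum_kset (fun S : {set 'I_N} => \prod_(i in S) y i) fs fd).
apply: eq_bigr => t ut; congr (_ * _).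
rewrite -(big_tuple _ _ t predT y) big_uniq //=; apply: eq_bigl => i.
by rewrite inE.
Qed.

Lemma sum_ksetM n (f g : n.-tuple nat -> R) N :
    symmetric_kernel f -> (forall t : n.-tuple nat, ~~ uniq t -> f t = 0) ->
    symmetric_kernel g -> (forall t : n.-tuple nat, ~~ uniq t -> g t = 0) ->
  \sum_(S : {set 'I_N}) kset f S * kset g S =
  n`!%:R * \sum_(t : n.-tuple 'I_N) f (nat_tuple t) * g (nat_tuple t).
Proof.
move=> fs fd gs gd; rewrite -sum_kset // mulr_sumr big_mkcond /=; apply: eq_bigr => t _.
rewrite [RHS]mulrCA kset_tuple //; case: ifP => // _; by rewrite mulr0.
Qed.

(* With N = M this is the squared norm of the contraction of [f] over m variables, all the
   indices being restricted to [0, N). *)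
Definition box_contr n (f : n.-tuple nat -> R) m N M : R :=
  \sum_(i : (n - m).-tuple 'I_N) \sum_(j : (n - m).-tuple 'I_N)
    (\sum_(a : m.-tuple 'I_M) f (to_tuple n (map val i ++ map val a)) *
       f (to_tuple n (map val j ++ map val a))) ^+ 2.

(** The factors n! come from the two occurrences of [kset]; dividing by m! passes from contracted
    sets to contracted tuples, each set of size m having m! orderings. *)
Lemma contr_tuple n (f : n.-tuple nat -> R) N m (t s : (n - m).-tuple 'I_N) :
    symmetric_kernel f -> (forall t : n.-tuple nat, ~~ uniq t -> f t = 0) ->
    (m <= n)%N -> uniq t -> uniq s ->
  contr (kset f) [set i in t]%SET [set i in s]%SET =
  n`!%:R ^+ 2 / m`!%:R * \sum_(a : m.-tuple 'I_N)
    f (to_tuple n (map val t ++ map val a)) * f (to_tuple n (map val s ++ map val a)).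
Proof.
move=> fs fd mn ut us.
(* Extension by 0 to overlapping sets matches the vanishing of [f] on diagonals, so that the sum
   over disjoint sets C becomes a sum over all tuples without repetition. *)
pose h (u : seq 'I_N) (C : {set 'I_N}) := if [disjoint [set i in u]%SET & C]%B then kset f ([set i in u]%SET :|: C) else 0.
have hE (u : (n - m).-tuple 'I_N) (a : m.-tuple 'I_N) : uniq u ->
    n`!%:R * f (to_tuple n (map val u ++ map val a)) = if uniq a then h u [set i in a]%SET else 0.
  move=> uu; rewrite -map_cat kset_seq //; last by rewrite size_cat !size_tuple subnK.
  rewrite cat_uniq uu /=; case: (uniq a); last by rewrite andbF.
  rewrite andbT /h (_ : ~~ has (mem u) a = [disjoint [set i in u]%SET & [set i in a]%SET]%B).
    case: ifP => // _; congr kset; apply/setP => i; by rewrite !inE mem_cat.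
  rewrite -setI_eq0 -all_predC; apply/allP/eqP => [h1|h1 i ia].
    apply/setP => i; rewrite !inE; apply/negbTE; rewrite negb_and orbC.
    by case ia: (i \in a) => //=; exact: h1.
  have /setP/(_ i) := h1; rewrite !inE ia andbT /= => ->; by [].
transitivity (m`!%:R^-1 * \sum_(a : m.-tuple 'I_N | uniq a) (fun C => h t C * h s C) [set i in a]%SET).
  rewrite (sum_uniq_tuple m (fun C => h t C * h s C)) mulrA mulVf ?natfact_neq0 // mul1r /contr [RHS]big_mkcond [LHS]big_mkcond /=.
  apply: eq_bigr => C _; rewrite /h.
  case: ifPn => [/andP[dt ds]|]; last first.
    by rewrite negb_and => /orP[] /negbTE ->; rewrite ?mul0r ?mulr0; case: ifP.
  rewrite dt ds; case: ifPn => // Cm; rewrite /kset.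
  rewrite [#|_ :|: C|]cardsU disjoint_setI0 // cards0 subn0 cardsE (card_uniqP ut) size_tuple.
  rewrite -{2}(subnK mn) eqn_add2l (negbTE Cm) mul0r //.
rewrite [n`!%:R ^+ 2 / _]mulrC -mulrA; congr (_ * _); rewrite big_mkcond mulr_sumr.
apply: eq_bigr => a _; rewrite expr2.
transitivity ((n`!%:R * f (to_tuple n (map val t ++ map val a))) *
              (n`!%:R * f (to_tuple n (map val s ++ map val a)))); last by ring.
by rewrite !hE //; case: ifP; rewrite ?mul0r.
Qed.

Lemma contr_energy_le n (f : n.-tuple nat -> R) N :
    symmetric_kernel f -> (forall t : n.-tuple nat, ~~ uniq t -> f t = 0) ->
  contr_energy n (kset f (N := N)) <=
  n`!%:R ^+ 4 * \sum_(1 <= m < n) box_contr f m N N.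
Proof.
move=> fs fd; rewrite /contr_energy mulr_sumr.
pose hc := @kset_homogeneous n f N.
(* A nonzero contraction has #|A| = #|B|; the terms are sorted by m = n - #|A|, the number of
   contracted variables. *)
have -> : \sum_(A : {set 'I_N} | (0 < #|A| < n)%N) \sum_(B : {set 'I_N}) contr (kset f) A B ^+ 2 =
  \sum_(1 <= m < n) \sum_(A : {set 'I_N} | #|A| == (n - m)%N)
     \sum_(B : {set 'I_N} | #|B| == (n - m)%N) contr (kset f) A B ^+ 2.
  rewrite [RHS](exchange_big_dep predT) //= [LHS]big_mkcond /=; apply: eq_bigr => A _.
  case: ifPn => An.
    rewrite [RHS]big_mkcond (bigD1_seq (n - #|A|)%N) ?iota_uniq //=; last first.
      rewrite mem_index_iota; case/andP: An => A0 An; rewrite subn_gt0 An /=.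
      by rewrite ltn_subrL A0 (leq_trans _ An).
    rewrite subKn; last by case/andP: An => _ /ltnW.
    rewrite eqxx /= [X in _ = _ + X]big1_seq ?addr0; last first.
      move=> m /andP[mA]; rewrite mem_index_iota => /andP[m1 mn].
      by case: eqP => // e; move: mA; rewrite e subKn ?eqxx // ltnW.
    rewrite [RHS]big_mkcond; apply: eq_bigr => B _; case: ifPn => // BA.
    have [->|/(contr_neq0 hc)[e _]] := eqVneq (contr (kset f) A B) 0; first by rewrite expr0n.
    by rewrite e eqxx in BA.
  rewrite big1_seq // => m /andP[/eqP e]; rewrite mem_index_iota => /andP[m1 mn].
  by case/negP: An; rewrite e subn_gt0 mn /= ltn_subrL m1 /= (leq_trans _ mn).
rewrite !big_nat; apply: ler_sum => m /andP[m1 mn].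
have F0 (i j : (n - m).-tuple 'I_N) : 0 <= (\sum_(a : m.-tuple 'I_N) f (to_tuple n (map val i ++ map val a)) *
       f (to_tuple n (map val j ++ map val a))) ^+ 2 by exact: sqr_ge0.
rewrite /box_contr mulr_sumr.
apply: le_trans (sum_set_le_uniq_tuple _ _) _ => [A|].
  by apply: sumr_ge0 => B _; exact: sqr_ge0.
rewrite [leLHS]big_mkcond /=; apply: ler_sum => t _; case: ifPn => ut; last first.
  by rewrite mulr_ge0 ?exprn_ge0 ?ler0n // sumr_ge0.
apply: le_trans (sum_set_le_uniq_tuple _ _) _ => [B|]; first exact: sqr_ge0.
rewrite [leLHS]big_mkcond /= mulr_sumr; apply: ler_sum => s _; case: ifPn => us; last first.
  by rewrite mulr_ge0 ?sqr_ge0 ?exprn_ge0 ?ler0n.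
rewrite (contr_tuple fs fd (ltnW mn) ut us) exprMn ler_wpM2r ?sqr_ge0 //.
rewrite exprMn -exprM ler_piMr ?exprn_ge0 ?ler0n //.
by rewrite expr_le1 ?invr_ge0 ?ler0n // invf_le1 ?ltr0n ?fact_gt0 // (ler_nat R 1) fact_gt0.
Qed.

End tuples_and_sets.

Arguments kset {R n} f {N} S.

(** * Contractions as products of matrices *)

Section gram.
Context {R : realType}.
Implicit Types (I J K : finType).

(** Squared Hilbert-Schmidt norm of the matrix u v^T. A contraction is such a product, with the free
    variables as rows and the contracted ones as columns. *)
Definition gram I J (u v : I -> J -> R) : R :=
  \sum_i \sum_j (\sum_a u i a * v j a) ^+ 2.

(** The squared norm of u v^T is the scalar product of u^T u and v^T v: free and contracted
    variables are exchanged. *)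
Lemma gram_swap I J (u v : I -> J -> R) :
  gram u v = \sum_a \sum_b (\sum_i u i a * u i b) * (\sum_j v j a * v j b).
Proof.
rewrite /gram.
transitivity (\sum_i \sum_j \sum_a \sum_b (u i a * u i b) * (v j a * v j b)).
  apply: eq_bigr => i _; apply: eq_bigr => j _; rewrite expr2 mulr_suml.
  by apply: eq_bigr => a _; rewrite mulr_sumr; apply: eq_bigr => b _; ring.
under eq_bigr => i _ do rewrite exchange_big.
rewrite exchange_big; apply: eq_bigr => a _.
under eq_bigr => i _ do rewrite exchange_big.
rewrite exchange_big; apply: eq_bigr => b _.
by rewrite mulr_suml; apply: eq_bigr => i _; rewrite mulr_sumr.
Qed.

Lemma gram_trans I J (u : I -> J -> R) :
  gram u u = gram (fun a i => u i a) (fun a i => u i a).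
Proof.
by rewrite gram_swap /gram; apply: eq_bigr => a _; apply: eq_bigr => b _; rewrite expr2.
Qed.

Lemma gram_sub I J K (h : K -> I) (u : I -> J -> R) : injective h ->
  gram (fun k => u (h k)) (fun k => u (h k)) <= gram u u.
Proof.
move=> hi; rewrite /gram.
have sub (F : I -> R) : (forall i, 0 <= F i) -> \sum_k F (h k) <= \sum_i F i.
  move=> F0; rewrite [leRHS](bigID (fun i => i \in [set h k | k in K]%SET)) /=.
  rewrite big_imset /=; last by move=> ? ? _ _ /hi.
  by rewrite lerDl sumr_ge0.
apply: le_trans (sub (fun i => \sum_j (\sum_a u i a * u j a) ^+ 2) _); last first.
  by move=> i; apply: sumr_ge0 => j _; exact: sqr_ge0.
apply: ler_sum => k _; apply: (sub (fun j => (\sum_a u (h k) a * u j a) ^+ 2)) => j.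
exact: sqr_ge0.
Qed.

(** After [gram_swap] the left side is a scalar product of two matrices and the right side half the
    sum of their squared norms. This bounds the mixed contractions of two kernels by contractions of
    each kernel alone. *)
Lemma gram_cross_le I J (u v : I -> J -> R) : gram u v <= (gram u u + gram v v) / 2.
Proof.
rewrite gram_swap [gram u u]gram_swap [gram v v]gram_swap -big_split mulr_suml /=; apply: ler_sum => a _.
rewrite -big_split mulr_suml /=; apply: ler_sum => b _.
set x := \sum_i _; set y := \sum_i _; have := sqr_ge0 (x - y); nra.
Qed.

Lemma gram_sym I J (u v : I -> J -> R) : gram u v = gram v u.
Proof.
rewrite /gram exchange_big; apply: eq_bigr => i _; apply: eq_bigr => j _; congr (_ ^+ 2).
by apply: eq_bigr => a _; rewrite mulrC.
Qed.

(** The cases e = 1 and e = -1 give sums and differences. The constant is 4, for the square of a sum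
    of four terms, times 2, for the mixed terms absorbed by [gram_cross_le]. *)
Lemma gram_add_le I J (u v : I -> J -> R) (e : R) : e ^+ 2 = 1 ->
  gram (fun i a => u i a + e * v i a) (fun i a => u i a + e * v i a) <=
  8 * (gram u u + gram v v).
Proof.
move=> e1; apply: (@le_trans _ _ (4 * (gram u u + gram u v + gram v u + gram v v))); last first.
  by have := gram_cross_le u v; rewrite (gram_sym v u); lra.
rewrite /gram -!big_split mulr_sumr; apply: ler_sum => i _; rewrite -!big_split mulr_sumr.
apply: ler_sum => j _ /=.
have -> : \sum_a (u i a + e * v i a) * (u j a + e * v j a) =
    \sum_a u i a * u j a + e * (\sum_a u i a * v j a) + e * (\sum_a v i a * u j a)
     + \sum_a v i a * v j a.
  rewrite !mulr_sumr -!big_split; apply: eq_bigr => a _ /=.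
  by ring: e1.
set a := \sum_a _; set b := \sum_a _; set c := \sum_a _; set d := \sum_a _.
have -> : b ^+ 2 = (e * b) ^+ 2 by rewrite exprMn e1 mul1r.
have -> : c ^+ 2 = (e * c) ^+ 2 by rewrite exprMn e1 mul1r.
move: (e * b) (e * c) => {}b {}c.
have := sqr_ge0 (a - b); have := sqr_ge0 (a - c); have := sqr_ge0 (a - d).
have := sqr_ge0 (b - c); have := sqr_ge0 (b - d); have := sqr_ge0 (c - d); nra.
Qed.

Lemma box_contr_gram n (f : n.-tuple nat -> R) m N M :
  box_contr f m N M = gram
   (fun (i : (n - m).-tuple 'I_N) (a : m.-tuple 'I_M) => f (to_tuple n (map val i ++ map val a)))
   (fun (i : (n - m).-tuple 'I_N) (a : m.-tuple 'I_M) => f (to_tuple n (map val i ++ map val a))).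
Proof. by []. Qed.

Lemma box_contr_add_le n (f g : n.-tuple nat -> R) (e : R) m N M : e ^+ 2 = 1 ->
  box_contr (fun t => f t + e * g t) m N M <= 8 * (box_contr f m N M + box_contr g m N M).
Proof. by move=> e1; rewrite !box_contr_gram; exact: gram_add_le. Qed.

(** The inner sums over a are signed, so nothing is monotone in M term by term; [gram_trans] turns
    the contracted indices into row indices, over which squares are summed. *)
Lemma box_contr_mono n (f : n.-tuple nat -> R) m N M : (N <= M)%N ->
  box_contr f m N N <= box_contr f m N M.
Proof.
move=> NM; rewrite !box_contr_gram gram_trans [leRHS]gram_trans.
pose h (a : m.-tuple 'I_N) : m.-tuple 'I_M := [tuple of map (widen_ord NM) a].
have hi : injective h.
  move=> a b /(congr1 val) /= /inj_map ab; apply/val_inj/ab => x y /(congr1 val) /= xy.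
  exact/val_inj.
have -> : (fun (a : m.-tuple 'I_N) (i : (n - m).-tuple 'I_N) => f (to_tuple n (map val i ++ map val a))) =
    (fun a i => f (to_tuple n (map val i ++ map val (h a)))).
  apply/funext => a; apply/funext => i; congr (f (to_tuple n (_ ++ _))).
  by rewrite /= -map_comp; apply: eq_map.
exact: (gram_sub (fun (a : m.-tuple 'I_M) (i : (n - m).-tuple 'I_N) => f (to_tuple n (map val i ++ map val a))) hi).
Qed.

End gram.

(** * Summable families and exhaustion by boxes *)

Section real_sums.
Context {R : realType} (T : choiceType).
Implicit Types (a u : T -> R) (A : {fset T}) (K e : R).

Lemma esum_fset_le a A : (forall x, 0 <= a x) ->
  ((\sum_(x <- A) a x)%:E <= \esum_(x in [set: T]) (a x)%:E)%E.
Proof.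
move=> a0; apply: esum_ge; exists [set` A].
  by split; [exact: finite_fset|].
by rewrite -fsbig_seq ?fset_uniq // sumEFin.
Qed.

Lemma esum_le_bound a K : (forall A, \sum_(x <- A) a x <= K) ->
  (\esum_(x in [set: T]) (a x)%:E <= K%:E)%E.
Proof.
move=> aK; apply: ge_ereal_sup => _ [X [finX _] <-].
by rewrite fsbig_finite //= sumEFin lee_fin.
Qed.

Lemma esum_fin a K : (forall x, 0 <= a x) -> (forall A, \sum_(x <- A) a x <= K) ->
  (\esum_(x in [set: T]) (a x)%:E)%E \is a fin_num.
Proof.
move=> a0 aK; rewrite ge0_fin_numE; last by apply: esum_ge0 => x _; rewrite lee_fin.
exact: le_lt_trans (esum_le_bound aK) (ltry _).
Qed.

Lemma esum_approx a K e : (forall x, 0 <= a x) -> (forall A, \sum_(x <- A) a x <= K) -> 0 < e ->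
  exists A0, forall A, fsubset A0 A ->
    `|\sum_(x <- A) a x - fine (\esum_(x in [set: T]) (a x)%:E)| <= e.
Proof.
move=> a0 aK e0; have fin := esum_fin a0 aK; set s := fine _.
have le_s A : \sum_(x <- A) a x <= s.
  by rewrite -lee_fin fineK //; exact: esum_fset_le.
have [A0 hA0] : exists A0, s - e <= \sum_(x <- A0) a x.
  apply: contrapT => /forallNP h.
  have : (\esum_(x in [set: T]) (a x)%:E <= (s - e)%:E)%E.
    by apply: esum_le_bound => A; apply/ltW; rewrite ltNge; apply/negP; exact: h.
  by rewrite -(fineK fin) lee_fin -/s lerBrDr gerDl leNgt e0.
exists A0 => A A0A; rewrite distrC ger0_norm ?subr_ge0 // lerBlDr addrC -lerBlDr.
apply: le_trans hA0 _.
rewrite (big_fsetID _ (mem A0) A) /= (_ : [fset x | x in A & x \in A0]%fset = A0).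
  by rewrite lerDl; apply: sumr_ge0.
apply/fsetP => x; rewrite !inE /=; apply/andP/idP => [[]//|xA0]; split => //.
by move/fsubsetP : A0A; apply.
Qed.

(** Positive and negative parts are approximated separately, as in the definition of [sumR]; the
    bound on absolute sums keeps both of them finite. *)
Lemma sumR_approx u K e : (forall A, \sum_(x <- A) `|u x| <= K) -> 0 < e ->
  exists A0, forall A, fsubset A0 A -> `|\sum_(x <- A) u x - sumR u| <= e.
Proof.
move=> uK e0.
pose p x := Num.max (u x) 0; pose n x := Num.max (- u x) 0.
have p0 x : 0 <= p x by rewrite le_max lexx orbT.
have n0 x : 0 <= n x by rewrite le_max lexx orbT.
have pK A : \sum_(x <- A) p x <= K.
  apply: le_trans (uK A); apply: ler_sum => x _.
  by rewrite ge_max ler_norm normr_ge0.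
have nK A : \sum_(x <- A) n x <= K.
  apply: le_trans (uK A); apply: ler_sum => x _.
  by rewrite ge_max -normrN ler_norm normr_ge0.
have e20 : 0 < e / 2 by rewrite divr_gt0.
have [A1 h1] := esum_approx p0 pK e20.
have [A2 h2] := esum_approx n0 nK e20.
exists (A1 `|` A2)%fset => A; rewrite fsubUset => /andP[A1A A2A].
have := h1 A A1A; have := h2 A A2A.
have -> : sumR u = fine (\esum_(x in [set: T]) (p x)%:E) - fine (\esum_(x in [set: T]) (n x)%:E).
  rewrite /sumR -fineB ?(esum_fin _ pK) ?(esum_fin _ nK) //; congr (fine (_ - _)%E);
   by apply: eq_esum => x _; rewrite ?funeposE ?funenegE /= ?EFin_max.
have -> : \sum_(x <- A) u x = \sum_(x <- A) p x - \sum_(x <- A) n x.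
  rewrite -sumrB; apply: eq_bigr => x _; rewrite /p /n /Num.max.
  by case: ifPn; case: ifPn; rewrite -?leNgt => *; lra.
set a := \sum_(_ <- _) _; set b := fine _; set c := \sum_(_ <- _) _; set d := fine _.
move=> ha hb.
have -> : c - a - (d - b) = (c - d) - (a - b) by ring.
apply: le_trans (ler_normB _ _) _; lra.
Qed.

Lemma l2_fset_le u A : l2 u -> \sum_(x <- A) u x ^+ 2 <= l2_norm u ^+ 2.
Proof.
move=> lu; have u0 x : 0 <= u x ^+ 2 by exact: sqr_ge0.
have fin : (\esum_(x in [set: T]) (u x ^+ 2)%:E)%E \is a fin_num.
  by rewrite ge0_fin_numE //; apply: esum_ge0 => x _; rewrite lee_fin.
have uK (B : {fset T}) : \sum_(x <- B) u x ^+ 2 <= fine (\esum_(x in [set: T]) (u x ^+ 2)%:E)%E.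
  by rewrite -lee_fin fineK //; exact: esum_fset_le.
have -> : l2_norm u ^+ 2 = fine (\esum_(x in [set: T]) (u x ^+ 2)%:E)%E; last exact: uK.
rewrite /l2_norm /l2_dot /sumR.
have -> : (\esum_(x in [set: T]) ((EFin \o (fun x => (u x * u x)%R))^\- x) = 0)%E.
  rewrite esum1 // => x _; rewrite funenegE /= -expr2.
  by apply/max_idPr; rewrite lee_fin oppr_le0.
rewrite sube0 sqr_sqrtr.
  by congr fine; apply: eq_esum => x _; rewrite funeposE /= -expr2; apply/max_idPl; rewrite lee_fin.
by apply: fine_ge0; apply: esum_ge0 => x _; exact: funepos_ge0.
Qed.

Lemma bound_l2 u K : (forall A, \sum_(x <- A) u x ^+ 2 <= K) -> l2 u.
Proof. by move=> uK; exact: le_lt_trans (esum_le_bound uK) (ltry _). Qed.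

Lemma l2_mul_bound u v A : l2 u -> l2 v ->
  \sum_(x <- A) `|u x * v x| <= l2_norm u ^+ 2 + l2_norm v ^+ 2.
Proof.
move=> /(l2_fset_le A) hu /(l2_fset_le A) hv; apply: le_trans (lerD hu hv).
rewrite -big_split /=; apply: ler_sum => x _; rewrite normrM.
rewrite -[u x ^+ 2]real_normK ?num_real // -[v x ^+ 2]real_normK ?num_real //.
have := sqr_ge0 (`|u x| - `|v x|); have := normr_ge0 (u x); have := normr_ge0 (v x); nra.
Qed.

End real_sums.

Section boxes.
Context {R : realType}.

Definition box n N : {fset n.-tuple nat} :=
  [fset x | x in map (@nat_tuple n N) (enum {: n.-tuple 'I_N})]%fset.

Lemma nat_tuple_inj n N : injective (@nat_tuple n N).
Proof.
move=> s t /(congr1 val) /= /inj_map st; apply/val_inj/st => x y xy; exact/val_inj.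
Qed.

Lemma sum_box n N (u : n.-tuple nat -> R) (P : pred (n.-tuple nat)) :
  \sum_(x <- box n N | P x) u x = \sum_(t : n.-tuple 'I_N | P (nat_tuple t)) u (nat_tuple t).
Proof.
rewrite (perm_big (map (@nat_tuple n N) (enum {: n.-tuple 'I_N}))) /=.
  by rewrite big_map big_enum_cond.
apply: uniq_perm; first exact: fset_uniq.
  by rewrite (map_inj_uniq (@nat_tuple_inj n N)) enum_uniq.
by move=> x; rewrite !inE.
Qed.

Lemma mem_box n N (t : n.-tuple nat) : (t \in box n N) = all (fun i => (i < N)%N) t.
Proof.
rewrite !inE; apply/mapP/allP => [[s _ ->] i /mapP[j _ ->]|h]; first exact: ltn_ord.
case: N h => [|N] h.
  case: t h => -[|x s] /= p h; last by have := h x (mem_head _ _).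
  have n0 : n = 0%N by rewrite -(eqP p).
  by subst n; exists [tuple]; rewrite ?mem_enum //; apply/val_inj.
exists [tuple of map inord t]; first by rewrite mem_enum.
apply/val_inj => /=; rewrite -map_comp -[LHS]map_id.
by apply/eq_in_map => i it /=; rewrite inordK // h.
Qed.

(** Boxes are cofinal among finite sets of tuples, so that unconditional sums and the limit in
    [is_J] can be followed along one sequence. *)
Lemma fsubset_box n (A : {fset n.-tuple nat}) :
  exists N0, forall N, (N0 <= N)%N -> fsubset A (box n N).
Proof.
exists (\max_(t <- A) \max_(i <- tval t) i.+1)%N => N h; apply/fsubsetP => t tA.
rewrite mem_box; apply/allP => i it; apply: leq_trans h.
apply: leq_trans (@leq_bigmax_seq _ (enum_fset A) xpredT (fun t : n.-tuple nat => \max_(i <- tval t) i.+1)%N t tA isT).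
exact: (@leq_bigmax_seq _ (tval t) xpredT (fun i => i.+1) i it isT).
Qed.

Lemma sumR_box_cvg n (u : n.-tuple nat -> R) K :
    (forall A : {fset n.-tuple nat}, \sum_(x <- A) `|u x| <= K) ->
  \sum_(t : n.-tuple 'I_N) u (nat_tuple t) @[N --> \oo] --> sumR u.
Proof.
move=> uK; apply/cvgrPdist_le => e e0.
have [A0 h] := sumR_approx uK e0; have [N0 h0] := fsubset_box A0.
exists N0 => // N /= N0N; rewrite distrC.
by have := h _ (h0 _ N0N); rewrite sum_box.
Qed.

Lemma l2_dot_box_cvg n (f g : n.-tuple nat -> R) : l2 f -> l2 g ->
  \sum_(t : n.-tuple 'I_N) f (nat_tuple t) * g (nat_tuple t) @[N --> \oo] --> l2_dot f g.
Proof.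
move=> lf lg.
exact: (sumR_box_cvg (fun A => @l2_mul_bound _ _ f g A lf lg)).
Qed.

Lemma l2_box_le n (f : n.-tuple nat -> R) N : l2 f ->
  \sum_(t : n.-tuple 'I_N) f (nat_tuple t) ^+ 2 <= l2_norm f ^+ 2.
Proof. by move=> /(l2_fset_le (box n N)); rewrite sum_box. Qed.

Lemma sum_cat_tuple N p q r (H : seq 'I_N -> R) : p = (q + r)%N ->
  \sum_(t : p.-tuple 'I_N) H t = \sum_(i : q.-tuple 'I_N) \sum_(j : r.-tuple 'I_N) H (i ++ j).
Proof.
move=> ->; rewrite pair_bigA /=.
pose h (ij : q.-tuple 'I_N * r.-tuple 'I_N) := [tuple of ij.1 ++ ij.2].
have hi : injective h.
  move=> [i j] [i' j'] /(congr1 val) /= /eqP; rewrite eqseq_cat ?size_tuple // => /andP[/eqP ii /eqP jj].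
  by congr pair; apply/val_inj.
rewrite (reindex h) //; apply: onW_bij; apply: inj_card_bij => //.
by rewrite card_prod !card_tuple expnD.
Qed.

(** Lagrange's identity: twice the defect is the sum of the squared 2 by 2 minors over ordered pairs
    of indices. *)
Lemma sum_CS (I : finType) (x y : I -> R) :
  (\sum_i x i * y i) ^+ 2 <= (\sum_i x i ^+ 2) * (\sum_i y i ^+ 2).
Proof.
have : 0 <= \sum_i \sum_j (x i * y j - x j * y i) ^+ 2.
  by apply: sumr_ge0 => i _; apply: sumr_ge0 => j _; exact: sqr_ge0.
have -> : \sum_i \sum_j (x i * y j - x j * y i) ^+ 2 =
    (\sum_i x i ^+ 2) * (\sum_i y i ^+ 2) + (\sum_i y i ^+ 2) * (\sum_i x i ^+ 2)
     - 2 * ((\sum_i x i * y i) * (\sum_i x i * y i)).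
  rewrite !big_distrlr /= mulr_sumr -big_split -sumrB; apply: eq_bigr => i _ /=.
  rewrite mulr_sumr -big_split -sumrB; apply: eq_bigr => j _ /=; ring.
by rewrite expr2; lra.
Qed.

End boxes.

(** * Star-contractions as limits of contractions on boxes *)

Section star_contraction.
Context {R : realType} (n : nat) (f : n.-tuple nat -> R) (m : nat).
Hypothesis (mn : (m <= n)%N) (lf : l2 f).

Lemma l2_section_le (i : seq nat) (A : {fset m.-tuple nat}) : size i = (n - m)%N ->
  \sum_(a <- A) f (to_tuple n (i ++ a)) ^+ 2 <= l2_norm f ^+ 2.
Proof.
move=> si; pose h (a : m.-tuple nat) := to_tuple n (i ++ a).
have sz (a : m.-tuple nat) : size (i ++ a) = n by rewrite size_cat si size_tuple subnK.
have hi : injective h.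
  move=> a b /(congr1 val); rewrite /h !val_to_tuple // => /eqP.
  by rewrite eqseq_cat // eqxx /= => /eqP ab; apply/val_inj.
have := l2_fset_le (h @` A)%fset lf; rewrite big_imfset //=.
by move=> ? ? _ _ /hi.
Qed.

Lemma star_box_cvg (t : (n + n - 2 * m).-tuple nat) :
  \sum_(a : m.-tuple 'I_M) f (to_tuple n (take (n - m) t ++ map val a)) *
     f (to_tuple n (drop (n - m) t ++ map val a)) @[M --> \oo] --> star m f f t.
Proof.
have s1 : size (take (n - m) t) = (n - m)%N.
  by rewrite size_takel // size_tuple; lia.
have s2 : size (drop (n - m) t) = (n - m)%N.
  by rewrite size_drop size_tuple; lia.
rewrite /star.
apply: (@sumR_box_cvg _ _ (fun a : m.-tuple nat => f (to_tuple n (take (n - m) t ++ a)) *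
     f (to_tuple n (drop (n - m) t ++ a))) (l2_norm f ^+ 2 + l2_norm f ^+ 2)) => A.
apply: le_trans (lerD (l2_section_le A s1) (l2_section_le A s2)).
rewrite -big_split /=; apply: ler_sum => a _; rewrite normrM.
set u := f _; set v := f _.
rewrite -[u ^+ 2]real_normK ?num_real // -[v ^+ 2]real_normK ?num_real //.
have := sqr_ge0 (`|u| - `|v|); have := normr_ge0 u; have := normr_ge0 v; nra.
Qed.

(** Only the contracted range M tends to infinity; the free range N stays fixed, so the limit is a
    finite sum of limits given by [star_box_cvg]. *)
Lemma box_contr_star N :
  box_contr f m N M @[M --> \oo] -->
  \sum_(t : (n + n - 2 * m).-tuple 'I_N) star m f f (nat_tuple t) ^+ 2.
Proof.
have -> : (fun M => box_contr f m N M) = (fun M => \sum_(t : (n + n - 2 * m).-tuple 'I_N)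
  (\sum_(a : m.-tuple 'I_M) f (to_tuple n (take (n - m) (nat_tuple t) ++ map val a)) *
     f (to_tuple n (drop (n - m) (nat_tuple t) ++ map val a))) ^+ 2).
  apply/funext => M; rewrite /box_contr.
  rewrite (@sum_cat_tuple R N _ (n - m) (n - m) (fun s => (\sum_(a : m.-tuple 'I_M)
     f (to_tuple n (take (n - m) (map val s) ++ map val a)) *
     f (to_tuple n (drop (n - m) (map val s) ++ map val a))) ^+ 2)); last by lia.
  apply: eq_bigr => i _; apply: eq_bigr => j _; rewrite map_cat.
  by rewrite take_size_cat ?drop_size_cat // size_map size_tuple.
apply: cvg_big => [|t _]; first exact: add_continuous.
by have h := @star_box_cvg (nat_tuple t); have := cvgM h h; exact.
Qed.

(** Cauchy-Schwarz in the contracted variables: the norm of the contraction is at most the squared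
    norm of [f]. The bound is uniform in both ranges and yields [star_l2]. *)
Lemma box_contr_le_norm N M : (N <= M)%N -> box_contr f m N M <= (l2_norm f ^+ 2) ^+ 2.
Proof.
move=> NM; apply: (@le_trans _ _ (box_contr f m M M)).
  pose h (a : (n - m).-tuple 'I_N) : (n - m).-tuple 'I_M := [tuple of map (widen_ord NM) a].
  have hi : injective h.
    move=> a b /(congr1 val) /= /inj_map ab; apply/val_inj/ab => x y /(congr1 val) /= xy.
    exact/val_inj.
  rewrite !box_contr_gram.
  have -> : (fun (i : (n - m).-tuple 'I_N) (a : m.-tuple 'I_M) => f (to_tuple n (map val i ++ map val a))) =
    (fun i a => f (to_tuple n (map val (h i) ++ map val a))).
    apply/funext => i; apply/funext => a; congr (f (to_tuple n (_ ++ _))).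
    by rewrite /= -map_comp; apply: eq_map.
  exact: (gram_sub (fun (i : (n - m).-tuple 'I_M) (a : m.-tuple 'I_M) => f (to_tuple n (map val i ++ map val a))) hi).
have := l2_box_le M lf.
under eq_bigr => t _ do rewrite -to_nat_tuple.
rewrite (@sum_cat_tuple R M _ (n - m) m (fun s => f (to_tuple n (map val s)) ^+ 2)); last by rewrite subnK.
move=> h; apply: le_trans (_ : (\sum_(i : (n - m).-tuple 'I_M)
       \sum_(j : m.-tuple 'I_M) f (to_tuple n (map val (i ++ j))) ^+ 2) ^+ 2 <= _); last first.
  apply: lerXn2r => //; rewrite nnegrE ?exprn_ge0 ?sqrtr_ge0 //.
  by apply: sumr_ge0 => i _; apply: sumr_ge0 => j _; exact: sqr_ge0.
rewrite expr2 big_distrlr /= /box_contr; apply: ler_sum => i _; apply: ler_sum => j _.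
under [X in _ <= X * _]eq_bigr => a _ do rewrite map_cat.
under [X in _ <= _ * X]eq_bigr => a _ do rewrite map_cat.
exact: sum_CS.
Qed.

Lemma sum_box_star_le N :
  \sum_(t : (n + n - 2 * m).-tuple 'I_N) star m f f (nat_tuple t) ^+ 2 <= (l2_norm f ^+ 2) ^+ 2.
Proof.
apply: (cvgr_to_le (@box_contr_star N)).
by exists N => // M /= NM; exact: box_contr_le_norm.
Qed.

(** This gives [l2_norm (star m f f)] its meaning as a bound: an infinite sum of squares would be
    sent to 0 by [fine]. *)
Lemma star_l2 : l2 (star m f f).
Proof.
apply: (@bound_l2 _ _ _ ((l2_norm f ^+ 2) ^+ 2)) => A.
have [N /(_ N (leqnn N)) AN] := fsubset_box A.
apply: le_trans (sum_box_star_le N).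
rewrite -(sum_box _ (fun t => star m f f t ^+ 2) xpredT) (big_fsetID _ (mem A) (box _ N)) /=.
rewrite (_ : [fset x | x in box _ N & x \in A]%fset = A).
  by rewrite lerDl; apply: sumr_ge0 => t _; exact: sqr_ge0.
apply/fsetP => x; rewrite !inE /=; apply/andP/idP => [[]//|xA]; split => //.
by move/fsubsetP : AN => /(_ _ xA); rewrite !inE.
Qed.

(** Two monotone steps: the contracted range grows to infinity with the free range fixed, then the
    free range grows. *)
Lemma box_contr_le_star N : box_contr f m N N <= l2_norm (star m f f) ^+ 2.
Proof.
apply: (@le_trans _ _ (\sum_(t : (n + n - 2 * m).-tuple 'I_N) star m f f (nat_tuple t) ^+ 2)).
  apply: (cvgr_to_ge (@box_contr_star N)).
  by exists N => // M /= NM; exact: box_contr_mono.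
exact: l2_box_le star_l2.
Qed.

End star_contraction.

(** * Characteristic functions in a Rademacher chaos *)

Lemma cos_lipschitz {R : realType} (x y : R) : `|cos x - cos y| <= `|x - y|.
Proof.
have -> : cos x - cos y = - 2 * (sin ((x + y) / 2) * sin ((x - y) / 2)).
  have -> : cos x = cos ((x + y) / 2 + (x - y) / 2) by congr cos; field.
  have -> : cos y = cos ((x + y) / 2 - (x - y) / 2) by congr cos; field.
  by rewrite cosD cosB; ring.
rewrite normrM normrN. rewrite (ger0_norm (_ : 0 <= 2)) // normrM.
have h1 := sin_max ((x + y) / 2); have h2 := normr_sin_le ((x - y) / 2).
have h3 := normr_ge0 (sin ((x - y) / 2)).
have : `|(x - y) / 2| = `|x - y| / 2 by rewrite normrM (ger0_norm (_ : 0 <= 2^-1)) // invr_ge0.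
nra.
Qed.

(** * Expectations of bounded measurable functions *)

Section bounded_expectation.
Context {R : realType} d (T : measurableType d) (P : probability T R).
Implicit Types (h g : T -> R) (K : R).

Definition bmeas h := measurable_fun [set: T] h /\ exists K, forall w, `|h w| <= K.

Lemma bmeas_integrable h : bmeas h -> P.-integrable [set: T] (EFin \o h).
Proof.
move=> [mh [K hK]]; apply: measurable_bounded_integrable => //.
  by rewrite (le_lt_trans (probability_le1 _ _)) ?ltry.
exists K; split; first exact: num_real.
by move=> M KM w _ /=; apply: le_trans (hK w) (ltW KM).
Qed.

Lemma bmeasD h g : bmeas h -> bmeas g -> bmeas (fun w => h w + g w).
Proof.
move=> [mh [K hK]] [mg [M gM]]; split; first exact: measurable_funD.
exists (K + M) => w; apply: le_trans (ler_normD _ _) _; exact: lerD.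
Qed.

Lemma bmeasM h g : bmeas h -> bmeas g -> bmeas (fun w => h w * g w).
Proof.
move=> [mh [K hK]] [mg [M gM]]; split; first exact: measurable_funM.
by exists (K * M) => w; rewrite normrM ler_pM.
Qed.

Lemma bmeas_cst K : bmeas (fun=> K).
Proof. by split; [exact: measurable_cst|exists `|K|]. Qed.

Lemma bmeasZ K h : bmeas h -> bmeas (fun w => K * h w).
Proof. by move=> bh; apply: bmeasM => //; exact: bmeas_cst. Qed.

Lemma bmeasB h g : bmeas h -> bmeas g -> bmeas (fun w => h w - g w).
Proof.
move=> bh /(bmeasZ (-1)) bg; rewrite (_ : (fun w => _) = (fun w => h w + -1 * g w)).
  exact: bmeasD.
by apply/funext => w; rewrite mulN1r.
Qed.

Lemma bmeas_sum (I : Type) (r : seq I) (Q : pred I) (h : I -> T -> R) :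
  (forall i, bmeas (h i)) -> bmeas (fun w => \sum_(i <- r | Q i) h i w).
Proof.
move=> bh; elim: r => [|i r IH].
  by rewrite (_ : (fun w => _) = fun=> 0); [exact: bmeas_cst|apply/funext => w; rewrite big_nil].
case Qi: (Q i).
  rewrite (_ : (fun w => _) = fun w => h i w + \sum_(i <- r | Q i) h i w); first exact: bmeasD.
  by apply/funext => w; rewrite big_cons Qi.
rewrite (_ : (fun w => _) = fun w => \sum_(i <- r | Q i) h i w) //.
by apply/funext => w; rewrite big_cons Qi.
Qed.

Lemma exp_cst K : \int[P]_w K = K.
Proof. rewrite Rintegral_cst //=. have -> : P [set: T] = 1%E by exact: probability_setT. by rewrite mulr1. Qed.

Lemma expD h g : bmeas h -> bmeas g ->
  \int[P]_w (h w + g w) = \int[P]_w h w + \int[P]_w g w.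
Proof. by move=> bh bg; rewrite RintegralD //; exact: bmeas_integrable. Qed.

Lemma expB h g : bmeas h -> bmeas g ->
  \int[P]_w (h w - g w) = \int[P]_w h w - \int[P]_w g w.
Proof. by move=> bh bg; rewrite RintegralB //; exact: bmeas_integrable. Qed.

Lemma expZ K h : bmeas h -> \int[P]_w (K * h w) = K * \int[P]_w h w.
Proof. by move=> bh; rewrite RintegralZl //; exact: bmeas_integrable. Qed.

Lemma exp_sum (I : Type) (r : seq I) (Q : pred I) (h : I -> T -> R) :
  (forall i, bmeas (h i)) ->
  \int[P]_w (\sum_(i <- r | Q i) h i w) = \sum_(i <- r | Q i) \int[P]_w h i w.
Proof.
move=> bh; elim: r => [|i r IH].
  by under eq_Rintegral do rewrite big_nil; rewrite exp_cst big_nil.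
rewrite big_cons -IH; under eq_Rintegral do rewrite big_cons.
by case: ifP => // _; rewrite expD //; exact: bmeas_sum.
Qed.

Lemma ler_exp h g : bmeas h -> bmeas g -> (forall w, h w <= g w) ->
  \int[P]_w h w <= \int[P]_w g w.
Proof. by move=> bh bg hg; apply: le_Rintegral => //; exact: bmeas_integrable. Qed.

Lemma norm_exp_le h K : measurable_fun [set: T] h -> (forall w, `|h w| <= K) ->
  `|\int[P]_w h w| <= K.
Proof.
move=> mh hK; have bh : bmeas h by split => //; exists K.
rewrite ler_norml -{1}(exp_cst (- K)) -{2}(exp_cst K).
apply/andP; split; apply: ler_exp => //; try exact: bmeas_cst.
  by move=> w; have := hK w; rewrite ler_norml => /andP[].
by move=> w; have := hK w; rewrite ler_norml => /andP[].
Qed.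

Lemma ae_eq_exp h g : bmeas h -> bmeas g -> {ae P, forall w, h w = g w} ->
  \int[P]_w h w = \int[P]_w g w.
Proof.
move=> [mh _] [mg _] hg; rewrite /Rintegral; congr fine; apply: ae_eq_integral => //.
- exact/measurable_EFinP.
- exact/measurable_EFinP.
- by apply: filterS hg => w -> _.
Qed.

Lemma bmeas_cos (G : T -> R) (t th : R) : measurable_fun [set: T] G ->
  bmeas (fun w => cos (t * G w + th)).
Proof.
move=> mG; split; last by exists 1 => w; exact: cos_max.
apply: (measurableT_comp (continuous_measurable_fun (@continuous_cos R))).
by apply: measurable_funD => //; exact: measurable_funM.
Qed.

(* Lipschitz transfer in L^2: from [|x| <= delta + x^2 / delta] one avoids the square root of
   Cauchy-Schwarz. *)
Lemma exp_cos_dist (F G : T -> R) (t th e delta : R) : 0 <= t -> 0 < delta ->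
    measurable_fun [set: T] F -> measurable_fun [set: T] G ->
    ('E_P[fun w => ((F w - G w) ^+ 2)%R] <= e%:E)%E ->
  `|\int[P]_w cos (t * F w + th) - \int[P]_w cos (t * G w + th)| <= t * (delta + e / delta).
Proof.
move=> t0 delta0 mF mG EFG.
have bF := bmeas_cos t th mF; have bG := bmeas_cos t th mG.
rewrite -expB // -lee_fin EFin_normr_Rintegral //; last exact/bmeas_integrable/bmeasB.
apply: le_trans (le_abse_integral _ _ _) _ => //.
  by apply/measurable_EFinP; have [] := bmeasB bF bG.
have m2 : measurable_fun [set: T] (fun w => (F w - G w) ^+ 2).
  by apply: measurable_funX; exact: measurable_funB.
apply: (@le_trans _ _ (\int[P]_w (t * delta + (t / delta) * (F w - G w) ^+ 2)%:E)%E).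
  apply: ge0_le_integral => //.
  - by apply: measurableT_comp => //; apply/measurable_EFinP; have [] := bmeasB bF bG.
  - by apply/measurable_EFinP; apply: measurable_funD => //; exact: measurable_funM.
  move=> w _; rewrite /= lee_fin.
  apply: le_trans (cos_lipschitz _ _) _.
  have -> : t * F w + th - (t * G w + th) = t * (F w - G w) by ring.
  rewrite normrM (ger0_norm t0) -mulrA -mulrDr ler_wpM2l //.
  rewrite -(@ler_pM2l _ delta) // mulrDr mulrA mulfV ?gt_eqF // mul1r.
  rewrite -[(F w - G w) ^+ 2]real_normK ?num_real //.
  have := sqr_ge0 (delta - `|F w - G w|); have := normr_ge0 (F w - G w); nra.
under eq_integral do rewrite EFinD [(t / delta * _)%:E]EFinM.
rewrite ge0_integralD //; first last.
- by apply: measurable_funeM; exact/measurable_EFinP.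
- by move=> w _; rewrite mule_ge0 // lee_fin ?sqr_ge0 ?divr_ge0 // ltW.
- by move=> w _; rewrite lee_fin mulr_ge0 // ltW.
have P1 : P [set: T] = 1%E by exact: probability_setT.
rewrite integral_cst //= P1 mule1 ge0_integralZl //; first last.
- by rewrite lee_fin divr_ge0 // ltW.
- by move=> w _; rewrite lee_fin sqr_ge0.
- exact/measurable_EFinP.
have -> : t * (delta + e / delta) = t * delta + t / delta * e by ring.
rewrite EFinD leeD2l // [(t / delta * e)%:E]EFinM lee_wpmul2l //.
  by rewrite lee_fin divr_ge0 // ltW.
by move: EFG; rewrite unlock.
Qed.

End bounded_expectation.

(** * From the random signs to the discrete cube *)

Section rademacher.
Context {d : measure_display} {T : measurableType d} {R : realType}
  (P : probability T R) (Y : nat -> {RV P >-> R}) (rY : iid_rademacher Y).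

Definition sgn_event N (x : {ffun 'I_N -> bool}) : set T :=
  [set w | forall k : 'I_N, Y k w = sgnc k x].

(** [independent_RV] takes a Borel set for every index; [insub] supplies the whole line for the
    indices from N on. *)
Lemma sgn_eventE N (x : {ffun 'I_N -> bool}) :
  sgn_event x = \bigcap_(k in [set` [fset k | k in iota 0 N]%fset])
    Y k @^-1` (if insub k is Some i then [set sgnc i x] else setT).
Proof.
apply/seteqP; split=> w /=.
  move=> h k /=; rewrite !inE /= mem_iota /= add0n => kN.
  by rewrite insubT; exact: (h (Ordinal kN)).
move=> h k; have := h k; rewrite /= !inE /= mem_iota /= add0n ltn_ord => /(_ isT).
by rewrite (insubT (fun i => i < N)%N (ltn_ord k)) /= => ->; congr (sgnc _ x); apply/val_inj.
Qed.

Lemma measurable_sgn_event N (x : {ffun 'I_N -> bool}) : measurable (sgn_event x).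
Proof.
have -> : sgn_event x = \bigcap_k (Y k @^-1` (if insub k is Some i then [set sgnc i x] else setT)).
  apply/seteqP; split=> w /=.
    by move=> h k _ /=; case: insubP => [i _ <-|_] //=; exact: h.
  move=> h k; have := h k I; rewrite /=.
  by rewrite (insubT (fun i => i < N)%N (ltn_ord k)) /= => ->; congr (sgnc _ x); apply/val_inj.
apply: bigcapT_measurable => k; apply: measurable_funPTI.
by case: insubP => [i _ _|_]; [exact: measurable_set1|exact: measurableT].
Qed.

Lemma prob_sgn_event N (x : {ffun 'I_N -> bool}) : P (sgn_event x) = ((2 ^+ N)^-1)%:E.
Proof.
rewrite sgn_eventE rY.1; last first.
  by move=> k; case: insubP => [i _ _|_]; [exact: measurable_set1|exact: measurableT].
rewrite (perm_big (iota 0 N)) /=; last first.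
  by apply: uniq_perm; rewrite ?fset_uniq ?iota_uniq // => k; rewrite !inE.
rewrite (eq_big_seq (fun=> (2^-1)%:E)); last first.
  move=> k; rewrite mem_iota /= add0n => kN; rewrite insubT /= /sgnc.
  by have [h1 h2] := rY.2 k; case: (x _); rewrite ?expr1 ?expr0.
rewrite -{1}(subn0 N) -/(index_iota 0 N).
elim: (N) => [|n IH]; first by rewrite big_nil expr0 invr1.
by rewrite big_nat_recr //= IH -EFinM exprS invfM mulrC.
Qed.


Lemma ae_sign : {ae P, forall w, forall k, Y k w = 1 \/ Y k w = -1}.
Proof.
apply/ae_foralln => k; have [h1 h2] := rY.2 k.
have m1 (a : R) : measurable (Y k @^-1` [set a]).
  by apply: measurable_funPTI; exact: measurable_set1.
exists (~` (Y k @^-1` [set 1] `|` Y k @^-1` [set -1])); split.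
- by apply: measurableC; apply: measurableU.
- apply: etrans (probability_setC P (measurableU _ _ (m1 1) (m1 (-1)))) _.
  rewrite measureU //; last first.
    by apply/seteqP; split => // w [/= -> /eqP]; rewrite -subr_eq0 opprK (eqr_nat R 2 0).
  have -> : (P (Y k @^-1` [set 1%R]) + P (Y k @^-1` [set (-1)%R]) = 1)%E.
    by rewrite [X in (X + _)%E]h1 [X in (_ + X)%E]h2 -EFinD; congr EFin; field.
  by rewrite subee.
- by move=> w /= h [e|e]; apply: h; [left|right].
Qed.

(** The sign events are disjoint, have mass 2^-N each, and cover the space up to the null set where
    some [Y k] is neither 1 nor -1; hence [h] is almost surely a simple function. *)
Lemma exp_cube N (h : T -> R) (Phi : {ffun 'I_N -> bool} -> R) : bmeas h ->
  (forall x w, sgn_event x w -> h w = Phi x) -> \int[P]_w h w = avg Phi.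
Proof.
move=> bh hPhi.
have bI x : bmeas (\1_(sgn_event x) : T -> R).
  split; first by apply: measurable_indic; exact: measurable_sgn_event.
  by exists 1 => w; rewrite indicE; case: (_ \in _); rewrite ?normr1 ?normr0.
rewrite (@ae_eq_exp _ _ _ P h (fun w => \sum_x Phi x * \1_(sgn_event x) w)) //; first last.
- apply: filterS ae_sign => w hw.
  pose x : {ffun 'I_N -> bool} := [ffun k => Y (val k) w == -1].
  have xw : sgn_event x w.
    move=> k; rewrite /sgnc ffunE; have [->|->] := hw k; rewrite ?eqxx ?expr1 //.
    by rewrite -subr_eq0 opprK (eqr_nat R 2 0) expr0.
  rewrite (bigD1 x) //= indicE mem_set // mulr1 big1 ?addr0; first exact: hPhi.
  move=> y yx; rewrite indicE memNset ?mulr0 // => yw.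
  move/eqP: yx; apply; apply/ffunP => k; rewrite ffunE yw /sgnc; case: (y k).
    by rewrite expr1 eqxx.
  by apply/esym/negbTE; rewrite expr0 -subr_eq0 opprK (eqr_nat R 2 0).
- by apply: bmeas_sum => x; exact: bmeasZ.
rewrite exp_sum; last by move=> x; exact: bmeasZ.
rewrite /avg mulr_sumr; apply: eq_bigr => x _; rewrite expZ // mulrC; congr (_ * _).
rewrite /Rintegral integral_indic //; last exact: measurable_sgn_event.
by rewrite setIT; exact: (congr1 fine (prob_sgn_event x)).
Qed.

(** Weaker than [is_J], since it only looks along boxes, and stated for a plain function [F], so
    that it applies to the combinations F_k + e F_j. *)
Definition box_lim l (g : l.-tuple nat -> R) (F : T -> R) :=
  forall e : R, 0 < e -> exists N0, forall N, (N0 <= N)%N ->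
  ('E_P[fun w => ((F w - partial_J Y g (box l N) w) ^+ 2)%R] <= e%:E)%E.

Lemma is_J_box_lim l (g : l.-tuple nat -> R) (F : {RV P >-> R}) :
  is_J Y g F -> box_lim g F.
Proof.
move=> JF e e0.
have : \forall A \near summability.totally,
    ('E_P[fun w => ((F w - partial_J Y g A w) ^+ 2)%R] < e%:E)%E.
  apply: (JF [set y | (y < e%:E)%E]); apply: open_nbhs_nbhs; split; first exact: open_ereal_lt_ereal.
  by rewrite /= lte_fin.
move=> [A0 _ hA]; have [N0 h0] := fsubset_box A0.
by exists N0 => N /h0 /hA /= /ltW.
Qed.

Lemma partial_J_box l (g : l.-tuple nat -> R) N w :
  partial_J Y g (box l N) w =
  \sum_(t : l.-tuple 'I_N | uniq t) g (nat_tuple t) * \prod_(k < l) Y (val (tnth t k)) w.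
Proof.
rewrite /partial_J sum_box; apply: eq_big => t; first by rewrite /= map_inj_uniq //; exact: val_inj.
by move=> _; congr (_ * _); apply: eq_bigr => k _; rewrite tnth_map.
Qed.

Lemma bmeas_partial_J_cos l (g : l.-tuple nat -> R) A t th :
  bmeas (fun w => cos (t * partial_J Y g A w + th)).
Proof.
apply: bmeas_cos; rewrite /partial_J.
under eq_fun do rewrite big_mkcond.
apply: measurable_sum => s; case: (uniq s); last exact: measurable_cst.
apply: measurable_funM; first exact: measurable_cst.
apply: measurable_prod => k _; exact: measurable_funP.
Qed.

End rademacher.

Section charfun.
Context {d : measure_display} {T : measurableType d} {R : realType}
  (P : probability T R) (Y : nat -> {RV P >-> R}) (rY : iid_rademacher Y).

Lemma sgn_event_partial_J l (g : l.-tuple nat -> R) N (x : {ffun 'I_N -> bool}) w :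
    symmetric_kernel g -> (forall t : l.-tuple nat, ~~ uniq t -> g t = 0) ->
    sgn_event Y x w ->
  partial_J Y g (box l N) w = wpoly (kset g) x.
Proof.
move=> gs gd xw; rewrite partial_J_box /wpoly /walsh -(sum_tuple_wpoly (fun k => sgnc k x) gs gd).
by apply: eq_bigr => t _; congr (_ * _); apply: eq_bigr => k _; rewrite xw.
Qed.

Lemma box_charfun_bound l (g : l.-tuple nat -> R) N (t th : R) :
    (2 <= l)%N -> symmetric_kernel g -> (forall t : l.-tuple nat, ~~ uniq t -> g t = 0) ->
    0 <= t ->
  `|\int[P]_w cos (t * partial_J Y g (box l N) w + th) -
    expR (- (t ^+ 2 / 2 * \sum_(S : {set 'I_N}) kset g S ^+ 2)) * cos th| <=
  t ^+ 4 * (9 ^+ l * contr_energy l (kset g (N := N))) +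
  t ^+ 2 * (2 ^+ l * Num.sqrt (contr_energy l (kset g (N := N)))).
Proof.
move=> l2 gs gd t0.
rewrite (@exp_cube _ _ _ P Y rY N _ (fun x => cos (t * wpoly (kset g) x + th))).
- by apply: cube_charfun_bound => //; exact: kset_homogeneous.
- exact: bmeas_partial_J_cos.
- by move=> x w xw; rewrite (sgn_event_partial_J gs gd xw).
Qed.

Lemma box_lim_cos_cvg l (g : l.-tuple nat -> R) (F : T -> R) t th :
  measurable_fun [set: T] F -> 0 <= t ->
  box_lim Y g F ->
  \int[P]_w cos (t * partial_J Y g (box l N) w + th) @[N --> \oo] -->
  \int[P]_w cos (t * F w + th).
Proof.
move=> mF t0 gF; apply/cvgrPdist_le => e e0.
pose delta := e / (2 * (t + 1)).
have delta0 : 0 < delta by rewrite divr_gt0 // mulr_gt0 // ltr_wpDl.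
have [|N0 hN] := gF (delta ^+ 2); first by rewrite exprn_gt0.
exists N0 => // N /= /hN hE.
apply: le_trans (exp_cos_dist th t0 delta0 mF _ hE) _.
- rewrite /partial_J; under eq_fun do rewrite big_mkcond.
  apply: measurable_sum => s; case: (uniq s); last exact: measurable_cst.
  apply: measurable_funM; first exact: measurable_cst.
  by apply: measurable_prod => k _; exact: measurable_funP.
- have -> : delta ^+ 2 / delta = delta by rewrite expr2 mulfK // gt_eqF.
  have e_def : e = delta * (2 * (t + 1)) by rewrite /delta divfK // gt_eqF // mulr_gt0 // ltr_wpDl.
  by rewrite [leRHS]e_def; nra.
Qed.

(* The summand 2 covers the case where the bound on the contractions exceeds 1. *)
Definition charfun_cst l (t : R) : R :=
  t ^+ 4 * (9 ^+ l * l`!%:R ^+ 4) + t ^+ 2 * (2 ^+ l * l`!%:R ^+ 2) + 2.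

Lemma charfun_cst_ge0 l t : 0 <= charfun_cst l t.
Proof.
rewrite /charfun_cst addr_ge0 // addr_ge0 // mulr_ge0 ?exprn_even_ge0 //;
  by apply: mulr_ge0; rewrite exprn_ge0 ?ler0n.
Qed.

Lemma charfun_cst_le l t r : 0 <= t <= r -> charfun_cst l t <= charfun_cst l r.
Proof.
move=> /andP[t0 tr]; have r0 := le_trans t0 tr.
rewrite /charfun_cst lerD2r lerD // ler_wpM2r ?mulr_ge0 ?exprn_ge0 ?ler0n //;
  by apply: lerXn2r => //; rewrite nnegrE.
Qed.

(** The variance [s2] and the bounds [s m] on contraction norms are abstract, so that the statement
    serves both for a single F_k and for F_k plus or minus F_j. The estimates are made on boxes,
    uniformly in N, and the limit is taken at the end. *)
Lemma charfun_bound l (g : l.-tuple nat -> R) (F : T -> R) (s : nat -> R) (s2 t th : R) :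
    measurable_fun [set: T] F -> (2 <= l)%N -> symmetric_kernel g -> (forall t : l.-tuple nat, ~~ uniq t -> g t = 0) ->
    box_lim Y g F -> (forall m, 0 <= s m) ->
    (forall m N, (1 <= m < l)%N -> box_contr g m N N <= s m ^+ 2) ->
    l`!%:R * \sum_(t : l.-tuple 'I_N) g (nat_tuple t) ^+ 2 @[N --> \oo] --> s2 ->
    0 <= s2 -> 0 <= t ->
  `|\int[P]_w cos (t * F w + th) - expR (- (t ^+ 2 / 2 * s2)) * cos th| <=
  charfun_cst l t * \sum_(1 <= m < l) s m.
Proof.
move=> mF l2 gs gd gF s0 hs hs2 s20 t0.
set S := \sum_(1 <= m < l) s m.
have S0 : 0 <= S by apply: sumr_ge0.
have [S1|S1] := ltP 1 S.
  apply: (@le_trans _ _ 2).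
    apply: le_trans (ler_normB _ _) _; apply: lerD.
      apply: norm_exp_le; last by move=> w; exact: cos_max.
      by have [] := bmeas_cos t th mF.
    rewrite normrM (ger0_norm (expR_ge0 _)) mulr_ile1 ?expR_ge0 ?cos_max //.
    by rewrite -expR0 ler_expR oppr_le0 mulr_ge0 // divr_ge0 // exprn_ge0.
  have : 0 <= t ^+ 4 * (9 ^+ l * l`!%:R ^+ 4) + t ^+ 2 * (2 ^+ l * l`!%:R ^+ 2).
    by rewrite addr_ge0 // !mulr_ge0 // ?exprn_ge0 ?ler0n.
  by rewrite /charfun_cst; nra.
(* Now S is at most 1. The energy is at most l!^4 S^2, so both it and its square root are bounded by
   multiples of S, and the rate is linear. *)
pose X N := contr_energy l (kset g (N := N)).
have XS N : X N <= l`!%:R ^+ 4 * S ^+ 2.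
  apply: le_trans (contr_energy_le N gs gd) _; rewrite ler_wpM2l ?exprn_ge0 ?ler0n //.
  apply: (@le_trans _ _ (\sum_(1 <= m < l) s m ^+ 2)).
    by rewrite !big_nat; apply: ler_sum => m hm; exact: hs.
  rewrite expr2 /S mulr_suml; apply: ler_sum_nat => m hm.
  rewrite expr2 ler_wpM2l // (bigD1_seq m) ?iota_uniq ?mem_index_iota //= lerDl.
  exact: sumr_ge0.
have X0 N : 0 <= X N by apply: sumr_ge0 => A _; apply: sumr_ge0 => B _; exact: sqr_ge0.
have hb N : `|\int[P]_w cos (t * partial_J Y g (box l N) w + th) -
    expR (- (t ^+ 2 / 2 * (l`!%:R * \sum_(t : l.-tuple 'I_N) g (nat_tuple t) ^+ 2))) * cos th| <= charfun_cst l t * S.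
  rewrite -(sum_ksetM N gs gd gs gd).
  apply: le_trans (box_charfun_bound N th l2 gs gd t0) _.
  have sqrtX : Num.sqrt (X N) <= l`!%:R ^+ 2 * S.
    have -> : l`!%:R ^+ 2 * S = Num.sqrt ((l`!%:R ^+ 2 * S) ^+ 2).
      by rewrite sqrtr_sqr ger0_norm // mulr_ge0 // exprn_ge0 ?ler0n.
    by rewrite ler_wsqrtr // exprMn -exprM.
  have SS : l`!%:R ^+ 4 * S ^+ 2 <= l`!%:R ^+ 4 * S.
    by rewrite ler_wpM2l ?exprn_ge0 ?ler0n // expr2; apply: ler_piMl.
  have -> : charfun_cst l t * S = (t ^+ 4 * (9 ^+ l * (l`!%:R ^+ 4 * S)) +
      t ^+ 2 * (2 ^+ l * (l`!%:R ^+ 2 * S))) + 2 * S by rewrite /charfun_cst; ring.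
  rewrite -[leLHS]addr0; apply: lerD; last exact: mulr_ge0.
  apply: lerD; rewrite ler_wpM2l ?exprn_ge0 // ler_wpM2l ?exprn_ge0 ?ler0n //.
  exact: le_trans (XS N) SS.
have cv : `|\int[P]_w cos (t * partial_J Y g (box l N) w + th) -
    expR (- (t ^+ 2 / 2 * (l`!%:R * \sum_(t : l.-tuple 'I_N) g (nat_tuple t) ^+ 2))) * cos th| @[N --> \oo] -->
    `|\int[P]_w cos (t * F w + th) - expR (- (t ^+ 2 / 2 * s2)) * cos th|.
  apply: cvg_norm; apply: cvgB; first exact: box_lim_cos_cvg.
  apply: cvgM; last exact: cvg_cst.
  apply: continuous_cvg; first exact: continuous_expR.
  by apply: cvgN; apply: cvgM => //; exact: cvg_cst.
by apply: (cvgr_to_le cv); exact: nearW.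
Qed.

Lemma partial_J_add l (g h : l.-tuple nat -> R) (e : R) A w :
  partial_J Y (fun t => g t + e * h t) A w = partial_J Y g A w + e * partial_J Y h A w.
Proof.
rewrite /partial_J mulr_sumr -big_split; apply: eq_bigr => t _ /=.
by rewrite mulrDl mulrA.
Qed.

Lemma box_lim_add l (g h : l.-tuple nat -> R) (F G : {RV P >-> R}) (e : R) : e ^+ 2 = 1 ->
  box_lim Y g F -> box_lim Y h G ->
  box_lim Y (fun t => g t + e * h t) (fun w => F w + e * G w).
Proof.
move=> e1 gF hG a a0.
have a4 : 0 < a / 4 by rewrite divr_gt0.
have [N1 h1] := gF _ a4; have [N2 h2] := hG _ a4.
exists (maxn N1 N2) => N; rewrite geq_max => /andP[/h1 {}h1 /h2 {}h2].
have mJ (k : l.-tuple nat -> R) : measurable_fun [set: T] (partial_J Y k (box l N)).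
  rewrite /partial_J; under eq_fun do rewrite big_mkcond.
  apply: measurable_sum => s; case: (uniq s); last exact: measurable_cst.
  apply: measurable_funM; first exact: measurable_cst.
  by apply: measurable_prod => k' _; exact: measurable_funP.
have m2 (H : {RV P >-> R}) k : measurable_fun [set: T] (fun w => (H w - partial_J Y k (box l N) w) ^+ 2).
  by apply: measurable_funX; apply: measurable_funB; [exact: measurable_funP|exact: mJ].
move: h1 h2; rewrite unlock => h1 h2.
apply: (@le_trans _ _ (\int[P]_w (2%:E * ((F w - partial_J Y g (box l N) w) ^+ 2)%:E +
   2%:E * ((G w - partial_J Y h (box l N) w) ^+ 2)%:E))%E).
  apply: ge0_le_integral => //.
  - by move=> w _; rewrite lee_fin sqr_ge0.
  - apply/measurable_EFinP; apply: measurable_funX; apply: measurable_funB; last exact: mJ.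
    by apply: measurable_funD; [exact: measurable_funP|apply: measurable_funM => //; exact: measurable_funP].
  - by apply: emeasurable_funD; apply: measurable_funeM; exact/measurable_EFinP.
  - move=> w _; rewrite partial_J_add -!EFinM -EFinD lee_fin.
    set u := F w; set v := G w; set u' := partial_J _ _ _ _; set v' := partial_J _ _ _ _.
    have -> : u + e * v - (u' + e * v') = (u - u') + e * (v - v') by ring.
    have <- : (e * (v - v')) ^+ 2 = (v - v') ^+ 2 by rewrite exprMn e1 mul1r.
    by move: (u - u') (e * (v - v')) => x y; have := sqr_ge0 (x - y); nra.
rewrite ge0_integralD //; first last.
- by apply: measurable_funeM; exact/measurable_EFinP.
- by move=> w _; rewrite mule_ge0 // lee_fin sqr_ge0.
- by apply: measurable_funeM; exact/measurable_EFinP.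
- by move=> w _; rewrite mule_ge0 // lee_fin sqr_ge0.
rewrite !ge0_integralZl //; first last.
- by move=> w _; rewrite lee_fin sqr_ge0.
- exact/measurable_EFinP.
- by move=> w _; rewrite lee_fin sqr_ge0.
- exact/measurable_EFinP.
have -> : a%:E = (2%:E * (a / 4)%:E + 2%:E * (a / 4)%:E)%E.
  by rewrite -!EFinM -EFinD; congr EFin; field.
by apply: leeD; apply: lee_wpmul2l.
Qed.

End charfun.

(** * Weak convergence through trigonometric test functions *)

Section normal_charfun.
Context {R : realType}.
Local Notation mu := (@lebesgue_measure R).

(** The change of variables holds with the Radon-Nikodym derivative, which agrees almost everywhere
    with the density because both have the same integral over every measurable set. *)
Lemma integral_normal_prob (h : R -> R) : bmeas (h : measurableTypeR R -> R) ->
  \int[normal_prob 0 1]_x h x = \int[mu]_x (h x * normal_pdf 0 1 x).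
Proof.
move=> bh; have [mh _] := bh.
have ih : (normal_prob 0 1).-integrable setT (EFin \o h) by exact: (bmeas_integrable _ bh).
have dom := @normal_prob_dominates R 0 1.
rewrite /Rintegral; congr fine.
rewrite -(Radon_Nikodym_change_of_variables dom) //=.
apply: ae_eq_integral => //.
- apply: emeasurable_funM; first exact/measurable_EFinP.
  by apply: (measurable_int mu); exact: Radon_Nikodym_integrable.
- by apply/measurable_EFinP; apply: measurable_funM => //; exact: measurable_normal_pdf.
- rewrite (_ : (fun x => (h x * normal_pdf 0 1 x)%:E) = (fun x => (h x)%:E * (normal_pdf 0 1 x)%:E)%E); last first.
    by apply/funext => x; rewrite EFinM.
  apply: ae_eqe_mul2l => /=.
  rewrite Radon_NikodymE //=; case: cid => /= k [k1 k2 k3].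
  apply: integral_ae_eq => //=.
  + by apply/measurable_EFinP; exact: measurable_normal_pdf.
  + by move=> E _ mE; rewrite -k3.
Qed.

(** Gaussian density of standard deviation [a] without its normalising factor. The case a = sqrt 2
    serves as an integrable bound for x times the case a = 1. *)
Definition gaussk (a x : R) : R := expR (- (x ^+ 2 / (2 * a ^+ 2))).

Lemma gaussk_normal_fun a : gaussk a = normal_fun 0 a.
Proof. by apply/funext => x; rewrite /gaussk /normal_fun subr0 mulNr mulr_natl. Qed.

Lemma integrable_gaussk a : a != 0 -> mu.-integrable setT (EFin \o gaussk a).
Proof.
move=> a0; have := integrable_normal_pdf 0 a.
rewrite normal_pdfE // => h.
have -> : EFin \o gaussk a = (fun x => ((normal_peak a)^-1)%:E * (normal_peak a * normal_fun 0 a x)%:E)%E.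
  by apply/funext => x /=; rewrite -EFinM mulKf ?gaussk_normal_fun // gt_eqF // normal_peak_gt0.
exact: integrableZl.
Qed.

Lemma continuous_gaussk a : continuous (gaussk a).
Proof.
move=> x; apply: continuous_comp; last exact: continuous_expR.
apply: cvgN; apply: cvgM; last exact: cvg_cst.
exact: exprn_continuous.
Qed.

Lemma is_derive_gaussk (x : R) : is_derive x 1 (gaussk 1) (- (x * gaussk 1 x)).
Proof.
rewrite (_ : gaussk 1 = (fun x => expR (- (x ^+ 2 * 2^-1)))); last first.
  by apply/funext => y; rewrite /gaussk expr1n mulr1.
by apply: is_derive_eq; rewrite /GRing.scale /=; field.
Qed.

(** |x| <= 1 + x^2 / 4 <= exp(x^2 / 4), and this factor changes the variance from 1 to 2. *)
Lemma norm_mul_gaussk_le x : `|x| * gaussk 1 x <= gaussk (Num.sqrt 2) x.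
Proof.
have -> : gaussk 1 x = expR (- (x ^+ 2 / 4)) * gaussk (Num.sqrt 2) x.
  by rewrite /gaussk sqr_sqrtr // -expRD; congr expR; field.
rewrite mulrA ler_piMl ?expR_ge0 // expRN -/(_ / _) ler_pdivrMr ?expR_gt0 // mul1r.
apply: le_trans (expR_ge1Dx _); rewrite -[x ^+ 2]real_normK ?num_real //.
have := sqr_ge0 (`|x| - 2); nra.
Qed.

Lemma gaussk_nat_le n : gaussk 1 n%:R <= 2 / n.+1%:R.
Proof.
rewrite /gaussk expRN -[leLHS]mul1r ler_pdivrMr ?expR_gt0 // mulrAC ler_pdivlMr ?ltr0n //.
rewrite mul1r; apply: le_trans (ler_wpM2l _ (expR_ge1Dx _)) => //.
by rewrite -natr1; have := sqr_ge0 (n%:R - 1 : R); nra.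
Qed.

Lemma gaussk_ge0 a x : 0 <= gaussk a x.
Proof. exact: expR_ge0. Qed.

Lemma gaussk_abs x : gaussk 1 `|x| = gaussk 1 x.
Proof. by rewrite /gaussk real_normK ?num_real. Qed.

Lemma measurable_continuous (h : R -> R) : continuous h -> measurable_fun [set: R] h.
Proof. exact: continuous_measurable_fun. Qed.

Lemma bounded_gaussk_integrable (h : R -> R) K : continuous h -> (forall x, `|h x| <= K) ->
  mu.-integrable setT (fun x => (h x * gaussk 1 x)%:E).
Proof.
move=> ch hK.
apply: (@le_integrable _ _ _ mu setT _ _ (fun x => K%:E * (gaussk 1 x)%:E)%E) => //.
- apply/measurable_EFinP; apply: measurable_funM; first exact: measurable_continuous.
  exact: (measurable_continuous (@continuous_gaussk 1)).
- move=> x _; rewrite -EFinM lee_fin !normrM ler_wpM2r //.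
  exact: le_trans (hK x) (ler_norm _).
- by apply: integrableZl => //; apply: integrable_gaussk; rewrite oner_neq0.
Qed.

Lemma xgaussk_integrable (h : R -> R) : continuous h -> (forall x, `|h x| <= 1) ->
  mu.-integrable setT (fun x => (x * h x * gaussk 1 x)%:E).
Proof.
move=> ch hK.
apply: (@le_integrable _ _ _ mu setT _ _ (fun x => (gaussk (Num.sqrt 2) x)%:E)%E) => //.
- apply/measurable_EFinP; apply: measurable_funM; last exact: (measurable_continuous (@continuous_gaussk 1)).
  by apply: measurable_funM => //; exact: measurable_continuous.
- move=> x _; rewrite lee_fin !normrM (ger0_norm (expR_ge0 _)) (ger0_norm (expR_ge0 _)).
  by apply: le_trans (norm_mul_gaussk_le x); rewrite mulrAC; apply: ler_piMr => //.
- by apply: integrable_gaussk; rewrite gt_eqF // sqrtr_gt0.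
Qed.

Lemma continuous_affine_sin (t th : R) : continuous (fun x : R => sin (t * x + th)).
Proof.
move=> x; apply: continuous_comp; last exact: continuous_sin.
apply: cvgD; last exact: cvg_cst.
by apply: cvgM; [exact: cvg_cst|exact: cvg_id].
Qed.

Lemma continuous_affine_cos (t th : R) : continuous (fun x : R => cos (t * x + th)).
Proof.
move=> x; apply: continuous_comp; last exact: continuous_cos.
apply: cvgD; last exact: cvg_cst.
by apply: cvgM; [exact: cvg_cst|exact: cvg_id].
Qed.

(** The difference of the two integrands is, up to sign, the derivative of sin(t x + th) exp(-x^2 /
    2). Its integral over [-n - 1, n + 1] is a boundary term that tends to 0, and dominated
    convergence identifies the limit. *)
Lemma gauss_stein (t th : R) :
  \int[mu]_x (x * sin (t * x + th) * gaussk 1 x) = t * \int[mu]_x (cos (t * x + th) * gaussk 1 x).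
Proof.
have i1 : mu.-integrable setT (fun x => (x * sin (t * x + th) * gaussk 1 x)%:E).
  apply: (@xgaussk_integrable (fun x => sin (t * x + th))); first exact: continuous_affine_sin.
  by move=> x; exact: sin_max.
have i2 : mu.-integrable setT (fun x => (cos (t * x + th) * gaussk 1 x)%:E).
  apply: (@bounded_gaussk_integrable (fun x => cos (t * x + th)) 1); first exact: continuous_affine_cos.
  by move=> x; exact: cos_max.
pose h x := t * (cos (t * x + th) * gaussk 1 x) - x * sin (t * x + th) * gaussk 1 x.
have i2t : mu.-integrable setT (fun x => (t * (cos (t * x + th) * gaussk 1 x))%:E).
  by under eq_fun do rewrite EFinM; exact: integrableZl.
have ih : mu.-integrable setT (EFin \o h).
  rewrite (_ : EFin \o h = (fun x => (t * (cos (t * x + th) * gaussk 1 x))%:E - (x * sin (t * x + th) * gaussk 1 x)%:E)%E).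
    exact: integrableB.
  by apply/funext => x /=; rewrite -EFinB.
suff : (\int[mu]_x (h x)%:E = 0)%E.
  move=> h0.
  have : \int[mu]_x h x = 0 by rewrite /Rintegral h0.
  rewrite RintegralB // RintegralZl // => /eqP; rewrite subr_eq0 => /eqP ->; by [].
have ch : continuous h.
  move=> x; apply: cvgB.
    apply: cvgM; first exact: cvg_cst.
    by apply: cvgM; [exact: continuous_affine_cos|exact: continuous_gaussk].
  apply: cvgM; last exact: continuous_gaussk.
  by apply: cvgM; [exact: cvg_id|exact: continuous_affine_sin].
pose S x := sin (t * x + th) * gaussk 1 x.
have Sd (x : R) : is_derive x 1 S (h x).
  have := is_derive_gaussk x => hg.
  rewrite /S; apply: is_derive_eq; rewrite /h /GRing.scale /=; ring.
pose I n := `[- (n.+1%:R : R), n.+1%:R]%classic.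
have In n : (\int[mu]_(x in I n) (h x)%:E = (S n.+1%:R - S (- n.+1%:R))%:E)%E.
  rewrite EFinB; apply: continuous_FTC2.
  - by rewrite -subr_gt0 opprK addr_gt0 // ltr0n.
  - by apply: continuous_subspaceT => x; exact: ch.
  - have cS : continuous S.
      by move=> x; apply: cvgM; [exact: continuous_affine_sin|exact: continuous_gaussk].
    split.
    + by move=> x _; have [] := Sd x.
    + by apply: cvg_at_right_filter; exact: cS.
    + by apply: cvg_at_left_filter; exact: cS.
  - by move=> x _; rewrite derive1E; have [_ ->] := Sd x.
have lim1 : (\int[mu]_x ((EFin \o h) \_ (I n)) x)%E @[n --> \oo] --> (\int[mu]_x (h x)%:E)%E.
  have [|||||_ _] := @dominated_convergence _ _ _ mu setT measurableT
     (fun n => (EFin \o h) \_ (I n)) (EFin \o h) (fun x => `|(h x)%:E|%E); last by [].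
  - move=> n; apply/(measurable_restrictT _ _).1 => //; first exact: measurable_itv.
    by apply: measurable_funTS; apply/measurable_EFinP; exact: measurable_continuous.
  - by apply/measurable_EFinP; exact: measurable_continuous.
  - apply: aeW => x _; apply: cvg_near_cst.
    exists (Num.truncn `|x|) => // n /= xn.
    have Ix : I n x.
      rewrite /I /= in_itv /= -ler_norml; apply: le_trans (ltW (truncnS_gt _)) _.
      by rewrite ler_nat ltnS.
    by rewrite patchE mem_set.
  - exact: integrable_abse.
  - apply: aeW => x n _; rewrite patchE; case: ifP => //= _; by rewrite normr0 lee_fin.
have lim2 : (\int[mu]_x ((EFin \o h) \_ (I n)) x)%E @[n --> \oo] --> 0%E.
  under eq_fun do rewrite -integral_mkcond In.
  apply: cvg_EFin; first exact: nearW.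
  rewrite (_ : fine \o _ = (fun n => S n.+1%:R - S (- n.+1%:R))) //.
  apply: norm_cvg0; apply: (@squeeze_cvgr _ _ _ _ (cst 0) (fun n => 4 * n.+1%:R^-1)); last 2 first.
  - exact: cvg_cst.
  - rewrite -(mulr0 4); apply: cvgM; [exact: cvg_cst|exact: cvg_harmonic].
  apply: nearW => n; rewrite /= normr_ge0 /=.
  have b (x : R) : `|x| = n.+1%:R -> `|S x| <= 2 * n.+1%:R^-1.
    move=> xn; rewrite /S normrM (ger0_norm (gaussk_ge0 _ _)) -gaussk_abs xn.
    apply: le_trans (ler_piMl (gaussk_ge0 _ _) (sin_max _)) _.
    apply: le_trans (gaussk_nat_le _) _.
    by rewrite ler_wpM2l // lef_pV2 ?posrE ?ltr0n // ler_nat.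
  apply: le_trans (ler_normB _ _) _.
  have := b n.+1%:R (ger0_norm (ler0n _ _)).
  have := b (- n.+1%:R); rewrite normrN => /(_ (ger0_norm (ler0n _ _))); move: (`|S _|) (`|S _|) (n.+1%:R^-1) => a b0 u; lra.
exact: (cvg_unique _ lim1 lim2).
Qed.

(** Differentiation under the integral, dominated by [gaussk (Num.sqrt 2)], followed by
    [gauss_stein]. *)
Lemma is_derive_gauss_charfun (t th : R) :
  is_derive t 1 (fun t => \int[mu]_x (cos (t * x + th) * gaussk 1 x))
    (- t * \int[mu]_x (cos (t * x + th) * gaussk 1 x)).
Proof.
pose f (t x : R) := cos (t * x + th) * gaussk 1 x.
have fd (u x : R) : is_derive u 1 (f ^~ x) (- (x * sin (u * x + th) * gaussk 1 x)).
  by rewrite /f; apply: is_derive_eq; rewrite /GRing.scale /=; ring.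
have d1 u x : partial1of2 f u x = - (x * sin (u * x + th) * gaussk 1 x).
  by rewrite partial1of2E; have [_ ->] := fd u x.
have tI : `]t - 1, t + 1[%classic t by rewrite /= in_itv /= ltrBlDr ltrDl ltr01.
have intf u : `]t - 1, t + 1[%classic u -> mu.-integrable setT (EFin \o f u).
  move=> _; apply: (@bounded_gaussk_integrable (fun x => cos (u * x + th)) 1).
    exact: continuous_affine_cos.
  by move=> x; exact: cos_max.
have derf u x : `]t - 1, t + 1[%classic u -> [set: R] x -> derivable (f ^~ x) u 1.
  by move=> _ _; have [] := fd u x.
have G0 x : 0 <= gaussk (Num.sqrt 2) x by exact: gaussk_ge0.
have iG : mu.-integrable setT (EFin \o gaussk (Num.sqrt 2)).
  by apply: integrable_gaussk; rewrite gt_eqF // sqrtr_gt0.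
have Gub u x : `]t - 1, t + 1[%classic u -> [set: R] x -> `|partial1of2 f u x| <= gaussk (Num.sqrt 2) x.
  move=> _ _; rewrite d1 normrN !normrM (ger0_norm (gaussk_ge0 _ _)).
  apply: le_trans (norm_mul_gaussk_le x); rewrite mulrAC; apply: ler_piMr; last exact: sin_max.
  by rewrite mulr_ge0 // gaussk_ge0.
apply: DeriveDef.
  exact: (derivable_under_integral measurableT tI intf derf G0 iG Gub).
rewrite -derive1E (differentiation_under_integral measurableT tI intf derf G0 iG Gub).
rewrite mulNr -gauss_stein -[RHS]mulN1r -RintegralZl //; last first.
  apply: (@xgaussk_integrable (fun x => sin (t * x + th))); first exact: continuous_affine_sin.
  by move=> x; exact: sin_max.
by apply: eq_Rintegral => x _; rewrite d1 mulN1r.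
Qed.

(** exp(u^2 / 2) times the transform has derivative 0, and the value at u = 0 is fixed by the total
    mass 1 of [normal_prob]. The same equation, with an error term, is solved in
    [cube_charfun_bound]. *)
Lemma normal_charfun (t th : R) : 0 <= t ->
  \int[normal_prob 0 1]_x cos (t * x + th) = expR (- (t ^+ 2 / 2)) * cos th.
Proof.
move=> t0.
have bc u : bmeas ((fun x => cos (u * x + th)) : measurableTypeR R -> R) by exact: bmeas_cos.
have E u : \int[normal_prob 0 1]_x cos (u * x + th) =
    normal_peak 1 * \int[mu]_x (cos (u * x + th) * gaussk 1 x).
  rewrite (integral_normal_prob (bc u)) -RintegralZl //; last first.
    apply: (@bounded_gaussk_integrable (fun x => cos (u * x + th)) 1); first exact: continuous_affine_cos.
    by move=> x; exact: cos_max.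
  by apply: eq_Rintegral => x _; rewrite normal_pdfE ?oner_neq0 // gaussk_normal_fun mulrCA.
pose phi u := \int[mu]_x (cos (u * x + th) * gaussk 1 x).
pose g u := expR (u ^+ 2 / 2) * phi u.
have gd (u : R) : is_derive u 1 g 0.
  have hphi : is_derive u 1 phi (- u * phi u) by exact: is_derive_gauss_charfun.
  by rewrite /g; apply: is_derive_eq; rewrite /GRing.scale /=; field.
have := @derive_bounded_le R g (fun=> 0) 0 t t0 gd.
rewrite mul0r normr0 => /(_ (fun u _ => lexx 0)).
rewrite normr_le0 subr_eq0 => /eqP gt.
have -> : cos th = normal_peak 1 * g 0.
  rewrite /g expr0n /= mul0r expR0 mul1r -E.
  rewrite -[LHS](@exp_cst R _ _ (normal_prob 0 1)).
  by apply: eq_Rintegral => x _; rewrite mul0r add0r.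
rewrite E -/(phi t) -gt (_ : phi t = expR (- (t ^+ 2 / 2)) * g t); first by rewrite mulrCA.
by rewrite /g mulrA -expRD addNr expR0 mul1r.
Qed.

End normal_charfun.

(** * Bernstein polynomials and trigonometric approximation *)

Section bernstein.
Context {R : realType}.
Implicit Types (u : R) (h : nat -> R).

(* Expectation of [h] under the binomial law of parameters n and u: a Bernstein polynomial, not
   rescaled to [0, 1]. *)
Fixpoint bern n h u : R :=
  if n is n'.+1 then u * bern n' (fun k => h k.+1) u + (1 - u) * bern n' h u else h 0%N.

Lemma bern_le n h g u : 0 <= u <= 1 -> (forall k, (k <= n)%N -> h k <= g k) -> bern n h u <= bern n g u.
Proof.
move=> /andP[u0 u1]; elim: n h g => [|n IH] h g hg /=; first exact: hg.
apply: lerD; apply: ler_wpM2l; rewrite ?subr_ge0 //; apply: IH => k kn; apply: hg => //.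
exact: leqW.
Qed.

Lemma bernD n h g u : bern n (fun k => h k + g k) u = bern n h u + bern n g u.
Proof. by elim: n h g => [|n IH] h g //=; rewrite !IH; ring. Qed.

Lemma bernZ n a h u : bern n (fun k => a * h k) u = a * bern n h u.
Proof. by elim: n h => [|n IH] h //=; rewrite !IH; ring. Qed.

Lemma bern_cst n a u : bern n (fun=> a) u = a.
Proof. by elim: n => [|n IH] //=; rewrite !IH; ring. Qed.

Lemma bern_ext n h g u : h =1 g -> bern n h u = bern n g u.
Proof.
elim: n h g => [|n IH] h g hg /=; first exact: hg.
by rewrite (IH h g) // (IH (fun k => h k.+1) (fun k => g k.+1)).
Qed.

(** The shift c makes the recursion close: conditioning on one trial changes the centre by u - 1 or
    by u. *)
Lemma bern_variance n c u :
  bern n (fun k => (k%:R - n%:R * u - c) ^+ 2) u = n%:R * (u * (1 - u)) + c ^+ 2.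
Proof.
elim: n c => [|n IH] c /=; first by ring.
rewrite (@bern_ext n _ (fun k => (k%:R - n%:R * u - (c + u - 1)) ^+ 2)); last first.
  by move=> k; rewrite -!natr1; ring.
rewrite (@bern_ext n (fun k => (k%:R - n.+1%:R * u - c) ^+ 2) (fun k => (k%:R - n%:R * u - (c + u)) ^+ 2)); last first.
  by move=> k; rewrite -!natr1; ring.
by rewrite !IH -natr1; ring.
Qed.

(** Bernstein's argument: the variance of k / n is u (1 - u) / n, at most 1 / n. *)
Lemma bern_approx n h u v e K : (0 < n)%N -> 0 <= u <= 1 -> 0 <= K ->
    (forall k, (k <= n)%N -> `|h k - v| <= e + K * (k%:R / n%:R - u) ^+ 2) ->
  `|bern n h u - v| <= e + K / n%:R.
Proof.
move=> n0 u01 K0 hb.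
have nn : n%:R != 0 :> R by rewrite pnatr_eq0 -lt0n.
have E : bern n (fun k => e + K * (k%:R / n%:R - u) ^+ 2) u <= e + K / n%:R.
  rewrite (@bern_ext n _ (fun k => e + K / n%:R ^+ 2 * (k%:R - n%:R * u - 0) ^+ 2)); last first.
    by move=> k; field.
  rewrite bernD bern_cst bernZ bern_variance lerD2l.
  have -> : K / n%:R ^+ 2 * (n%:R * (u * (1 - u)) + 0 ^+ 2) = K / n%:R * (u * (1 - u)) by field.
  apply: ler_piMr; first by rewrite divr_ge0 ?ler0n.
  by case/andP: u01 => u0 u1; nra.
have d (g : nat -> R) : (forall k, (k <= n)%N -> g k <= e + K * (k%:R / n%:R - u) ^+ 2) -> bern n g u <= e + K / n%:R.
  by move=> hg; apply: le_trans E; exact: bern_le.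
rewrite ler_norml lerNl; apply/andP; split.
  have -> : - (bern n h u - v) = bern n (fun k => v + -1 * h k) u by rewrite bernD bern_cst bernZ; ring.
  by apply: d => k kn; apply: le_trans (hb k kn); rewrite mulN1r distrC ler_norm.
have -> : bern n h u - v = bern n (fun k => h k + - v) u by rewrite bernD bern_cst.
by apply: d => k kn; apply: le_trans (hb k kn); rewrite ler_norm.
Qed.

End bernstein.

Section trigonometric_approximation.
Context {R : realType}.

(** Maps the window |x| <= (m + 1) pi / 2 bijectively onto [0, 1], so that polynomials on [0, 1]
    become trigonometric polynomials in x / (m + 1). *)
Definition trigu (m : nat) (x : R) : R := (1 + sin (x / m.+1%:R)) / 2.

Lemma trigu01 m x : 0 <= trigu m x <= 1.
Proof.
rewrite /trigu; have := sin_le1 (x / m.+1%:R); have := sin_geN1 (x / m.+1%:R).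
by move=> *; apply/andP; split; lra.
Qed.

(** The difference is 2 cos((x + y) / 2) sin((x - y) / 2), and both trigonometric factors are at
    least sin(delta / 2), since |x + y| / 2 <= pi / 2 - delta / 2. *)
Lemma sin_gap (x y delta : R) : - (pi / 2) <= y -> x <= pi / 2 -> 0 < delta -> delta <= x - y ->
  2 * sin (delta / 2) ^+ 2 <= sin x - sin y.
Proof.
move=> yl xr d0 dxy.
have p0 := @pi_gt0 R.
have -> : sin x - sin y = 2 * (cos ((x + y) / 2) * sin ((x - y) / 2)).
  have -> : sin x = sin ((x + y) / 2 + (x - y) / 2) by congr sin; field.
  have -> : sin y = sin ((x + y) / 2 - (x - y) / 2) by congr sin; field.
  by rewrite sinD sinB; ring.
have s0 : 0 <= sin (delta / 2) by apply: sin_ge0_pi; apply/andP; split; lra.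
have smono (a b : R) : - (pi / 2) <= a -> a <= b -> b <= pi / 2 -> sin a <= sin b.
  move=> ha ab hb; have [->//|anb] := eqVneq a b.
  apply/ltW; rewrite ltr_sin ?in_itv /=; first by rewrite lt_def eq_sym anb.
  - by apply/andP; split; lra.
  - by apply/andP; split; lra.
have h1 : sin (delta / 2) <= sin ((x - y) / 2) by apply: smono; lra.
have h2 : sin (delta / 2) <= cos ((x + y) / 2).
  have -> : cos ((x + y) / 2) = sin (pi / 2 - `|(x + y) / 2|).
    by rewrite [pi / 2 - _]addrC sinDpihalf cosN cos_norm.
  have hn : `|(x + y) / 2| <= pi / 2 - delta / 2 by rewrite ler_norml; apply/andP; split; lra.
  by have hn0 := normr_ge0 ((x + y) / 2); apply: smono; lra.
by rewrite ler_pM2l // expr2; apply: ler_pM.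
Qed.


Lemma trigu_preimage m v : 0 <= v <= 1 -> exists2 y, `|y / m.+1%:R| <= pi / 2 & trigu m y = v :> R.
Proof.
move=> /andP[v0 v1]; have hv : -1 <= 2 * v - 1 <= 1 by apply/andP; split; lra.
have m0 : m.+1%:R != 0 :> R by rewrite pnatr_eq0.
exists (m.+1%:R * asin (2 * v - 1)).
  rewrite mulrAC mulfV // mul1r ler_norml; apply/andP; split.
    exact: asin_geNpi2.
  exact: asin_lepi2.
by rewrite /trigu mulrAC mulfV // mul1r asinK ?in_itv //=; field.
Qed.

Lemma uniform_modulus (phi : R -> R) (L e : R) : continuous phi -> 0 < e ->
  exists2 delta, 0 < delta & forall x y, `|x| <= L -> `|y| <= L -> `|x - y| < delta ->
    `|phi x - phi y| <= e.
Proof.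
move=> cphi e0.
have /compact_near_coveringP cov := @segment_compact R (- L) L.
(* Compactness in its covering form: an estimate near each point for small delta becomes one delta
   for the whole segment. *)
have := cov R (0^'+) (fun delta x => forall y, `|x - y| < delta -> `|phi x - phi y| <= e) _.
case=> [x _|delta0 /= d0 h].
  have /cvgrPdist_lt/(_ (e / 2)) := cphi x; rewrite divr_gt0 // => /(_ isT) [eta /= eta0 heta].
  exists (ball x (eta / 2), [set delta | delta < eta / 2]) => /=.
    split; first by apply: nbhsx_ballx; rewrite divr_gt0.
    by apply: nbhs_right_lt; rewrite divr_gt0.
  move=> [x' delta] /= [bx hd] y xy.
  have h1 : `|phi x - phi x'| < e / 2.
    apply: heta => /=; apply: lt_trans bx _; lra.
  have h2 : `|phi x - phi y| < e / 2.
    apply: heta => /=; rewrite (_ : x - y = (x - x') + (x' - y)); last by ring.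
    apply: le_lt_trans (ler_normD _ _) _; move: bx xy hd; rewrite /ball /=; lra.
  rewrite (_ : phi x' - phi y = - (phi x - phi x') + (phi x - phi y)); last by ring.
  apply: le_trans (ler_normD _ _) _; rewrite normrN; lra.
have [delta [delta0' hdelta]] : exists delta, 0 < delta /\ delta < delta0.
  by exists (delta0 / 2); split; lra.
exists delta => // x y xL yL xy; apply: (h delta) => //=.
  by rewrite sub0r normrN gtr0_norm.
by rewrite in_itv /= -ler_norml.
Qed.

(** This is the input of [bern_approx]. Close points use uniform continuity; at distant points the
    values of [trigu] differ by at least [gap], and K is chosen so that K gap^2 is at least the
    oscillation of phi. *)
Lemma trigu_modulus (phi : R -> R) m (e : R) : continuous phi -> bounded_fun phi -> 0 < e ->
  exists2 K, 0 <= K & forall x y, `|x / m.+1%:R| <= pi / 2 -> `|y / m.+1%:R| <= pi / 2 ->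
    `|phi x - phi y| <= e + K * (trigu m x - trigu m y) ^+ 2.
Proof.
move=> cphi [B [_ hB]] e0.
pose B1 : R := `|B| + 1.
have B0 : 0 <= B1 by rewrite addr_ge0.
have phiB x : `|phi x| <= B1 by apply: hB => //; apply: le_lt_trans (ler_norm _) _; rewrite ltrDl.
have m0 : 0 < m.+1%:R :> R by rewrite ltr0n.
have [delta d0 hd] := uniform_modulus (m.+1%:R * (pi / 2)) cphi e0.
(* Capped by 1 so that dm / 2 lies in (0, pi), where the sine is positive. *)
pose dm : R := Num.min (delta / m.+1%:R) 1.
have dm0 : 0 < dm by rewrite lt_min divr_gt0 //=.
pose gap : R := sin (dm / 2) ^+ 2.
have gap0 : 0 < gap.
  rewrite exprn_gt0 // sin_gt0_pi //.
  have : dm <= 1 by rewrite ge_min lexx orbT.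
  by have := @pi_ge2 R => *; apply/andP; split; lra.
exists (2 * B1 / gap ^+ 2); first by rewrite divr_ge0 ?sqr_ge0 // mulr_ge0.
move=> x y.
wlog yx : x y / y <= x.
  move=> W hx hy; have [yx|/ltW xy] := leP y x; first exact: W.
  by rewrite distrC -[(trigu m x - _) ^+ 2]sqrrN opprB; exact: (W y x xy hy hx).
move=> hx hy.
have bnd (z : R) : `|z / m.+1%:R| <= pi / 2 -> `|z| <= m.+1%:R * (pi / 2).
  by rewrite normrM normfV normr_nat ler_pdivrMr // mulrC.
have [close|far] := ltP `|x - y| delta.
  apply: le_trans (hd _ _ (bnd _ hx) (bnd _ hy) close) _.
  by rewrite lerDl mulr_ge0 ?sqr_ge0 // divr_ge0 ?sqr_ge0 // mulr_ge0.
have hgap : gap <= trigu m x - trigu m y.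
  move: hx hy; rewrite !ler_norml => /andP[hx1 hx2] /andP[hy1 hy2].
  have := @sin_gap (x / m.+1%:R) (y / m.+1%:R) dm hy1 hx2 dm0.
  have -> : dm <= x / m.+1%:R - y / m.+1%:R.
    rewrite ge_min -mulrBl ler_pM2r ?invr_gt0 //.
    by move: far; rewrite ger0_norm ?subr_ge0 // => ->.
  by move=> /(_ isT); rewrite /trigu /gap; lra.
apply: (@le_trans _ _ (2 * B1)).
  apply: le_trans (ler_normB _ _) _; have := phiB x; have := phiB y; lra.
apply: (@le_trans _ _ (2 * B1 / gap ^+ 2 * gap ^+ 2)).
  by rewrite divfK // expf_neq0 // gt_eqF.
rewrite -[leLHS]add0r; apply: lerD; first exact: ltW.
apply: ler_wpM2l; first by rewrite divr_ge0 ?sqr_ge0 // mulr_ge0.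
by rewrite ler_sqr ?nnegrE ?(ltW gap0) // (le_trans (ltW gap0)).
Qed.

(* A trigonometric polynomial of period 2 pi (m + 1), bounded like [phi] on the whole line. *)
Lemma trig_approx (phi : R -> R) B m (e : R) : continuous phi -> (forall x, `|phi x| <= B) -> 0 < e ->
  exists n (h : nat -> R), (forall x, `|bern n h (trigu m x)| <= B) /\
    (forall x, `|x / m.+1%:R| <= pi / 2 -> `|phi x - bern n h (trigu m x)| <= e).
Proof.
move=> cphi phiB e0.
have B0 : 0 <= B by apply: le_trans (phiB 0).
have e20 : 0 < e / 2 by rewrite divr_gt0.
have bphi : bounded_fun phi.
  exists B; split; first exact: num_real.
  by move=> M BM x _; apply: le_trans (phiB x) (ltW BM).
have [K K0 hK] := trigu_modulus m cphi bphi e20.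
pose n := (Num.truncn (K / (e / 2))).+1.
have n0 : 0 < n%:R :> R by rewrite ltr0n.
have Kn : K / n%:R <= e / 2.
  rewrite ler_pdivrMr // mulrC -ler_pdivrMr //.
  exact/ltW/truncnS_gt.
(* The nodes k / n are pulled back to the window; for k > n the point 0 is a default, never reached
   by [bern n]. *)
have pre k : exists y : R, (k <= n)%N -> `|y / m.+1%:R| <= pi / 2 /\ trigu m y = k%:R / n%:R.
  have [kn|nk] := leqP k n; last by exists 0.
  have [|y y1 y2] := @trigu_preimage m (k%:R / n%:R).
    by rewrite divr_ge0 ?ler0n // ler_pdivrMr // mul1r ler_nat kn.
  by exists y.
have [y hy] := choice pre.
exists n, (fun k => phi (y k)); split.
  move=> x; rewrite ler_norml; apply/andP; split.
    rewrite -(bern_cst n (- B) (trigu m x)); apply: bern_le; first exact: trigu01.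
    by move=> k _; have := phiB (y k); rewrite ler_norml => /andP[].
  rewrite -[leRHS](bern_cst n B (trigu m x)); apply: bern_le; first exact: trigu01.
  by move=> k _; have := phiB (y k); rewrite ler_norml => /andP[].
move=> x hx; rewrite distrC.
apply: (@le_trans _ _ (e / 2 + K / n%:R)); last by lra.
apply: bern_approx => //; first exact: trigu01.
move=> k /hy[y1 y2]; rewrite -y2; exact: hK.
Qed.

End trigonometric_approximation.

(** * Weak convergence of positive functionals *)

Section weak_convergence.
Context {R : realType}.
Local Notation bm h := (bmeas (h : measurableTypeR R -> R)).

(** One notion for three functionals: the expectation under the law of F_n, the logarithmic average
    along a fixed path, and the Gaussian integral. The total mass is left free, as the logarithmic
    average at n = 0 is 0. *)
Definition posfun (Lam : (R -> R) -> R) : Prop :=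
  [/\ forall f g, bm f -> bm g -> Lam (fun x => f x + g x) = Lam f + Lam g,
      forall a f, bm f -> Lam (fun x => a * f x) = a * Lam f
    & forall f g, bm f -> bm g -> (forall x, f x <= g x) -> Lam f <= Lam g].

Lemma bm_cos (t th : R) : bm (fun x : R => cos (t * x + th)).
Proof. exact: bmeas_cos. Qed.

Lemma bm_continuous (f : R -> R) : bounded_continuous f -> bm f.
Proof.
move=> [cf [B [_ hB]]]; split; first exact: measurable_continuous.
by exists (`|B| + 1) => x; apply: hB => //; apply: le_lt_trans (ler_norm _) _; rewrite ltrDl.
Qed.

Variables (Lam : nat -> (R -> R) -> R) (L : (R -> R) -> R).
Hypotheses (hLam : forall n, posfun (Lam n)) (hL : posfun L).

Definition cvgf (f : R -> R) := Lam n f @[n --> \oo] --> L f.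

Lemma cvgfD f g : bm f -> bm g -> cvgf f -> cvgf g -> cvgf (fun x => f x + g x).
Proof.
move=> bf bg cf cg; rewrite /cvgf; have [-> // _ _] := hL.
under eq_fun => n do (have [-> // _ _] := hLam n).
exact: cvgD.
Qed.

Lemma cvgfZ a f : bm f -> cvgf f -> cvgf (fun x => a * f x).
Proof.
move=> bf cf; rewrite /cvgf; have [_ -> // _] := hL.
under eq_fun => n do (have [_ -> // _] := hLam n).
by apply: cvgM => //; exact: cvg_cst.
Qed.

Hypothesis trig_cvg : forall m k : nat,
  cvgf (fun x => cos (k%:R / m.+1%:R * x)) /\ cvgf (fun x => sin (k%:R / m.+1%:R * x)).

(** Requiring convergence after multiplication by every cosine of frequency k / (m + 1) makes the
    class stable under multiplication by sin(x / (m + 1)), hence under the recursion of [bern]. *)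
Definition trigclass (m : nat) (f : R -> R) :=
  bm f /\ forall (k : nat) th, cvgf (fun x => f x * cos (k%:R / m.+1%:R * x + th)).

Lemma trig_cvg_shift m (k : nat) th : cvgf (fun x => cos (k%:R / m.+1%:R * x + th)).
Proof.
have [c1 c2] := trig_cvg m k.
have b1 : bm (fun x : R => cos (k%:R / m.+1%:R * x)).
  by have := bm_cos (k%:R / m.+1%:R) 0; under eq_fun do rewrite addr0.
have b2 : bm (fun x : R => sin (k%:R / m.+1%:R * x)).
  by have := bm_cos (k%:R / m.+1%:R) (- (pi / 2)); under eq_fun do rewrite cosBpihalf.
rewrite (_ : (fun x => _) = (fun x => cos th * cos (k%:R / m.+1%:R * x) + - sin th * sin (k%:R / m.+1%:R * x))).
  by apply: cvgfD; try exact: bmeasZ; exact: cvgfZ.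
by apply/funext => x; rewrite cosD; ring.
Qed.

Lemma trigclassD m f g : trigclass m f -> trigclass m g -> trigclass m (fun x => f x + g x).
Proof.
move=> [bf cf] [bg cg]; split; first exact: bmeasD.
move=> k th; under eq_fun do rewrite mulrDl.
by apply: cvgfD => //; apply: bmeasM => //; exact: bm_cos.
Qed.

Lemma trigclassZ m a f : trigclass m f -> trigclass m (fun x => a * f x).
Proof.
move=> [bf cf]; split; first exact: bmeasZ.
move=> k th; under eq_fun do rewrite -mulrA.
by apply: cvgfZ => //; apply: bmeasM => //; exact: bm_cos.
Qed.

Lemma trigclass_cst m a : trigclass m (fun=> a).
Proof.
split; first exact: bmeas_cst.
move=> k th; apply: cvgfZ; first exact: bm_cos.
exact: trig_cvg_shift.
Qed.

Lemma trigclass_sin m f : trigclass m f -> trigclass m (fun x => sin (x / m.+1%:R) * f x).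
Proof.
move=> [bf cf].
have bs : bm (fun x : R => sin (x / m.+1%:R)).
  have := bm_cos (m.+1%:R^-1) (- (pi / 2)); under eq_fun do rewrite cosBpihalf.
  by under eq_fun do rewrite mulrC.
split; first exact: bmeasM.
have bfc k th : bm (fun x : R => f x * cos (k%:R / m.+1%:R * x + th)).
  by apply: bmeasM => //; exact: bm_cos.
(* Frequency 0 is apart: the product formula would lead to the frequency -1 / (m + 1), while [k] is
   a natural number. *)
move=> [|k] th.
  rewrite (_ : (fun x => _) = (fun x => cos th * (f x * cos (1%:R / m.+1%:R * x + - (pi / 2))))).
    exact: cvgfZ.
  by apply/funext => x; rewrite cosBpihalf !mul0r add0r mul1r [_^-1 * x]mulrC; ring.
rewrite (_ : (fun x => _) = (fun x => 2^-1 * (f x * cos (k.+2%:R / m.+1%:R * x + (th - pi / 2))) +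
    (- 2^-1) * (f x * cos (k%:R / m.+1%:R * x + (th - pi / 2))))).
  by apply: cvgfD; try exact: bmeasZ; exact: cvgfZ.
apply/funext => x; rewrite !addrA !cosBpihalf.
set a := x / m.+1%:R; set b := k.+1%:R / m.+1%:R * x + th.
have -> : k.+2%:R / m.+1%:R * x + th = b + a.
  by rewrite /a /b -[k.+2%:R]natr1; ring.
have -> : k%:R / m.+1%:R * x + th = b - a.
  by rewrite /a /b -[k.+1%:R]natr1; ring.
by rewrite sinD sinB; field.
Qed.

Lemma trigclass_bern m n h : trigclass m (fun x => bern n h (trigu m x)).
Proof.
elim: n h => [|n IH] h /=; first exact: trigclass_cst.
pose u g := fun x => 2^-1 * (g x : R) + 2^-1 * (sin (x / m.+1%:R) * g x).
pose v g := fun x => 2^-1 * (g x : R) + (- 2^-1) * (sin (x / m.+1%:R) * g x).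
have -> : (fun x => trigu m x * bern n (fun k => h k.+1) (trigu m x) + (1 - trigu m x) * bern n h (trigu m x)) =
    (fun x => u (fun x => bern n (fun k => h k.+1) (trigu m x)) x + v (fun x => bern n h (trigu m x)) x).
  by apply/funext => x; rewrite /u /v {1 3}/trigu; field.
by apply: trigclassD; apply: trigclassD; apply: trigclassZ => //; exact: trigclass_sin.
Qed.

Lemma bern_cvgf m n h : bm (fun x => bern n h (trigu m x)) /\ cvgf (fun x => bern n h (trigu m x)).
Proof.
have [b c] := trigclass_bern m n h; split=> //.
have := c 0%N 0; rewrite (_ : (fun x => _ * cos _) = (fun x => bern n h (trigu m x))) //.
by apply/funext => x; rewrite !mul0r addr0 cos0 mulr1.
Qed.

Hypothesis L1 : L (fun=> 1) = 1.
(** [psi] dominates the indicator of |x| >= K and is itself a test for which convergence holds, so a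
    small [L psi] controls the tails of [Lam n] for all large n. *)
Hypothesis tight : forall e : R, 0 < e -> exists (psi : R -> R) (K : R),
  [/\ bm psi, forall x, 0 <= psi x, forall x, K <= `|x| -> 1 <= psi x,
      cvgf psi & L psi <= e].

(** The trigonometric polynomial [p] approximates phi on a window only, but it is bounded by B
    everywhere, so that outside the window the error is at most 2 B psi. Positivity of the
    functionals then integrates the pointwise bound [err]. *)
Theorem weak_cvg (phi : R -> R) : bounded_continuous phi -> cvgf phi.
Proof.
move=> bcphi; have bphi := bm_continuous bcphi; have [cphi _] := bcphi.
have [_ [B hB]] := bphi.
have B0 : 0 <= B by apply: le_trans (hB 0).
have c1 : cvgf (fun=> 1).
  have [+ _] := trig_cvg 0 0; rewrite (_ : (fun x => _) = fun=> 1) //.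
  by apply/funext => x; rewrite !mul0r cos0.
apply/cvgrPdist_le => e e0.
(* The three errors at the end add up to at most (4 + 6 B) eta. *)
pose eta := e / (6 + 8 * B).
have den : 0 < 6 + 8 * B by rewrite ltr_wpDr // mulr_ge0.
have eta0 : 0 < eta by rewrite divr_gt0.
have [psi [K [bpsi psi0 psi1 cpsi Lpsi]]] := tight eta0.
(* Since m + 1 > K and pi / 2 >= 1, every point outside the window of [trigu m] satisfies K <=
   |x|. *)
pose m := Num.truncn K.
have Km x : ~~ (`|x / m.+1%:R| <= pi / 2) -> K <= `|x|.
  rewrite -ltNge normrM normfV normr_nat ltr_pdivlMr ?ltr0n // => h.
  apply/ltW; apply: lt_trans h; apply: lt_le_trans (truncnS_gt K) _.
  by rewrite ler_peMl // pihalf_ge1.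
have [n0 [h [pB pe]]] := trig_approx m cphi hB eta0.
have [bp cp] := bern_cvgf m n0 h.
move: pB pe bp cp; set p := (fun x : R => bern n0 h (trigu m x)).
rewrite -/(p _) => pB pe bp cp.
have err x : `|phi x - p x| <= eta + 2 * B * psi x.
  have [/pe hx|/Km/psi1 hx] := boolP (`|x / m.+1%:R| <= pi / 2).
    by apply: le_trans hx _; rewrite lerDl !mulr_ge0.
  apply: le_trans (ler_normB _ _) _.
  have h1 : 2 * B <= 2 * B * psi x by rewrite ler_peMr // mulr_ge0.
  have h2 : 0 <= eta by exact: ltW.
  by move: (hB x) (pB x) => h3; rewrite -/(p x) => h4; lra.
have bq : bm (fun x => eta * 1 + 2 * B * psi x).
  by apply: bmeasD; [exact: bmeas_cst|exact: bmeasZ].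
have Lerr Lm : posfun Lm -> `|Lm phi - Lm p| <= eta * Lm (fun=> 1) + 2 * B * Lm psi.
  move=> [LD LZ Lle].
  have <- : Lm (fun x => eta * 1 + 2 * B * psi x) = eta * Lm (fun=> 1) + 2 * B * Lm psi.
    rewrite (LD (fun=> eta * 1) (fun x => 2 * B * psi x)); [|exact: bmeas_cst|exact: bmeasZ].
    by rewrite (LZ eta (fun=> 1)) ?LZ //; exact: bmeas_cst.
  have bpN : bm (fun x => -1 * p x) by exact: bmeasZ.
  have bphiN : bm (fun x => -1 * phi x) by exact: bmeasZ.
  rewrite ler_norml lerNl; apply/andP; split.
    have -> : - (Lm phi - Lm p) = Lm (fun x => -1 * phi x + p x) by rewrite LD // LZ //; ring.
    apply: Lle => //; first exact: bmeasD.
    by move=> x; apply: le_trans (ler_norm _) _; rewrite mulN1r addrC distrC mulr1.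
  have -> : Lm phi - Lm p = Lm (fun x => phi x + -1 * p x) by rewrite LD // LZ //; ring.
  apply: Lle => //; first exact: bmeasD.
  by move=> x; apply: le_trans (ler_norm _) _; rewrite mulN1r mulr1.
have lt1 : L psi < 2 * eta by lra.
have lt2 : L (fun=> 1) < 2 by rewrite L1; lra.
have [N1 _ hN1] : \forall n \near \oo, Lam n psi <= 2 * eta by have /cvgr_le := cpsi; exact.
have [N2 _ hN2] : \forall n \near \oo, Lam n (fun=> 1) <= 2 by have /cvgr_le := c1; exact.
have /cvgrPdist_le/(_ eta eta0) [N3 _ hN3] := cp.
exists (maxn N1 (maxn N2 N3)) => // n /=; rewrite !geq_max => /and3P[/hN1 h1 /hN2 h2 /hN3 h3].
have e_def : e = eta * (6 + 8 * B) by rewrite /eta divfK // gt_eqF.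
have E1 := Lerr _ hL; have E2 := Lerr _ (hLam n); rewrite L1 in E1.
have -> : L phi - Lam n phi = (L phi - L p) + (L p - Lam n p) - (Lam n phi - Lam n p) by ring.
apply: le_trans (ler_normB _ _) _; apply: le_trans (lerD (ler_normD _ _) (lexx _)) _.
have h1' : B * Lam n psi <= B * (2 * eta) by exact: ler_wpM2l.
have h2' : eta * Lam n (fun=> 1) <= eta * 2 by rewrite ler_wpM2l // ltW.
have h4' : B * L psi <= B * eta by exact: ler_wpM2l.
have : 0 <= B * eta by rewrite mulr_ge0 // ltW.
move: E1 E2 h1' h2' h3 h4'; rewrite e_def /=; lra.
Qed.

End weak_convergence.

Section bounded_convergence.
Context {R : realType} d (T : measurableType d) (P : probability T R).

Lemma bmeas_cvg (h_ : nat -> T -> R) (h : T -> R) (K : R) :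
    (forall n, measurable_fun [set: T] (h_ n)) -> (forall n w, `|h_ n w| <= K) ->
    (forall w, h_ n w @[n --> \oo] --> h w) ->
  bmeas h.
Proof.
move=> mh hK hh; split.
  by apply: (measurable_fun_cvg mh) => w _; exact: hh.
exists K => w; apply: (cvgr_to_le (cvg_norm (hh w))); exact: nearW.
Qed.

Lemma exp_bounded_cvg (h_ : nat -> T -> R) (h : T -> R) (K : R) :
    (forall n, measurable_fun [set: T] (h_ n)) -> (forall n w, `|h_ n w| <= K) ->
    (forall w, h_ n w @[n --> \oo] --> h w) ->
  \int[P]_w h_ n w @[n --> \oo] --> \int[P]_w h w.
Proof.
move=> mh hK hh; have [mh' _] := bmeas_cvg mh hK hh.
have bK : P.-integrable setT (EFin \o (fun=> K)) by exact/bmeas_integrable/bmeas_cst.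
have [|||||_ _ ih] := @dominated_convergence _ _ _ P setT measurableT
     (fun n => EFin \o h_ n) (EFin \o h) (EFin \o (fun=> K)).
- by move=> n; exact/measurable_EFinP.
- exact/measurable_EFinP.
- by apply: aeW => w _; apply: cvg_EFin; [exact: nearW|exact: hh].
- by [].
- by apply: aeW => w n _; rewrite lee_fin.
- have ifin := bmeas_integrable P (bmeas_cvg mh hK hh).
  have ihf : (\int[P]_w (h_ n w)%:E)%E @[n --> \oo] --> (\int[P]_w h w)%:E.
    rewrite /Rintegral fineK; [exact: ih|exact: (integrable_fin_num measurableT ifin)].
  exact: (fine_cvg ihf).
Qed.

End bounded_convergence.

(** * The cardinal sine as a limit of averages of cosines *)

Section sinc.
Context {R : realType}.

Definition sinc (x : R) : R := if x == 0 then 1 else sin x / x.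

(* Midpoint sums of [sinc x], the integral of [cos (s * x)] over s in [0, 1]: finite averages carry
   bounds on characteristic functions over to [sinc] without integrating in the parameter. *)
Definition cosavg (N : nat) (x : R) : R :=
  N.+1%:R^-1 * \sum_(j < N.+1) cos ((2 * j%:R + 1) / (2 * N.+1%:R) * x).

Lemma cosavg_le1 N x : `|cosavg N x| <= 1.
Proof.
rewrite normrM normfV normr_nat ler_pdivrMl ?ltr0n // mulr1.
apply: le_trans (ler_norm_sum _ _ _) _; apply: le_trans (ler_sum _ (fun i _ => cos_max _)) _.
by rewrite sumr_const card_ord.
Qed.

Lemma norm_sin_sub_le (y : R) : `|sin y - y| <= `|y| ^+ 3 + `|y| ^+ 2.
Proof.
have -> : sin y - y = (sin y - y * cos y) - y * (1 - cos y) by ring.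
apply: le_trans (ler_normB _ _) _; apply: lerD; first exact: sin_sub_mul_cos_le.
rewrite normrM expr2 ler_wpM2l //.
by have := cos_lipschitz 0 y; rewrite cos0 sub0r normrN.
Qed.

Lemma mul_sinc x : x * sinc x = sin x.
Proof.
rewrite /sinc; case: eqP => [->|/eqP x0]; first by rewrite mul0r sin0.
by rewrite mulrCA mulfV // mulr1.
Qed.

Lemma sinc_le x : 2 <= `|x| -> `|sinc x| <= 2^-1.
Proof.
move=> x2; have x0 : 0 < `|x| by apply: lt_le_trans x2.
rewrite /sinc -[x == 0]normr_eq0 gt_eqF // normrM normfV ler_pdivrMr //.
by apply: le_trans (sin_max _) _; lra.
Qed.

Lemma sinc_sub1_le x : `|sinc x - 1| <= `|x| ^+ 2 + `|x|.
Proof.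
have [->|x0] := eqVneq x 0.
  by rewrite /sinc eqxx subrr normr0 expr0n addr0.
rewrite -(@ler_pM2l _ `|x|) ?normr_gt0 // -normrM mulrBr mul_sinc mulr1.
by rewrite mulrDr -exprS -expr2; exact: norm_sin_sub_le.
Qed.

(** Telescoping: 2 sin th cos((2 j + 1) th) = sin((2 j + 2) th) - sin(2 j th). *)
Lemma cosavg_sin N x : cosavg N x * (2 * N.+1%:R * sin (x / (2 * N.+1%:R))) = sin x.
Proof.
have N0 : N.+1%:R != 0 :> R by rewrite pnatr_eq0.
set th := x / (2 * N.+1%:R).
have S n : (\sum_(j < n) cos ((2 * j%:R + 1) / (2 * N.+1%:R) * x)) * (2 * sin th) = sin (2 * n%:R * th).
  elim: n => [|n IH]; first by rewrite big_ord0 mul0r mulr0 mul0r sin0.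
  rewrite big_ord_recr /= mulrDl IH.
  have -> : (2 * n%:R + 1) / (2 * N.+1%:R) * x = (2 * n%:R * th) + th by rewrite /th; field.
  have -> : 2 * n.+1%:R * th = (2 * n%:R * th + th) + th by rewrite -natr1; ring.
  have -> : sin (2 * n%:R * th) = sin ((2 * n%:R * th + th) - th) by congr sin; ring.
  by rewrite [sin (_ + th + th)]sinD [sin (_ - th)]sinB; ring.
rewrite /cosavg (_ : _ * _ = (\sum_(j < N.+1) cos ((2 * j%:R + 1) / (2 * N.+1%:R) * x)) * (2 * sin th)); last first.
  by rewrite /th; field.
by rewrite S; congr sin; rewrite /th; field.
Qed.

(** By [cosavg_sin], x times the difference equals [cosavg N x] times x - 2 (N + 1) sin(x / (2 (N +
    1))), which is small because sin y - y is controlled by y^2 and |y|^3. *)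
Lemma cosavg_sinc_le N x : `|cosavg N x - sinc x| <= (`|x| ^+ 2 + `|x|) / N.+1%:R.
Proof.
have N0 : 0 < N.+1%:R :> R by rewrite ltr0n.
have [->|x0] := eqVneq x 0.
  rewrite /sinc eqxx /cosavg; under eq_bigr do rewrite mulr0 cos0.
  by rewrite sumr_const card_ord -mulr_natr mul1r mulVf ?gt_eqF // subrr normr0 expr0n addr0 mul0r.
rewrite -(@ler_pM2l _ `|x|) ?normr_gt0 // -normrM mulrBr mul_sinc.
have -> : x * cosavg N x - sin x = cosavg N x * (x - 2 * N.+1%:R * sin (x / (2 * N.+1%:R))).
  by rewrite -[sin x](cosavg_sin N); ring.
rewrite normrM; apply: le_trans (ler_piMl _ (cosavg_le1 _ _)) _ => //.
set y := x / (2 * N.+1%:R).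
have -> : x - 2 * N.+1%:R * sin y = - (2 * N.+1%:R) * (sin y - y).
  by rewrite /y; field; rewrite gt_eqF.
rewrite normrM normrN (ger0_norm (_ : 0 <= 2 * N.+1%:R)) ?mulr_ge0 ?ler0n //.
apply: le_trans (ler_wpM2l _ (norm_sin_sub_le _)) _; first by rewrite mulr_ge0 // ler0n.
have -> : `|y| = `|x| / (2 * N.+1%:R).
  by rewrite /y normrM normfV (ger0_norm (_ : 0 <= 2 * N.+1%:R)) // mulr_ge0 ?ler0n.
move: (`|x|) (normr_ge0 x) => a a0; set n := N.+1%:R in N0 *.
have n1 : 1 <= n by rewrite /n (ler_nat R 1).
have -> : 2 * n * ((a / (2 * n)) ^+ 3 + (a / (2 * n)) ^+ 2) = a * ((a ^+ 2 / (4 * n) + a / 2) / n).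
  by field; rewrite gt_eqF.
rewrite ler_wpM2l // ler_pM2r ?invr_gt0 //; apply: lerD; last by lra.
by rewrite ler_pdivrMr ?mulr_gt0 //; rewrite ler_peMr ?exprn_ge0 //; lra.
Qed.

Lemma cosavg_cvg x : cosavg N x @[N --> \oo] --> sinc x.
Proof.
apply/subr_cvg0; apply: norm_cvg0.
apply: (@squeeze_cvgr _ _ _ _ (cst 0) (fun N => (`|x| ^+ 2 + `|x|) * N.+1%:R^-1)).
- by apply: nearW => N; rewrite /= normr_ge0 cosavg_sinc_le.
- exact: cvg_cst.
- rewrite -(mulr0 (`|x| ^+ 2 + `|x|)); apply: cvgM; [exact: cvg_cst|exact: cvg_harmonic].
Qed.

End sinc.

(** * Logarithmic averages *)

Section harmonic_numbers.
Context {R : realType}.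
Local Notation gam := (@gamma R).

Lemma gammaS n : gam n.+1 = gam n + n.+1%:R^-1.
Proof. by rewrite /gamma big_nat_recr. Qed.

Lemma gamma_mono m n : (m <= n)%N -> gam m <= gam n.
Proof.
move=> /subnK <-; elim: (n - m)%N => [|k IH] //; rewrite addSn gammaS.
by apply: le_trans IH _; rewrite lerDl invr_ge0 ler0n.
Qed.

Lemma gamma1 : gam 1 = 1.
Proof. by rewrite /gamma big_nat1 invr1. Qed.

Lemma gamma_ge1 n : (1 <= n)%N -> 1 <= gam n.
Proof. by move=> n1; rewrite -gamma1; exact: gamma_mono. Qed.

Lemma gamma_ge0 n : 0 <= gam n.
Proof. by apply: sumr_ge0 => k _; rewrite invr_ge0 ler0n. Qed.

Lemma ln_le_gamma n : ln n.+1%:R <= gam n.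
Proof.
elim: n => [|n IH]; first by rewrite ln1 gamma_ge0.
rewrite gammaS; have -> : n.+2%:R = n.+1%:R * (1 + n.+1%:R^-1) :> R.
  by rewrite mulrDr mulfV ?pnatr_eq0 // mulr1 -[n.+2%:R]natr1.
have h : 0 < 1 + n.+1%:R^-1 :> R by rewrite addr_gt0 ?invr_gt0 ?ltr0n.
rewrite lnM ?posrE ?ltr0n //; apply: lerD => //; apply: le_ln1Dx.
by apply: lt_trans (_ : 0 < _); rewrite ?invr_gt0 ?ltr0n ?oppr_lt0.
Qed.

Lemma gamma_le_ln n : gam n.+1 <= 1 + ln n.+1%:R.
Proof.
elim: n => [|n IH]; first by rewrite ln1 addr0 gamma1.
rewrite gammaS.
have : ln n.+1%:R <= ln n.+2%:R - n.+2%:R^-1 :> R.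
  have -> : n.+1%:R = n.+2%:R * (1 + - n.+2%:R^-1) :> R.
    by rewrite mulrDr mulrN mulfV ?pnatr_eq0 // mulr1 -[n.+2%:R]natr1 addrK.
  have lt1 : - 1 < - n.+2%:R^-1 :> R.
    by rewrite ltrN2 invf_lt1 ?ltr0n // (ltr_nat R 1).
  have h : 0 < 1 + - n.+2%:R^-1 :> R by rewrite -ltrBlDl sub0r.
  rewrite lnM ?posrE ?ltr0n //.
  by rewrite lerD2l; exact: le_ln1Dx.
move=> h; apply: le_trans (lerD (le_trans IH (lerD (lexx 1) h)) (lexx _)) _.
by rewrite addrA subrK.
Qed.

Lemma gamma_unbounded (A : R) : exists n, A < gam n.
Proof.
exists (Num.truncn (expR A)).
apply: lt_le_trans (ln_le_gamma _).
by rewrite -{1}(expRK A) ltr_ln ?posrE ?expR_gt0 ?ltr0n // truncnS_gt.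
Qed.

Definition logsum (x : nat -> R) n := \sum_(1 <= k < n.+1) k%:R^-1 * x k.

Lemma logsumS x n : logsum x n.+1 = logsum x n + n.+1%:R^-1 * x n.+1.
Proof. by rewrite /logsum big_nat_recr. Qed.

Lemma logsum_dist x M p n : (forall k, `|x k| <= M) -> (p <= n)%N ->
  `|logsum x n - logsum x p| <= M * (gam n - gam p).
Proof.
move=> xM /subnK <-; elim: (n - p)%N => [|k IH]; first by rewrite !subrr normr0 mulr0.
rewrite addSn logsumS gammaS.
have -> : logsum x (k + p) + (k + p).+1%:R^-1 * x (k + p).+1 - logsum x p =
  (logsum x (k + p) - logsum x p) + (k + p).+1%:R^-1 * x (k + p).+1 by ring.
apply: le_trans (ler_normD _ _) _.
have -> : M * (gam (k + p) + (k + p).+1%:R^-1 - gam p) =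
  M * (gam (k + p) - gam p) + (k + p).+1%:R^-1 * M by ring.
apply: lerD => //; rewrite normrM ger0_norm ?invr_ge0 ?ler0n //.
by rewrite ler_wpM2l ?invr_ge0 ?ler0n.
Qed.

Lemma gamma_sub_le p q : (1 <= p)%N -> (p <= q)%N ->
  gam q - gam p <= \sum_(p <= n < q) n%:R^-1.
Proof.
move=> p1 /subnK <-; elim: (q - p)%N => [|k IH]; first by rewrite subrr big_geq.
rewrite addSn gammaS big_nat_recr ?leq_addl //= addrAC; apply: lerD => //.
have kp : (0 < k + p)%N by rewrite addn_gt0 p1 orbT.
by rewrite lef_pV2 ?posrE ?ltr0n // ler_nat.
Qed.

Lemma bounded_sum_tail (a : nat -> R) K (eta : R) : (forall n, 0 <= a n) ->
    (forall q, \sum_(2 <= n < q) a n <= K) -> 0 < eta ->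
  exists N0, forall p q, (N0 <= p)%N -> (p <= q)%N -> \sum_(p <= n < q) a n <= eta.
Proof.
move=> a0 aK eta0; pose s q := \sum_(2 <= n < q.+2) a n.
have snd : nondecreasing_seq s.
  apply/nondecreasing_seqP => n; rewrite /s [leRHS]big_nat_recr //=.
  by rewrite lerDl.
have cs : cvgn s.
  apply: nondecreasing_is_cvgn => //.
  by exists K => _ [n _ <-]; exact: aK.
have /cvgrPdist_le/(_ (eta / 2)) := cs.
rewrite divr_gt0 // => /(_ isT) [N0 _ hN0].
exists N0.+2 => -[|[|p]] // -[|[|q]] // pN pq.
have h1 := hN0 p pN; have h2 := hN0 q (leq_trans pN pq).
have -> : \sum_(p.+2 <= n < q.+2) a n = s q - s p.
  rewrite /s [X in X - _](@big_cat_nat _ _ _ p.+2) //=.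
  by rewrite addrAC subrr add0r.
move: h1 h2; rewrite /= !ler_norml => /andP[h1 h2] /andP[h3 h4]; lra.
Qed.

(* If the ratio logsum/gamma is at least eps at p, it stays above eps/4 as long as gamma_n does
   not exceed (1 + kappa) gamma_p, and such a stretch carries a fixed mass of the series. *)
Lemma log_average_cvg0 (x : nat -> R) (M K : R) : (forall k, `|x k| <= M) ->
    (forall q, \sum_(2 <= n < q) (n%:R * gam n ^+ 3)^-1 * logsum x n ^+ 2 <= K) ->
  logsum x n / gam n @[n --> \oo] --> (0 : R).
Proof.
move=> xM aK; apply/cvgr0Pnorm_le => e e0.
pose M1 := Num.max M 1; pose eps := Num.min e 1.
have M11 : 1 <= M1 by rewrite le_max lexx orbT.
have eps0 : 0 < eps by rewrite lt_min e0 ltr01.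
have eps1 : eps <= 1 by rewrite ge_min lexx orbT.
have epse : eps <= e by rewrite ge_min lexx.
have xM1 k : `|x k| <= M1 by rewrite le_max xM.
(* While gamma grows by a factor at most 1 + kap, [logsum] moves by at most M1 kap gamma_p = eps
   gamma_p / 2. The cutoffs by 1 ensure kap <= 1/2, hence gamma_n^3 <= (3/2)^3 gamma_p^3 <= 4
   gamma_p^3. *)
pose kap := eps / (2 * M1).
have kap0 : 0 < kap by rewrite divr_gt0 // mulr_gt0 //; lra.
have kap1 : kap <= 2^-1.
  by rewrite ler_pdivrMr ?mulr_gt0 //; lra.
have kapM : M1 * kap = eps / 2 by rewrite /kap; field; lra.
pose a n := (n%:R * gam n ^+ 3)^-1 * logsum x n ^+ 2.
have a0 n : 0 <= a n.
  by rewrite mulr_ge0 ?sqr_ge0 // invr_ge0 mulr_ge0 ?ler0n // exprn_ge0 // gamma_ge0.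
(* Half of the mass of a stretch: each term there is at least eps^2 / (16 gamma_p n), and the sum of
   1 / n over the stretch is at least kap gamma_p. *)
pose eta := eps ^+ 2 * kap / 32.
have eta0 : 0 < eta by rewrite divr_gt0 // mulr_gt0 // exprn_gt0.
have [N0 hN0] := bounded_sum_tail a0 aK eta0.
exists (maxn N0 2) => // p /=; rewrite geq_max => /andP[pN p2].
have gp1 : 1 <= gam p by apply: gamma_ge1; exact: leq_trans p2.
have gp0 : 0 < gam p by lra.
apply: le_trans _ epse; rewrite leNgt; apply/negP.
rewrite normrM normfV (gtr0_norm gp0) ltr_pdivlMr // => big.
have ex : exists q, (1 + kap) * gam p < gam q by exact: gamma_unbounded.
(* First index beyond the stretch. *)
pose q := ex_minn ex.
have [hq qmin] : (1 + kap) * gam p < gam q /\ forall n, (n < q)%N -> gam n <= (1 + kap) * gam p.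
  rewrite /q; case: ex_minnP => q' h1 h2; split=> // n nq; rewrite leNgt; apply/negP => /h2.
  by rewrite leqNgt nq.
have pq : (p <= q)%N.
  rewrite leqNgt; apply/negP => /ltnW /gamma_mono h.
  have : kap * gam p > 0 by rewrite mulr_gt0.
  by move: hq h; rewrite mulrDl mul1r; lra.
have := hN0 p q pN pq; apply/negP; rewrite -ltNge.
have low n : (p <= n < q)%N -> eps ^+ 2 / (16 * gam p) * n%:R^-1 <= a n.
  move=> /andP[pn nq].
  have n0 : 0 < n%:R :> R by rewrite ltr0n (leq_trans _ pn) // (leq_trans _ p2).
  have gpn := gamma_mono pn; have gn0 : 0 < gam n by lra.
  have gnq := qmin n nq.
  have d := logsum_dist xM1 pn.
  have dM : M1 * (gam n - gam p) <= eps / 2 * gam p.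
    rewrite -kapM -mulrA ler_wpM2l //; last by lra.
    by move: gnq; rewrite mulrDl mul1r; lra.
  have S1 : eps / 2 * gam p <= `|logsum x n|.
    have : `|logsum x p| <= `|logsum x n| + `|logsum x n - logsum x p|.
      by rewrite -[X in `|X| <= _](subKr (logsum x n)) (le_trans (ler_normB _ _)).
    lra.
  have S2 : (eps / 2 * gam p) ^+ 2 <= logsum x n ^+ 2.
    rewrite -[logsum x n ^+ 2]real_normK ?num_real // ler_sqr ?nnegrE //.
    by rewrite mulr_ge0 // ?divr_ge0 // ltW.
  have g3 : gam n ^+ 3 <= 4 * gam p ^+ 3.
    have le32 : gam n <= 3 / 2 * gam p.
      by apply: le_trans gnq _; rewrite ler_pM2r //; lra.
    apply: (@le_trans _ _ ((3 / 2 * gam p) ^+ 3)).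
      by apply: lerXn2r => //; rewrite nnegrE; lra.
    rewrite exprMn ler_wpM2r ?exprn_ge0 ?ltW //.
    by rewrite !exprS expr0; lra.
  apply: (@le_trans _ _ (n%:R^-1 * (4 * gam p ^+ 3)^-1 * (eps / 2 * gam p) ^+ 2)).
    rewrite le_eqVlt; apply/orP; left; apply/eqP; field.
    by rewrite !gt_eqF.
  have -> : a n = n%:R^-1 * (gam n ^+ 3)^-1 * logsum x n ^+ 2 by rewrite /a invfM.
  apply: ler_pM => //.
  - by rewrite ltW // mulr_gt0 // invr_gt0 // mulr_gt0 // exprn_gt0.
  - exact: sqr_ge0.
  by rewrite ler_wpM2l ?invr_ge0 ?ler0n // lef_pV2 ?posrE ?mulr_gt0 ?exprn_gt0.
apply: (@lt_le_trans _ _ (\sum_(p <= n < q) eps ^+ 2 / (16 * gam p) * n%:R^-1)); last first.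
  by rewrite big_nat [leRHS]big_nat; apply: ler_sum => n; exact: low.
rewrite -mulr_sumr.
have sum_ge : kap * gam p <= \sum_(p <= n < q) n%:R^-1.
  apply: le_trans (gamma_sub_le (leq_trans _ p2) pq) => //.
  by move: hq; rewrite mulrDl mul1r; lra.
apply: lt_le_trans (ler_wpM2l _ sum_ge); last first.
  by rewrite divr_ge0 ?sqr_ge0 // mulr_ge0 // ltW.
have -> : eps ^+ 2 / (16 * gam p) * (kap * gam p) = eps ^+ 2 * kap / 16.
  by field; rewrite gt_eqF.
have : 0 < eps ^+ 2 * kap by rewrite mulr_gt0 ?exprn_gt0.
by rewrite /eta; lra.
Qed.

End harmonic_numbers.

(** * Almost sure convergence from second moments *)

Section almost_sure.
Context {R : realType} d (T : measurableType d) (P : probability T R).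
Local Notation gam := (@gamma R).

(** The series of nonnegative terms has finite expectation by monotone convergence; hence it is
    almost surely finite and then bounds its partial sums. *)
Lemma ae_bounded_sums (D : nat -> T -> R) (c : nat -> R) K :
    (forall n, bmeas (D n)) -> (forall n, 0 <= c n) ->
    (forall q, \sum_(2 <= n < q) c n * \int[P]_w (D n w ^+ 2) <= K) ->
  {ae P, forall w, exists Kw, forall q, \sum_(2 <= n < q) c n * D n w ^+ 2 <= Kw}.
Proof.
move=> bD c0 hK.
have bD2 n : bmeas (fun w => D n w ^+ 2) by exact: (bmeasM (bD n) (bD n)).
(* The indices are shifted by 2 to make the series start at 0. *)
pose u n w := (c n.+2 * D n.+2 w ^+ 2)%:E.
have u0 n w : (0 <= u n w)%E by rewrite lee_fin mulr_ge0 ?sqr_ge0.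
have mu n : measurable_fun setT (u n).
  by apply/measurable_EFinP; have [] := bmeasZ (c n.+2) (bD2 n.+2).
pose f w := (\sum_(n <oo) u n w)%E.
have f0 w : (0 <= f w)%E by apply: nneseries_ge0 => n _ _; exact: u0.
have mf : measurable_fun setT f.
  by apply: ge0_emeasurable_sum => //.
have intu n : (\int[P]_w u n w = (c n.+2 * \int[P]_w (D n.+2 w ^+ 2))%:E)%E.
  rewrite -expZ // /Rintegral fineK //; apply: (integrable_fin_num measurableT).
  exact: bmeas_integrable (bmeasZ _ (bD2 _)).
have fint : P.-integrable setT f.
  apply/integrableP; split=> //.
  under eq_integral do rewrite gee0_abs //.
  rewrite integral_nneseries //.
  apply: (@le_lt_trans _ _ K%:E); last exact: ltry.
  apply: lime_le; first by apply: is_cvg_nneseries => n _ _; exact: integral_ge0.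
  apply: nearW => q; under eq_bigr do rewrite intu.
  rewrite sumEFin lee_fin; apply: le_trans (hK q.+2).
  by rewrite -{2}[2%N]add0n big_addn subn2 /=; under [leRHS]eq_bigr do rewrite addn2.
have := integrable_ae measurableT fint; apply: filterS => w /(_ I) fw.
exists (fine (f w)) => q.
have [q2|q2] := leqP q 2; first by rewrite big_geq // fine_ge0.
rewrite -lee_fin fineK // -sumEFin.
have := @nneseries_lim_ge R (fun n => u n w) xpredT 0 (q - 2) (fun n _ _ => u0 n w).
apply: le_trans; rewrite -{1}[2%N]add0n big_addn.
by under eq_bigr do rewrite addn2.
Qed.

(* The passage from second moments to almost sure convergence of logarithmic averages
   (Ibragimov-Lifshits). *)
Lemma ae_log_average (x : nat -> T -> R) (M K : R) : (forall k, bmeas (x k)) -> (forall k w, `|x k w| <= M) ->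
    (forall q, \sum_(2 <= n < q) (n%:R * gam n ^+ 3)^-1 *
       \int[P]_w (logsum (fun k => x k w) n ^+ 2) <= K) ->
  {ae P, forall w, logsum (fun k => x k w) n / gam n @[n --> \oo] --> (0 : R)}.
Proof.
move=> bx xM hK.
have bD n : bmeas (fun w => logsum (fun k => x k w) n).
  by apply: bmeas_sum => k; exact: bmeasZ.
have c0 n : 0 <= (n%:R * gam n ^+ 3)^-1.
  by rewrite invr_ge0 mulr_ge0 ?ler0n // exprn_ge0 // gamma_ge0.
apply: filterS (ae_bounded_sums bD c0 hK) => w [Kw hw].
exact: (log_average_cvg0 (fun k => xM k w) hw).
Qed.

End almost_sure.

(** * Second moments of logarithmic averages in a Rademacher chaos *)

Section second_moments.
Context (R : realType) (d : measure_display) (T : measurableType d)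
    (P : probability T R) (Y : nat -> {RV P >-> R}) (l : nat)
    (f : nat -> l.-tuple nat -> R) (F : nat -> {RV P >-> R}).
Hypotheses (rY : iid_rademacher Y) (l2l : (2 <= l)%N)
  (kerf : forall n, (1 <= n)%N -> sym_offdiag_kernel (f n))
  (JF : forall n, (1 <= n)%N -> is_J Y (f n) (F n))
  (normf : forall n, (1 <= n)%N -> l`!%:R * l2_norm (f n) ^+ 2 = 1).

Definition star_sum k : R := \sum_(1 <= m < l) l2_norm (star m (f k) (f k)).

Lemma star_sum_ge0 k : 0 <= star_sum k.
Proof. by apply: sumr_ge0 => m _; exact: sqrtr_ge0. Qed.

Let mF k : measurable_fun [set: T] (F k). Proof. exact: measurable_funP. Qed.

Lemma l2_norm_sqr n (g : n.-tuple nat -> R) : l2 g -> l2_norm g ^+ 2 = l2_dot g g.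
Proof.
move=> lg; rewrite /l2_norm sqr_sqrtr //.
apply: (cvgr_to_ge (l2_dot_box_cvg lg lg)).
by apply: nearW => N; apply: sumr_ge0 => t _; rewrite -expr2 sqr_ge0.
Qed.

Lemma variance_cvg k : (1 <= k)%N ->
  l`!%:R * \sum_(t : l.-tuple 'I_N) f k (nat_tuple t) ^+ 2 @[N --> \oo] --> (1 : R).
Proof.
move=> k1; have [lf _ _] := kerf k1.
have h : l`!%:R * \sum_(t : l.-tuple 'I_N) f k (nat_tuple t) ^+ 2 @[N --> \oo] -->
    l`!%:R * l2_dot (f k) (f k).
  by apply: cvgM; [exact: cvg_cst|exact: l2_dot_box_cvg].
by move: h; rewrite -l2_norm_sqr // normf.
Qed.

Lemma charfun_single k t th : (1 <= k)%N -> 0 <= t ->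
  `|\int[P]_w cos (t * F k w + th) - expR (- (t ^+ 2 / 2)) * cos th| <=
  charfun_cst l t * star_sum k.
Proof.
move=> k1 t0; have [lf fs fd] := kerf k1.
rewrite -[t ^+ 2 / 2]mulr1.
apply: (charfun_bound rY th (mF k) l2l fs fd (is_J_box_lim (JF k1)) (s := fun m => l2_norm (star m (f k) (f k)))) => //.
- by move=> m; exact: sqrtr_ge0.
- by move=> m N /andP[_ ml]; exact: (box_contr_le_star (ltnW ml) lf).
- exact: variance_cvg.
Qed.

(** The kernel f_k + e f_j has limit variance 1 + 1 + 2 e rho, and its contraction norms are at most
    3 (a + b), with a and b those of the two kernels, since 8 (a^2 + b^2) <= 9 (a + b)^2. The sign
    of the variance is returned as well, for [expR_lipschitz]. *)
Lemma charfun_pair k j (e t th : R) : (1 <= k)%N -> (1 <= j)%N -> e ^+ 2 = 1 -> 0 <= t ->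
  `|\int[P]_w cos (t * (F k w + e * F j w) + th) -
     expR (- (t ^+ 2 / 2 * (2 + 2 * (e * (l`!%:R * l2_dot (f k) (f j)))))) * cos th| <=
   charfun_cst l t * (3 * (star_sum k + star_sum j)) /\
  0 <= 2 + 2 * (e * (l`!%:R * l2_dot (f k) (f j))).
Proof.
move=> k1 j1 e1 t0; have [lk ks kd] := kerf k1; have [lj js jd] := kerf j1.
have cv : l`!%:R * \sum_(t : l.-tuple 'I_N) (f k (nat_tuple t) + e * f j (nat_tuple t)) ^+ 2 @[N --> \oo]
    --> 2 + 2 * (e * (l`!%:R * l2_dot (f k) (f j))).
  have -> : (fun N => l`!%:R * \sum_(t : l.-tuple 'I_N) (f k (nat_tuple t) + e * f j (nat_tuple t)) ^+ 2) =
    (fun N => l`!%:R * \sum_(t : l.-tuple 'I_N) f k (nat_tuple t) ^+ 2 +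
       l`!%:R * \sum_(t : l.-tuple 'I_N) f j (nat_tuple t) ^+ 2 +
       2 * (e * (l`!%:R * \sum_(t : l.-tuple 'I_N) f k (nat_tuple t) * f j (nat_tuple t)))).
    apply/funext => N; rewrite !mulr_sumr -!big_split /=; apply: eq_bigr => s _.
    by ring: e1.
  have -> : 2 + 2 * (e * (l`!%:R * l2_dot (f k) (f j))) = 1 + 1 + 2 * (e * (l`!%:R * l2_dot (f k) (f j))) by ring.
  apply: cvgD; first by apply: cvgD; exact: variance_cvg.
  apply: cvgM; first exact: cvg_cst.
  apply: cvgM; first exact: cvg_cst.
  apply: cvgM; first exact: cvg_cst.
  exact: l2_dot_box_cvg.
have s20 : 0 <= 2 + 2 * (e * (l`!%:R * l2_dot (f k) (f j))).
  apply: (cvgr_to_ge cv); apply: nearW => N.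
  by rewrite mulr_ge0 ?ler0n // sumr_ge0 // => s _; rewrite sqr_ge0.
split=> //.
have -> : 3 * (star_sum k + star_sum j) =
   \sum_(1 <= m < l) 3 * (l2_norm (star m (f k) (f k)) + l2_norm (star m (f j) (f j))).
  by rewrite /star_sum -big_split mulr_sumr.
apply: (charfun_bound rY th (g := fun t => f k t + e * f j t)
  (s := fun m => 3 * (l2_norm (star m (f k) (f k)) + l2_norm (star m (f j) (f j))))) => //.
- by apply: measurable_funD => //; exact: measurable_funM.
- by move=> s u; rewrite (ks s u) (js s u).
- by move=> u uu; rewrite kd // jd // mulr0 addr0.
- by apply: box_lim_add => //; apply: is_J_box_lim; exact: JF.
- by move=> m; rewrite mulr_ge0 // addr_ge0 // sqrtr_ge0.
- move=> m N /andP[_ ml]; apply: le_trans (box_contr_add_le _ _ _ _ _ e1) _.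
  have h1 := box_contr_le_star (ltnW ml) lk N; have h2 := box_contr_le_star (ltnW ml) lj N.
  have a0 : 0 <= l2_norm (star m (f k) (f k)) by exact: sqrtr_ge0.
  have b0 : 0 <= l2_norm (star m (f j) (f j)) by exact: sqrtr_ge0.
  apply: (@le_trans _ _ (8 * (l2_norm (star m (f k) (f k)) ^+ 2 + l2_norm (star m (f j) (f j)) ^+ 2))).
    by rewrite ler_wpM2l // lerD.
  by move: a0 b0; move: (l2_norm _) (l2_norm _) => a b a0 b0; nra.
Qed.

Lemma expR_lipschitz (a b : R) : 0 <= a -> 0 <= b -> `|expR (- a) - expR (- b)| <= `|a - b|.
Proof.
wlog ab : a b / a <= b.
  move=> W a0 b0; have [ab|/ltW ba] := leP a b; first exact: W.
  by rewrite distrC [leRHS]distrC; exact: W.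
move=> a0 b0; rewrite ger0_norm; last by rewrite subr_ge0 ler_expR lerN2.
rewrite distrC ger0_norm ?subr_ge0 //.
have -> : expR (- b) = expR (- a) * expR (- (b - a)) by rewrite -expRD; congr expR; ring.
rewrite -{1}[expR (- a)]mulr1 -mulrBr.
apply: (@le_trans _ _ (1 - expR (- (b - a)))).
  apply: ler_piMl; first by rewrite subr_ge0 -expR0 ler_expR oppr_le0 subr_ge0.
  by rewrite -expR0 ler_expR oppr_le0.
by rewrite lerBlDr -lerBlDl; have := expR_ge1Dx (- (b - a)); lra.
Qed.

(** Of the four copies of [charfun_cst], three come from the sum and difference of F_k and F_j and
    one from the centring; r^2 l! is the price of replacing the variance of F_k + e F_j by 2. *)
Definition cov_cst (r : R) : R := 4 * charfun_cst l r + r ^+ 2 * l`!%:R.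

Lemma cov_cst_ge0 r : 0 <= cov_cst r.
Proof.
by apply: addr_ge0; apply: mulr_ge0; rewrite ?charfun_cst_ge0 ?sqr_ge0 ?ler0n.
Qed.

(** The product of cosines is half the sum of a cosine of t (F_k + F_j) with phase 2 th and one of t
    (F_k - F_j) with phase 0. At variance 2 both have the Gaussian factor exp(-t^2), and the
    Gaussian parts cancel. Uniformity in t <= r serves for the averages over frequencies. *)
Lemma cov_bound k j (t r th : R) : (1 <= k)%N -> (1 <= j)%N -> 0 <= t <= r ->
  `|\int[P]_w ((cos (t * F k w + th) - expR (- (t ^+ 2 / 2)) * cos th) *
               (cos (t * F j w + th) - expR (- (t ^+ 2 / 2)) * cos th))| <=
  cov_cst r * (star_sum k + star_sum j + `|l2_dot (f k) (f j)|).
Proof.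
move=> k1 j1 tr; have /andP[t0 _] := tr.
set a := expR (- (t ^+ 2 / 2)) * cos th.
have bk := bmeas_cos t th (mF k); have bj := bmeas_cos t th (mF j).
set K := charfun_cst l r; set S := star_sum k + star_sum j; set rho := l2_dot (f k) (f j).
have KK : charfun_cst l t <= K by exact: charfun_cst_le.
have S0 : 0 <= S by rewrite addr_ge0 // star_sum_ge0.
have sq1 : (1 : R) ^+ 2 = 1 by rewrite expr1n.
have sqN1 : (-1 : R) ^+ 2 = 1 by rewrite sqrrN expr1n.
have cc : expR (- (t ^+ 2 / 2)) * expR (- (t ^+ 2 / 2)) = expR (- (t ^+ 2)).
  by rewrite -expRD; congr expR; field.
have lr : l`!%:R * `|rho| * t ^+ 2 <= r ^+ 2 * l`!%:R * `|rho|.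
  rewrite mulrC mulrA ler_wpM2r // ler_wpM2r ?ler0n //.
  by case/andP: tr => _ tr; apply: lerXn2r => //; rewrite nnegrE //; lra.
have pair (e th' : R) : e ^+ 2 = 1 -> `|e| = 1 ->
    `|\int[P]_w cos (t * (F k w + e * F j w) + th') - expR (- (t ^+ 2)) * cos th'| <=
    K * (3 * S) + r ^+ 2 * l`!%:R * `|rho|.
  move=> e1 en; have [h s20] := charfun_pair th' k1 j1 e1 t0.
  set E1 := expR _ in h.
  have -> : \int[P]_w cos (t * (F k w + e * F j w) + th') - expR (- (t ^+ 2)) * cos th' =
    (\int[P]_w cos (t * (F k w + e * F j w) + th') - E1 * cos th') + (E1 - expR (- t ^+ 2)) * cos th'.
    by ring.
  apply: le_trans (ler_normD _ _) _; apply: lerD.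
    by apply: le_trans h _; rewrite ler_wpM2r // mulr_ge0.
  rewrite normrM; apply: le_trans (ler_piMr _ (cos_max _)) _ => //.
  apply: le_trans (expR_lipschitz _ _) _; first by rewrite mulr_ge0 // divr_ge0 // sqr_ge0.
    exact: sqr_ge0.
  apply: le_trans lr; rewrite -/rho.
  have -> : t ^+ 2 / 2 * (2 + 2 * (e * (l`!%:R * rho))) - t ^+ 2 = e * (l`!%:R * rho * t ^+ 2) by field.
  by rewrite normrM en mul1r normrM (ger0_norm (sqr_ge0 t)) normrM normr_nat.
have h1 := pair 1 (2 * th) sq1 (normr1 _).
have h2 := pair (-1) 0 sqN1 (normrN1 _).
have h3 := charfun_single th k1 t0; have h4 := charfun_single th j1 t0.
rewrite -/a in h3 h4.
have bp : bmeas (fun w => cos (t * (F k w + 1 * F j w) + 2 * th)).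
  by apply: bmeas_cos; apply: measurable_funD => //; exact: measurable_funM.
have bm : bmeas (fun w => cos (t * (F k w + -1 * F j w) + 0)).
  by apply: bmeas_cos; apply: measurable_funD => //; exact: measurable_funM.
have -> : \int[P]_w ((cos (t * F k w + th) - a) * (cos (t * F j w + th) - a)) =
   2^-1 * (\int[P]_w cos (t * (F k w + 1 * F j w) + 2 * th) - expR (- (t ^+ 2)) * cos (2 * th)) +
   2^-1 * (\int[P]_w cos (t * (F k w + -1 * F j w) + 0) - expR (- (t ^+ 2)) * cos 0) -
   a * (\int[P]_w cos (t * F k w + th) - a) - a * (\int[P]_w cos (t * F j w + th) - a).
  transitivity (\int[P]_w (2^-1 * cos (t * (F k w + 1 * F j w) + 2 * th) +
      2^-1 * cos (t * (F k w + -1 * F j w) + 0) +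
      ((- a) * cos (t * F k w + th) + ((- a) * cos (t * F j w + th) + a ^+ 2)))).
    apply: eq_Rintegral => w _.
    have -> : t * (F k w + 1 * F j w) + 2 * th = (t * F k w + th) + (t * F j w + th) by ring.
    have -> : t * (F k w + -1 * F j w) + 0 = (t * F k w + th) - (t * F j w + th) by ring.
    by move: (t * F k w + th) (t * F j w + th) => A B; rewrite cosD cosB; field.
  rewrite expD; first last.
  - apply: bmeasD; first exact: bmeasZ.
    by apply: bmeasD; [exact: bmeasZ|exact: bmeas_cst].
  - by apply: bmeasD; exact: bmeasZ.
  rewrite [X in X + _]expD; [|exact: bmeasZ|exact: bmeasZ].
  rewrite [X in _ + X]expD; first last.
  - by apply: bmeasD; [exact: bmeasZ|exact: bmeas_cst].
  - exact: bmeasZ.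
  rewrite [X in _ + (_ + X)]expD; [|exact: bmeasZ|exact: bmeas_cst].
  rewrite exp_cst !expZ //.
  (* The square of the centring [a] is the Gaussian value of the same product formula, by cos(2 th)
     = 2 cos(th)^2 - 1. *)
  have a2 : a ^+ 2 = 2^-1 * (expR (- t ^+ 2) * cos (2 * th)) + 2^-1 * (expR (- t ^+ 2) * cos 0).
    by rewrite cos0 -cc /a [2 * th]mulrC mulr_natr cos_mulr2n; field.
  by move: a2; set u := 2^-1 * (_ * cos (2 * th)); set v := 2^-1 * (_ * cos 0) => a2; rewrite !mulrBr -/u -/v; lra.
have an : `|a| <= 1.
  rewrite normrM (ger0_norm (expR_ge0 _)) mulr_ile1 ?expR_ge0 ?cos_max //.
  by rewrite -expR0 ler_expR oppr_le0 divr_ge0 // sqr_ge0.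
have an3 : `|a * (\int[P]_w cos (t * F k w + th) - a)| <= K * star_sum k.
  rewrite normrM; apply: le_trans (ler_piMl _ an) _ => //; apply: le_trans h3 _.
  by rewrite ler_wpM2r // star_sum_ge0.
have an4 : `|a * (\int[P]_w cos (t * F j w + th) - a)| <= K * star_sum j.
  rewrite normrM; apply: le_trans (ler_piMl _ an) _ => //; apply: le_trans h4 _.
  by rewrite ler_wpM2r // star_sum_ge0.
apply: le_trans (ler_normB _ _) _; apply: le_trans (lerD (ler_normB _ _) (lexx _)) _.
apply: le_trans (lerD (lerD (ler_normD _ _) (lexx _)) (lexx _)) _.
have half (z : R) : `|2^-1 * z| = 2^-1 * `|z| by rewrite normrM ger0_norm // invr_ge0.
rewrite !half.
apply: (@le_trans _ _ (K * (3 * S) + r ^+ 2 * l`!%:R * `|rho| + K * S)).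
  have -> : K * S = K * star_sum k + K * star_sum j by rewrite mulrDr.
  apply: le_trans (lerD (lerD (lerD (ler_wpM2l _ h1) (ler_wpM2l _ h2)) an3) an4) _; rewrite ?invr_ge0 //.
  by rewrite le_eqVlt; apply/orP; left; apply/eqP; rewrite mulrDr; field.
have K0 : 0 <= K by exact: charfun_cst_ge0.
rewrite /cov_cst -/K -/S; set q := r ^+ 2 * _.
have q0 : 0 <= q * S by apply: mulr_ge0 => //; apply: mulr_ge0; rewrite ?sqr_ge0 ?ler0n.
have K_rho : 0 <= K * `|rho| by rewrite mulr_ge0.
have -> : (4 * K + q) * (S + `|rho|) = 4 * (K * S) + 4 * (K * `|rho|) + q * S + q * `|rho| by ring.
by move: K_rho q0; lra.
Qed.

End second_moments.

(** * The Gaussian functional and tightness *)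

Section gauss_functional.
Context {R : realType}.
Local Notation bm h := (bmeas (h : measurableTypeR R -> R)).

Definition gint (h : R -> R) : R := \int[normal_prob 0 1]_x h x.

Lemma gint_cos (t th : R) : 0 <= t -> gint (fun x => cos (t * x + th)) = expR (- (t ^+ 2 / 2)) * cos th.
Proof. exact: normal_charfun. Qed.

Lemma gint_le h K : bm h -> (forall x, `|h x| <= K) -> `|gint h| <= K.
Proof. by move=> [mh _] hK; exact: (norm_exp_le (normal_prob 0 1) mh hK). Qed.

Lemma posfun_gint : posfun gint.
Proof.
split=> [g h bg bh|a g bg|g h bg bh gh].
- exact: (expD (normal_prob 0 1) bg bh).
- exact: (expZ (normal_prob 0 1) a bg).
- exact: (ler_exp (normal_prob 0 1) bg bh gh).
Qed.

Lemma gint1 : gint (fun=> 1) = 1.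
Proof. exact: (exp_cst (normal_prob 0 1)). Qed.

Lemma bm_cosavg N (a : R) : bm (fun x => cosavg N (a * x)).
Proof.
apply: bmeasZ; apply: bmeas_sum => j.
rewrite (_ : (fun x => _) = fun x : R => cos ((2 * (j : nat)%:R + 1) / (2 * N.+1%:R) * a * x + 0)).
  exact: bm_cos.
by apply/funext => x; rewrite addr0 mulrA.
Qed.

Lemma bm_sinc (a : R) : bm (fun x => sinc (a * x)).
Proof.
apply: (@bmeas_cvg _ _ (measurableTypeR R) (fun N x => cosavg N (a * x)) _ 1).
- by move=> N; have [] := bm_cosavg N a.
- by move=> N x; exact: cosavg_le1.
- by move=> x; exact: cosavg_cvg.
Qed.

Lemma gint_cosavg_cvg (a : R) :
  gint (fun x => cosavg N (a * x)) @[N --> \oo] --> gint (fun x => sinc (a * x)).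
Proof.
apply: (@exp_bounded_cvg _ _ (measurableTypeR R) (normal_prob 0 1) (fun N x => cosavg N (a * x)) _ 1).
- by move=> N; have [] := bm_cosavg N a.
- by move=> N x; exact: cosavg_le1.
- by move=> x; exact: cosavg_cvg.
Qed.

Lemma sinc_le1 (x : R) : `|sinc x| <= 1.
Proof.
have c : `|cosavg N x| @[N --> \oo] --> `|sinc x| by apply: cvg_norm; exact: cosavg_cvg.
by apply: (cvgr_to_le c); apply: nearW => N; exact: cosavg_le1.
Qed.

Lemma gint_sinc_cvg1 : gint (fun x => sinc (m.+1%:R^-1 * x)) @[m --> \oo] --> (1 : R).
Proof.
rewrite -[X in _ --> X]gint1.
apply: (@exp_bounded_cvg _ _ (measurableTypeR R) (normal_prob 0 1) (fun m x => sinc (m.+1%:R^-1 * x)) _ 1).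
- by move=> N; have [] := bm_sinc N.+1%:R^-1.
- by move=> N x; exact: sinc_le1.
- move=> x; apply/subr_cvg0; apply: norm_cvg0.
  apply: (@squeeze_cvgr _ _ _ _ (cst 0) (fun m => m.+1%:R^-1 * (`|x| ^+ 2 + `|x|))).
  + apply: nearW => m; rewrite /= normr_ge0 /=; apply: le_trans (sinc_sub1_le _) _.
    rewrite normrM ger0_norm ?invr_ge0 ?ler0n // mulrDr lerD2r exprMn ler_wpM2r ?exprn_ge0 //.
    rewrite expr2 ler_piMl ?invr_ge0 ?ler0n // invf_le1 ?ltr0n //.
    by rewrite (ler_nat R 1).
  + exact: cvg_cst.
  + rewrite -(mul0r (`|x| ^+ 2 + `|x|)); apply: cvgM; [exact: cvg_harmonic|exact: cvg_cst].
Qed.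

(* [1 - sinc] is nonnegative, and at least 1/2 away from a neighbourhood of the origin. *)
Lemma sinc_tight (Lam : nat -> (R -> R) -> R) (e : R) : (forall n, posfun (Lam n)) ->
    (forall m, cvgf Lam gint (fun x => sinc (m.+1%:R^-1 * x))) ->
    cvgf Lam gint (fun=> 1) -> 0 < e ->
  exists (psi : R -> R) (K : R),
  [/\ bm psi, forall x, 0 <= psi x, forall x, K <= `|x| -> 1 <= psi x,
      cvgf Lam gint psi & gint psi <= e].
Proof.
move=> hLam hs h1 e0.
have /cvgrPdist_le/(_ (e / 2)) := gint_sinc_cvg1; rewrite divr_gt0 // => /(_ isT) [m _ /(_ m (leqnn m)) hm].
have b1 : bm (fun=> 2 * 1) by exact: bmeas_cst.
have b2 : bm (fun x => -2 * sinc (m.+1%:R^-1 * x)) by exact: bmeasZ (bm_sinc _).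
exists (fun x => 2 * 1 + -2 * sinc (m.+1%:R^-1 * x)), (2 * m.+1%:R); split.
- exact: bmeasD.
- by move=> x; have := sinc_le1 (m.+1%:R^-1 * x); rewrite ler_norml => /andP[]; lra.
- move=> x hx; have : `|sinc (m.+1%:R^-1 * x)| <= 2^-1.
    apply: sinc_le; rewrite normrM ger0_norm ?invr_ge0 ?ler0n //.
    by rewrite mulrC ler_pdivlMr ?ltr0n.
  by rewrite ler_norml => /andP[]; lra.
- apply: cvgfD => //; first exact: posfun_gint.
  + by apply: (cvgfZ hLam posfun_gint) => //; exact: bmeas_cst.
  + by apply: (cvgfZ hLam posfun_gint) => //; exact: bm_sinc.
- have [gD gZ _] := posfun_gint.
  rewrite (gD (fun=> 2 * 1)) // (gZ 2 (fun=> 1)); last exact: bmeas_cst.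
  rewrite gZ; last exact: bm_sinc.
  by rewrite gint1; move: hm; rewrite ler_norml => /andP[]; lra.
Qed.

(** Frequencies of the midpoint sum for sinc(x / (m + 1)). They stay in [0, 1], so that the
    constants taken at frequency 1 serve for all of them. *)
Definition node N m (j : nat) : R := (2 * j%:R + 1) / (2 * N.+1%:R) * m.+1%:R^-1.

Lemma node_itv N m (j : 'I_N.+1) : 0 <= node N m j <= 1.
Proof.
have m1 : m.+1%:R^-1 <= 1 :> R by rewrite invf_le1 ?ltr0n // (ler_nat R 1).
have m0 : 0 <= m.+1%:R^-1 :> R by rewrite invr_ge0 ler0n.
have a0 : 0 <= (2 * (j : nat)%:R + 1) / (2 * N.+1%:R) :> R.
  by rewrite divr_ge0 // ?addr_ge0 ?mulr_ge0 // ler0n.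
rewrite mulr_ge0 //=; apply: mulr_ile1 => //.
rewrite ler_pdivrMr ?mulr_gt0 ?ltr0n // mul1r.
have : (j : nat).+1%:R <= N.+1%:R :> R by rewrite ler_nat ltn_ord.
by rewrite -natr1; lra.
Qed.

Lemma cosavg_node N m (x : R) :
  cosavg N (m.+1%:R^-1 * x) = N.+1%:R^-1 * \sum_(j < N.+1) cos (node N m j * x + 0).
Proof.
by rewrite /cosavg; congr (_ * _); apply: eq_bigr => j _; rewrite addr0 mulrA.
Qed.

Lemma exp_cosavg_node d (T : measurableType d) (P : probability T R) (X : T -> R) N m :
    measurable_fun [set: T] X ->
  \int[P]_w cosavg N (m.+1%:R^-1 * X w) =
  N.+1%:R^-1 * \sum_(j < N.+1) \int[P]_w cos (node N m j * X w + 0).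
Proof.
move=> mX; have b j : bmeas (fun w => cos (node N m j * X w + 0)) by exact: bmeas_cos.
rewrite -(exp_sum P _ _ (fun j : 'I_N.+1 => b j)) -expZ; last exact: bmeas_sum.
by apply: eq_Rintegral => w _; exact: cosavg_node.
Qed.

End gauss_functional.

(** * Second moments for cosine and sinc tests *)

Section log_average_moments.
Context (R : realType) (d : measure_display) (T : measurableType d)
    (P : probability T R) (Y : nat -> {RV P >-> R}) (l : nat)
    (f : nat -> l.-tuple nat -> R) (F : nat -> {RV P >-> R}).
Hypotheses (rY : iid_rademacher Y) (l2l : (2 <= l)%N)
  (kerf : forall n, (1 <= n)%N -> sym_offdiag_kernel (f n))
  (JF : forall n, (1 <= n)%N -> is_J Y (f n) (F n))
  (normf : forall n, (1 <= n)%N -> l`!%:R * l2_norm (f n) ^+ 2 = 1).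
Local Notation gam := (@gamma R).
Local Notation bm h := (bmeas (h : measurableTypeR R -> R)).

Let mF k : measurable_fun [set: T] (F k). Proof. exact: measurable_funP. Qed.

Definition logavg (h : R -> R) n w := logsum (fun k => h (F k w) - gint h) n.

Definition cov_sum n : R := \sum_(1 <= k < n.+1) \sum_(1 <= j < n.+1)
  k%:R^-1 * j%:R^-1 * (star_sum f k + star_sum f j + `|l2_dot (f k) (f j)|).

Lemma bmeas_comp h k : bm h -> bmeas (fun w => h (F k w)).
Proof.
move=> [mh [K hK]]; split; last by exists K => w; exact: hK.
exact: (measurableT_comp mh (mF k)).
Qed.

Lemma bmeas_centered h k : bm h -> bmeas (fun w => h (F k w) - gint h).
Proof. by move=> bh; apply: bmeasB; [exact: bmeas_comp|exact: bmeas_cst]. Qed.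

Lemma bmeas_logavg h n : bm h -> bmeas (logavg h n).
Proof. by move=> bh; apply: bmeas_sum => k; apply: bmeasZ; exact: bmeas_centered. Qed.

Lemma logavg_cos_sqr (t r th : R) n : 0 <= t <= r ->
  \int[P]_w (logavg (fun x => cos (t * x + th)) n w ^+ 2) <= cov_cst l r * cov_sum n.
Proof.
move=> tr; have /andP[t0 _] := tr.
pose x k w := cos (t * F k w + th) - expR (- (t ^+ 2 / 2)) * cos th.
have bx k : bmeas (x k) by apply: bmeasB; [exact: bmeas_cos|exact: bmeas_cst].
have -> : \int[P]_w (logavg (fun x => cos (t * x + th)) n w ^+ 2) =
   \int[P]_w (\sum_(1 <= k < n.+1) \sum_(1 <= j < n.+1) k%:R^-1 * j%:R^-1 * (x k w * x j w)).
  apply: eq_Rintegral => w _; rewrite /logavg /logsum gint_cos // expr2 big_distrlr /=.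
  by apply: eq_bigr => k _; apply: eq_bigr => j _; rewrite /x; ring.
have bxx k j : bmeas (fun w => k%:R^-1 * j%:R^-1 * (x k w * x j w)).
  by apply: bmeasZ; exact: bmeasM.
rewrite exp_sum; last by move=> k; exact: bmeas_sum.
rewrite /cov_sum mulr_sumr; apply: ler_sum_nat => k /andP[k1 _].
rewrite exp_sum // mulr_sumr; apply: ler_sum_nat => j /andP[j1 _].
rewrite expZ; last exact: bmeasM.
rewrite mulrCA ler_wpM2l ?mulr_ge0 ?invr_ge0 ?ler0n //.
apply: le_trans (ler_norm _) _; exact: (cov_bound rY l2l kerf JF normf th k1 j1 tr).
Qed.

(** The square of an average of cosine tests is at most the average of the squares, whence a bound
    that depends neither on N nor on m and survives the limit to [sinc]. *)
Lemma logavg_cosavg_sqr N m n :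
  \int[P]_w (logavg (fun x => cosavg N (m.+1%:R^-1 * x)) n w ^+ 2) <= cov_cst l 1 * cov_sum n.
Proof.
pose t (j : nat) : R := node N m j.
have N0 : 0 < N.+1%:R :> R by rewrite ltr0n.
have bt j : bm (fun x => cos (t j * x + 0)) by exact: bm_cos.
have E n' w : logavg (fun x => cosavg N (m.+1%:R^-1 * x)) n' w =
   N.+1%:R^-1 * \sum_(j < N.+1) logavg (fun x => cos (t j * x + 0)) n' w.
  have g : gint (fun x => cosavg N (m.+1%:R^-1 * x)) = N.+1%:R^-1 * \sum_(j < N.+1) gint (fun x => cos (t j * x + 0)).
    exact: (exp_cosavg_node (normal_prob 0 1) N m (X := fun x : measurableTypeR R => x) (@measurable_id _ _ _)).
  rewrite /logavg /logsum exchange_big mulr_sumr /=; apply: eq_bigr => k _.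
  by rewrite g cosavg_node -mulrBr -sumrB mulrCA; congr (_ * _); rewrite mulr_sumr.
apply: (@le_trans _ _ (\int[P]_w (N.+1%:R^-1 * \sum_(j < N.+1) logavg (fun x => cos (t j * x + 0)) n w ^+ 2))).
  apply: ler_exp.
  - by apply: (bmeasM (h := logavg _ n) (g := logavg _ n)); apply: bmeas_logavg; exact: bm_cosavg.
  - apply: bmeasZ; apply: bmeas_sum => j.
    by apply: (bmeasM (h := logavg _ n) (g := logavg _ n)); exact: bmeas_logavg.
  - move=> w; rewrite E exprMn.
    have := @sum_sqr_le R 'I_N.+1 predT (fun j => logavg (fun x => cos (t j * x + 0)) n w).
    rewrite cardE size_enum_ord => h.
    apply: le_trans (ler_wpM2l _ h) _; first by rewrite sqr_ge0.
    by rewrite mulrA expr2 mulfVK ?gt_eqF.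
have bj (j : 'I_N.+1) : bmeas (fun w => logavg (fun x => cos (t j * x + 0)) n w ^+ 2).
  by apply: (bmeasM (h := logavg _ n) (g := logavg _ n)); exact: bmeas_logavg.
rewrite expZ; last exact: bmeas_sum.
rewrite exp_sum // mulrC ler_pdivrMr //.
apply: le_trans (ler_sum _ (fun j _ => logavg_cos_sqr 0 n (node_itv m j))) _.
by rewrite sumr_const card_ord mulr_natr.
Qed.

Lemma logavg_sinc_sqr m n :
  \int[P]_w (logavg (fun x => sinc (m.+1%:R^-1 * x)) n w ^+ 2) <= cov_cst l 1 * cov_sum n.
Proof.
have c : \int[P]_w (logavg (fun x => cosavg N (m.+1%:R^-1 * x)) n w ^+ 2) @[N --> \oo] -->
   \int[P]_w (logavg (fun x => sinc (m.+1%:R^-1 * x)) n w ^+ 2).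
  have bl N w : `|logavg (fun x => cosavg N (m.+1%:R^-1 * x)) n w| <= 2 * gam n.
    rewrite /logavg /logsum; apply: le_trans (ler_norm_sum _ _ _) _.
    rewrite /gamma mulr_sumr; apply: ler_sum => k _.
    rewrite normrM ger0_norm ?invr_ge0 ?ler0n // mulrC ler_wpM2r ?invr_ge0 ?ler0n //.
    apply: le_trans (ler_normB _ _) _.
    rewrite -[2]/(1 + 1); apply: lerD; first exact: cosavg_le1.
    exact: (gint_le (bm_cosavg N m.+1%:R^-1) (fun x => cosavg_le1 N _)).
  apply: (@exp_bounded_cvg _ _ _ P (fun N w => logavg (fun x => cosavg N (m.+1%:R^-1 * x)) n w ^+ 2) _ ((2 * gam n) ^+ 2)).
  - move=> N; apply: measurable_funX.
    by have [] := bmeas_logavg n (bm_cosavg N m.+1%:R^-1).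
  - by move=> N w; rewrite normrX lerXn2r // nnegrE // mulr_ge0 // gamma_ge0.
  - move=> w.
    have h : logavg (fun x => cosavg N (m.+1%:R^-1 * x)) n w @[N --> \oo] --> logavg (fun x => sinc (m.+1%:R^-1 * x)) n w.
      apply: cvg_big => [|k _]; first exact: add_continuous.
      apply: cvgM; first exact: cvg_cst.
      by apply: cvgB; [exact: cosavg_cvg|exact: gint_cosavg_cvg].
    exact: (cvgM h h).
by apply: (cvgr_to_le c); apply: nearW => N; exact: logavg_cosavg_sqr.
Qed.

End log_average_moments.

(** * Summability of the weighted covariances *)

Section series.
Context {R : realType}.
Local Notation gam := (@gamma R).

Lemma series_bounded_sums (a : nat -> R) : (forall n, 0 <= a n) ->
  (\sum_(2 <= n <oo) (a n)%:E < +oo)%E -> exists K, forall q, \sum_(2 <= n < q) a n <= K.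
Proof.
move=> a0 fin.
have s0 : (0 <= \sum_(2 <= n <oo) (a n)%:E)%E by apply: nneseries_ge0 => n _ _; rewrite lee_fin.
exists (fine (\sum_(2 <= n <oo) (a n)%:E)%E) => q.
rewrite -lee_fin fineK; last by rewrite ge0_fin_numE.
rewrite -sumEFin; apply: (@nneseries_lim_ge R (fun n => (a n)%:E) xpredT 2 q) => n _ _.
by rewrite lee_fin.
Qed.

(** In [cov_sum] each star term depends on one of the two indices only; summing over the other gives
    gamma_n, which lowers gamma_n^3 to gamma_n^2 and matches the second series. By symmetry the two
    star terms contribute the factor 2. *)
Lemma cov_sum_bounded_sums l (f : nat -> l.-tuple nat -> R) :
  (\sum_(2 <= n <oo)
     ((n%:R * gam n ^+ 3)^-1 *
      \sum_(1 <= k < n.+1) \sum_(1 <= j < n.+1)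
        `|l2_dot (f k) (f j)| / (k%:R * j%:R))%:E < +oo)%E ->
  (forall m, (1 <= m <= l - 1)%N ->
    (\sum_(2 <= n <oo)
       ((n%:R * gam n ^+ 2)^-1 *
        \sum_(1 <= k < n.+1) k%:R^-1 * l2_norm (star m (f k) (f k)))%:E
     < +oo)%E) ->
  exists K, forall q, \sum_(2 <= n < q) (n%:R * gam n ^+ 3)^-1 * cov_sum f n <= K.
Proof.
move=> hrho hstar.
have c0 i n : 0 <= (n%:R * gam n ^+ i)^-1.
  by rewrite invr_ge0 mulr_ge0 ?ler0n // exprn_ge0 // gamma_ge0.
have [K1 hK1] : exists K, forall q, \sum_(2 <= n < q) ((n%:R * gam n ^+ 3)^-1 *
      \sum_(1 <= k < n.+1) \sum_(1 <= j < n.+1) `|l2_dot (f k) (f j)| / (k%:R * j%:R)) <= K.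
  apply: series_bounded_sums hrho => n; rewrite mulr_ge0 // sumr_ge0 // => k _.
  by apply: sumr_ge0 => j _; rewrite divr_ge0 // mulr_ge0 ?ler0n.
have [Km hKm] : exists Km : nat -> R, forall m, (1 <= m <= l - 1)%N -> forall q,
    \sum_(2 <= n < q) ((n%:R * gam n ^+ 2)^-1 *
        \sum_(1 <= k < n.+1) k%:R^-1 * l2_norm (star m (f k) (f k))) <= Km m.
  (* The condition on m is placed inside the existential, which makes the statement total in m and
     allows [choice]. *)
  have pre (m : nat) : exists K : R, (1 <= m <= l - 1)%N -> forall q,
      \sum_(2 <= n < q) ((n%:R * gam n ^+ 2)^-1 *
        \sum_(1 <= k < n.+1) k%:R^-1 * l2_norm (star m (f k) (f k))) <= K.
    have [hm|hm] := boolP (1 <= m <= l - 1)%N; last by exists 0.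
    have [|K hK] := series_bounded_sums _ (hstar m hm); last by exists K.
    move=> n; rewrite mulr_ge0 // sumr_ge0 // => k _.
    by rewrite mulr_ge0 ?invr_ge0 ?ler0n // sqrtr_ge0.
  by have [Km hKm] := choice pre; exists Km.
exists (2 * \sum_(1 <= m < l) Km m + K1) => q.
have E n : (2 <= n)%N -> (n%:R * gam n ^+ 3)^-1 * cov_sum f n =
   2 * \sum_(1 <= m < l) ((n%:R * gam n ^+ 2)^-1 *
        \sum_(1 <= k < n.+1) k%:R^-1 * l2_norm (star m (f k) (f k))) +
   (n%:R * gam n ^+ 3)^-1 * \sum_(1 <= k < n.+1) \sum_(1 <= j < n.+1) `|l2_dot (f k) (f j)| / (k%:R * j%:R).
  move=> n2.
  have g0 : gam n != 0 by rewrite gt_eqF // (lt_le_trans ltr01) // gamma_ge1 // (leq_trans _ n2).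
  have n0 : n%:R != 0 :> R by rewrite pnatr_eq0 -lt0n (leq_trans _ n2).
  pose s := \sum_(1 <= k < n.+1) k%:R^-1 * star_sum f k.
  have -> : cov_sum f n = 2 * (gam n * s) +
      \sum_(1 <= k < n.+1) \sum_(1 <= j < n.+1) `|l2_dot (f k) (f j)| / (k%:R * j%:R).
    have e1 : gam n * s = \sum_(1 <= k < n.+1) \sum_(1 <= j < n.+1) k%:R^-1 * j%:R^-1 * star_sum f k.
      rewrite mulrC /s /gamma big_distrlr /=; apply: eq_bigr => k _; apply: eq_bigr => j _.
      by rewrite mulrAC.
    have e2 : gam n * s = \sum_(1 <= k < n.+1) \sum_(1 <= j < n.+1) k%:R^-1 * j%:R^-1 * star_sum f j.
      rewrite /s /gamma big_distrlr /=; apply: eq_bigr => k _; apply: eq_bigr => j _.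
      by rewrite mulrA.
    rewrite mulr2n mulrDl mul1r {1}e1 e2 -!big_split /=; apply: eq_bigr => k _.
    by rewrite -!big_split /=; apply: eq_bigr => j _; rewrite invfM; ring.
  rewrite mulrDr; congr (_ + _).
  have -> : \sum_(1 <= m < l) ((n%:R * gam n ^+ 2)^-1 *
        \sum_(1 <= k < n.+1) k%:R^-1 * l2_norm (star m (f k) (f k))) = (n%:R * gam n ^+ 2)^-1 * s.
    rewrite -mulr_sumr exchange_big /=; congr (_ * _); apply: eq_bigr => k _.
    by rewrite /star_sum mulr_sumr.
  by field; rewrite g0 n0.
rewrite big_nat (eq_bigr _ (fun n h => E n (proj1 (andP h)))) -big_nat big_split /=.
apply: lerD; last exact: hK1.
rewrite -mulr_sumr ler_wpM2l // exchange_big /=; apply: ler_sum_nat => m /andP[m1 ml].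
by apply: hKm; rewrite m1 /=; lia.
Qed.

End series.

(** * Convergence in law and almost sure convergence *)

Section law_convergence.
Context (R : realType) (d : measure_display) (T : measurableType d)
    (P : probability T R) (Y : nat -> {RV P >-> R}) (l : nat)
    (f : nat -> l.-tuple nat -> R) (F : nat -> {RV P >-> R}).
Hypotheses (rY : iid_rademacher Y) (l2l : (2 <= l)%N)
  (kerf : forall n, (1 <= n)%N -> sym_offdiag_kernel (f n))
  (JF : forall n, (1 <= n)%N -> is_J Y (f n) (F n))
  (normf : forall n, (1 <= n)%N -> l`!%:R * l2_norm (f n) ^+ 2 = 1).

Let law n (h : R -> R) : R := \int[P]_w h (F n w).

Lemma posfun_law n : posfun (fun h => \int[P]_w h (F n w)).
Proof.
split=> [g h bg bh|a g bg|g h bg bh gh].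
- exact: (expD P (bmeas_comp F n bg) (bmeas_comp F n bh)).
- exact: (expZ P a (bmeas_comp F n bg)).
- exact: (ler_exp P (bmeas_comp F n bg) (bmeas_comp F n bh) (fun w => gh (F n w))).
Qed.

Hypothesis star0 : forall m, (1 <= m <= l - 1)%N ->
    l2_norm (star m (f n) (f n)) @[n --> \oo] --> (0 : R).

Lemma star_sum_cvg0 : star_sum f n @[n --> \oo] --> (0 : R).
Proof.
(* The range is kept as a condition of the sum, since [star0] speaks of the orders 1 to l - 1
   only. *)
have -> : (0 : R) = \sum_(1 <= m < l | (1 <= m < l)%N) 0 by rewrite big1.
rewrite /star_sum; under eq_fun do rewrite big_nat.
apply: cvg_big => [|m /andP[m1 ml]]; first exact: add_continuous.
by apply: star0; rewrite m1 /=; lia.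
Qed.

Lemma law_cvg_of_bound h K : (forall n, (1 <= n)%N -> `|law n h - gint h| <= K * star_sum f n) ->
  cvgf law gint h.
Proof.
move=> hb; apply/subr_cvg0; apply: norm_cvg0.
apply: (@squeeze_cvgr _ _ _ _ (cst 0) (fun n => K * star_sum f n)).
- by exists 1%N => // n /= n1; rewrite normr_ge0 hb.
- exact: cvg_cst.
- rewrite -(mulr0 K); apply: cvgM; [exact: cvg_cst|exact: star_sum_cvg0].
Qed.

Lemma law_cos_cvg (t th : R) : 0 <= t -> cvgf law gint (fun x => cos (t * x + th)).
Proof.
move=> t0; apply: (@law_cvg_of_bound _ (charfun_cst l t)) => n n1.
by rewrite gint_cos //; exact: (charfun_single rY l2l kerf JF normf th n1 t0).
Qed.

(** Every midpoint sum obeys the bound with the constant at frequency 1; the limit in N is taken for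
    fixed n, before n tends to infinity. *)
Lemma law_sinc_cvg m : cvgf law gint (fun x => sinc (m.+1%:R^-1 * x)).
Proof.
apply: (@law_cvg_of_bound _ (charfun_cst l 1)) => n n1.
have c : `|law n (fun x => cosavg N (m.+1%:R^-1 * x)) - gint (fun x => cosavg N (m.+1%:R^-1 * x))| @[N --> \oo]
    --> `|law n (fun x => sinc (m.+1%:R^-1 * x)) - gint (fun x => sinc (m.+1%:R^-1 * x))|.
  apply: cvg_norm; apply: cvgB; last exact: gint_cosavg_cvg.
  apply: (@exp_bounded_cvg _ _ _ P (fun N w => cosavg N (m.+1%:R^-1 * F n w)) _ 1).
  - by move=> N; have [] := bmeas_comp F n (bm_cosavg N m.+1%:R^-1).
  - by move=> N w; exact: cosavg_le1.
  - by move=> w; exact: cosavg_cvg.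
apply: (cvgr_to_le c); apply: nearW => N {c}.
have N0 : 0 < N.+1%:R :> R by rewrite ltr0n.
rewrite /law (exp_cosavg_node P N m (measurable_funP (F n))).
rewrite /gint (exp_cosavg_node (normal_prob 0 1) N m (X := fun x : measurableTypeR R => x) (@measurable_id _ _ _)).
rewrite -mulrBr normrM (ger0_norm (_ : 0 <= N.+1%:R^-1)) ?invr_ge0 ?ler0n //.
rewrite mulrC ler_pdivrMr // -sumrB.
apply: le_trans (ler_norm_sum _ _ _) _.
have b (j : 'I_N.+1) : `|\int[P]_w cos (node N m j * F n w + 0) -
    \int[normal_prob 0 1]_x cos (node N m j * x + 0)| <= charfun_cst l 1 * star_sum f n.
  have /andP[t0 t1] := @node_itv R N m j.
  rewrite [X in _ - X](gint_cos 0 t0).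
  apply: le_trans (charfun_single rY l2l kerf JF normf 0 n1 t0) _.
  by rewrite ler_wpM2r ?star_sum_ge0 // charfun_cst_le // t0.
apply: le_trans (ler_sum _ (fun j _ => b j)) _.
by rewrite sumr_const card_ord mulr_natr.
Qed.


Lemma law_trig_cvg (m k : nat) : cvgf law gint (fun x => cos (k%:R / m.+1%:R * x)) /\
  cvgf law gint (fun x => sin (k%:R / m.+1%:R * x)).
Proof.
have t0 : 0 <= k%:R / m.+1%:R :> R by rewrite divr_ge0 ?ler0n.
split; [have := law_cos_cvg (th := 0) t0|have := law_cos_cvg (th := - (pi / 2)) t0].
  by under [fun x => cos (_ + 0)]eq_fun do rewrite addr0.
by under [fun x => cos (_ - _)]eq_fun do rewrite cosBpihalf.
Qed.

Lemma law_cvg : cvg_law_std_normal F.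
Proof.
move=> phi bcphi; apply: (weak_cvg (Lam := law) (L := gint)) => //.
- exact: posfun_law.
- exact: posfun_gint.
- exact: law_trig_cvg.
- exact: gint1.
- move=> e e0; apply: sinc_tight => //; first exact: posfun_law.
    exact: law_sinc_cvg.
  have [+ _] := law_trig_cvg 0 0; rewrite (_ : (fun x => _) = fun=> 1) //.
  by apply/funext => x; rewrite !mul0r cos0.
Qed.

End law_convergence.

(** * Logarithmic averages along almost every path *)

Section almost_sure_convergence.
Context (R : realType) (d : measure_display) (T : measurableType d)
    (P : probability T R) (Y : nat -> {RV P >-> R}) (l : nat)
    (f : nat -> l.-tuple nat -> R) (F : nat -> {RV P >-> R}).
Hypotheses (rY : iid_rademacher Y) (l2l : (2 <= l)%N)
  (kerf : forall n, (1 <= n)%N -> sym_offdiag_kernel (f n))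
  (JF : forall n, (1 <= n)%N -> is_J Y (f n) (F n))
  (normf : forall n, (1 <= n)%N -> l`!%:R * l2_norm (f n) ^+ 2 = 1).
Variable K : R.
Local Notation gam := (@gamma R).
Local Notation bm h := (bmeas (h : measurableTypeR R -> R)).
Hypothesis cov_sumK :
  forall q, \sum_(2 <= n < q) (n%:R * gam n ^+ 3)^-1 * cov_sum f n <= K.

Let Lam w n (h : R -> R) : R := logsum (fun k => h (F k w)) n / gam n.

Lemma posfun_log_average w n : posfun (fun h => logsum (fun k => h (F k w)) n / gam n).
Proof.
split=> [g h _ _|a g _|g h _ _ gh]; rewrite /logsum.
- by rewrite -mulrDl -big_split /=; congr (_ / _); apply: eq_bigr => k _; rewrite mulrDr.
- by rewrite mulrA mulr_sumr; congr (_ / _); apply: eq_bigr => k _; rewrite mulrCA.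
- rewrite ler_wpM2r ?invr_ge0 ?gamma_ge0 //; apply: ler_sum => k _.
  by rewrite ler_wpM2l ?invr_ge0 ?ler0n.
Qed.

Lemma ae_cvg_of_moment h C : bm h -> (forall x, `|h x| <= 1) ->
    (forall n, \int[P]_w (logavg F h n w ^+ 2) <= C * cov_sum f n) -> 0 <= C ->
  {ae P, forall w, cvgf (Lam w) gint h}.
Proof.
move=> bh h1 hC C0.
have c0 n : 0 <= (n%:R * gam n ^+ 3)^-1.
  by rewrite invr_ge0 mulr_ge0 ?ler0n // exprn_ge0 // gamma_ge0.
have h2 k w : `|h (F k w) - gint h| <= 2.
  by rewrite (le_trans (ler_normB _ _)) // -[2]/(1 + 1) lerD // (gint_le bh).
have hK q : \sum_(2 <= n < q) (n%:R * gam n ^+ 3)^-1 *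
    \int[P]_w (logsum (fun k => h (F k w) - gint h) n ^+ 2) <= C * K.
  apply: le_trans (ler_wpM2l C0 (cov_sumK q)); rewrite mulr_sumr; apply: ler_sum => n _.
  by rewrite [leRHS]mulrCA; exact: (ler_wpM2l (c0 n) (hC n)).
have := ae_log_average (fun k => bmeas_centered F k bh) h2 hK.
apply: filterS => w cw; apply/subr_cvg0; apply: cvg_trans cw; apply: near_eq_cvg.
exists 1%N => // n /= n1.
have g0 : gam n != 0 by rewrite gt_eqF // (lt_le_trans ltr01) // gamma_ge1.
apply/esym; apply: (canRL (mulfK g0)); rewrite mulrBl /Lam divfK // /gamma mulr_sumr -sumrB.
by apply: eq_bigr => k _; rewrite mulrBr [gint h * _]mulrC.
Qed.

Lemma ae_cos_cvg (t th : R) : 0 <= t ->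
  {ae P, forall w, cvgf (Lam w) gint (fun x => cos (t * x + th))}.
Proof.
move=> t0; apply: (@ae_cvg_of_moment _ (cov_cst l t)).
- exact: bm_cos.
- by move=> x; exact: cos_max.
- by move=> n; apply: (logavg_cos_sqr rY l2l kerf JF normf); rewrite t0 lexx.
- exact: cov_cst_ge0.
Qed.

Lemma ae_sinc_cvg m : {ae P, forall w, cvgf (Lam w) gint (fun x => sinc (m.+1%:R^-1 * x))}.
Proof.
apply: (@ae_cvg_of_moment _ (cov_cst l 1)).
- exact: bm_sinc.
- by move=> x; exact: sinc_le1.
- by move=> n; exact: (logavg_sinc_sqr rY l2l kerf JF normf).
- exact: cov_cst_ge0.
Qed.

(** The tests are indexed by two natural numbers, so one null set serves for all of them; arbitrary
    phi are then reached path by path. *)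
Lemma ae_trig_cvg : {ae P, forall w, forall m k : nat,
  cvgf (Lam w) gint (fun x => cos (k%:R / m.+1%:R * x)) /\
  cvgf (Lam w) gint (fun x => sin (k%:R / m.+1%:R * x))}.
Proof.
apply/ae_foralln => m; apply/ae_foralln => k.
have t0 : 0 <= k%:R / m.+1%:R :> R by rewrite divr_ge0 ?ler0n.
apply: filterS2 (ae_cos_cvg 0 t0) (ae_cos_cvg (- (pi / 2)) t0) => w c1 c2; split.
  by move: c1; under [fun x => cos (_ + 0)]eq_fun do rewrite addr0.
by move: c2; under [fun x => cos (_ - _)]eq_fun do rewrite cosBpihalf.
Qed.

Lemma ae_log_average_cvg : {ae P, forall w, forall phi : R -> R, bounded_continuous phi ->
  cvgf (Lam w) gint phi}.
Proof.
have ae_sinc := ae_foralln ae_sinc_cvg.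
apply: filterS2 ae_trig_cvg ae_sinc => w trig sincw phi bcphi.
apply: weak_cvg => //.
- by move=> n; exact: posfun_log_average.
- exact: posfun_gint.
- exact: gint1.
- move=> e e0; apply: sinc_tight => //; first by move=> n; exact: posfun_log_average.
  have [+ _] := trig 0%N 0%N; rewrite (_ : (fun x => _) = fun=> 1) //.
  by apply/funext => x; rewrite !mul0r cos0.
Qed.

End almost_sure_convergence.

(** ln n <= gamma_n <= 1 + ln n, so the quotient differs from 1 by at most 1 / ln n. *)
Lemma gamma_div_ln_cvg (R : realType) : gamma n / ln n%:R @[n --> \oo] --> (1 : R).
Proof.
apply/cvgrPdist_le => e e0; have [N hN] := gamma_unbounded (1 + e^-1).
exists N.+1 => // -[|n] //= Nn.
have hn := lt_le_trans hN (gamma_mono (ltnW Nn)).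
have h1 := @gamma_le_ln R n.
have h2 : ln n.+1%:R <= gamma n.+1 :> R.
  by apply: le_trans (ln_le_gamma _); rewrite ler_ln ?posrE ?ltr0n // ler_nat.
have e1 : 0 < e^-1 by rewrite invr_gt0.
move: h1 h2; set L : R := ln _; set g := gamma n.+1 => h1 h2.
have L1 : e^-1 < L by rewrite -/g in hn; lra.
have L0 : 0 < L by lra.
have -> : 1 - g / L = (L - g) / L by field; rewrite gt_eqF.
rewrite normrM normfV (gtr0_norm L0) ler_pdivrMr // ler0_norm ?subr_le0 //.
have : 1 <= e * L by rewrite mulrC -ler_pdivrMr // mul1r ltW.
lra.
Qed.

Lemma ln_average_cvg (R : realType) (x : nat -> R) (a : R) :
  logsum x n / gamma n @[n --> \oo] --> a ->
  (ln n%:R)^-1 * (\sum_(1 <= k < n.+1) k%:R^-1 * x k) @[n --> \oo] --> a.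
Proof.
move=> cx.
have c : gamma n / ln n%:R * (logsum x n / gamma n) @[n --> \oo] --> a.
  by rewrite -[a]mul1r; apply: cvgM cx; exact: gamma_div_ln_cvg.
apply: cvg_trans c; apply: near_eq_cvg; exists 1%N => // n /= n1.
have g0 : gamma n != 0 :> R by rewrite gt_eqF // (lt_le_trans ltr01) // gamma_ge1.
rewrite -/(logsum x n) [_ / ln _]mulrC -mulrA [gamma n * _]mulrC divfK //.
Qed.

Theorem theorem3p2 (R : realType) (d : measure_display) (T : measurableType d)
    (P : probability T R) (Y : nat -> {RV P >-> R}) (l : nat)
    (f : nat -> l.-tuple nat -> R) (F : nat -> {RV P >-> R}) :
  iid_rademacher Y ->
  (2 <= l)%N ->
  (forall n, (1 <= n)%N -> sym_offdiag_kernel (f n)) ->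
  (forall n, (1 <= n)%N -> is_J Y (f n) (F n)) ->
  (forall n, (1 <= n)%N -> l`!%:R * l2_norm (f n) ^+ 2 = 1) ->
  (forall m, (1 <= m <= l - 1)%N ->
    l2_norm (star m (f n) (f n)) @[n --> \oo] --> (0 : R)) ->
  (\sum_(2 <= n <oo)
     ((n%:R * gamma n ^+ 3)^-1 *
      \sum_(1 <= k < n.+1) \sum_(1 <= j < n.+1)
        `|l2_dot (f k) (f j)| / (k%:R * j%:R))%:E < +oo)%E ->
  (forall m, (1 <= m <= l - 1)%N ->
    (\sum_(2 <= n <oo)
       ((n%:R * gamma n ^+ 2)^-1 *
        \sum_(1 <= k < n.+1) k%:R^-1 * l2_norm (star m (f k) (f k)))%:E
     < +oo)%E) ->
  ASCLT F.
Proof.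
move=> rY l2l kerf JF normf star0 hrho hstar; split.
  exact: (law_cvg rY l2l kerf JF normf star0).
have [K cov_sumK] := cov_sum_bounded_sums hrho hstar.
have := ae_log_average_cvg rY l2l kerf JF normf cov_sumK.
apply: filterS => w hw phi bcphi.
exact: (ln_average_cvg (hw phi bcphi)).
Qed.
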